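(* For any $-\frac12<d<0$ and $\lambda>0$, the space $\mathcal{A}_2$ is isometric to $$\overline{\mathrm{Sp}}(S^{I\!I}_{d,\lambda})=\Big\{X\in L^2(\Omega):\ \|\mathcal{I}^{d,\lambda}(f_n)-X\|_{L^2(\Omega)}\to 0\text{ for some sequence }(f_n)_{n\in\mathbb{N}}\subseteq\mathcal{E}\Big\}.$$
   Context: Driving Lévy process. $L=\{L(t)\}_{t\in\mathbb{R}}$ is the two-sided Lévy process $L(t)=L_1(t)\mathbf 1_{[0,\infty)}(t)-L_2((-t)-)\mathbf 1_{(-\infty,0)}(t)$, where $L_1,L_2$ are independent copies of a Lévy process on $[0,\infty)$. It is centered ($\mathbb{E}[L(1)]=0$), has no Brownian component, and $\mathbb{E}[e^{i\theta L(t)}]=e^{t\psi(\theta)}$ for $t\ge 0$, with $\psi(\theta)=\int_{\mathbb{R}}(e^{i\theta x}-1-i\theta x)\,\nu(dx)$, where the Lévy measure $\nu$ satisfies $\nu(\{0\})=0$, $\int_{\mathbb{R}}(|x|^2\wedge 1)\,\nu(dx)<\infty$ and $\int_{|x|>1}x^2\,\nu(dx)<\infty$; hence $\mathbb{E}[L(1)^2]<\infty$. For deterministic $f\in L^2(\mathbb{R})$, $\int_{\mathbb{R}} f\,dL$ is the usual Wiener-type integral in $L^2(\Omega)$, with $\mathbb{E}[\int f\,dL\int g\,dL]=\mathbb{E}[L(1)^2]\int fg$. TFLP II. With $(x)_+=x\mathbf 1_{\{x>0\}}$, $(x)_+^p=x^p$ for $x>0$ and $0$ for $x\le0$, and oriented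 integrals, the tempered fractional Lévy process of the second kind is $$S^{I\!I}_{d,\lambda}(t)=\frac{1}{\Gamma(d+1)}\int_{\mathbb{R}}\Big[(t-y)_+^{d}e^{-\lambda(t-y)_+}-(-y)_+^{d}e^{-\lambda(-y)_+}+\lambda\int_0^t(s-y)_+^{d}e^{-\lambda(s-y)_+}ds\Big]dL(y),\ t\in\mathbb{R}.$$ Integrands. $\mathcal{E}$ is the space of step functions $f=\sum_{i=1}^n a_i\mathbf 1_{[t_i,t_{i+1})}$ with $a_i,t_i$ real and $t_i\le t_{i+1}$; for such $f$, $\mathcal{I}^{d,\lambda}(f)=\sum_{i=1}^n a_i[S^{I\!I}_{d,\lambda}(t_{i+1})-S^{I\!I}_{d,\lambda}(t_i)]$. $\widehat f$ is the $L^2$ Fourier transform with kernel $e^{-i\omega x}$ (up to a normalizing constant). For $\kappa>0$, $W^{\kappa,2}(\mathbb{R})=\{f\in L^2(\mathbb{R}):\int_{\mathbb{R}}(\lambda^2+\omega^2)^{\kappa}|\widehat f(\omega)|^2d\omega<\infty\}$, and for $f\in W^{\kappa,2}(\mathbb{R})$ the negative tempered fractional derivative $\mathbb{D}^{\kappa,\lambda}_{-}f$ is the unique element of $L^2(\mathbb{R})$ with Fourier transform $(\lambda-i\omega)^{\kappa}\widehat f(\omega)$. Finally, $$\mathcal{A}_2=\{f\in W^{-d,2}(\mathbb{R}):\varphi_f=\mathbb{D}^{-d,\lambda}_{-}f\text{ for some }\varphi_f\in L^2(\mathbb{R})\},\qquad\langle f,g\rangle_{\mathcal{A}_2}=\l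angle\varphi_f,\varphi_g\rangle_{L^2(\mathbb{R})}.$$
   Formalization: The Lévy measure ν is assumed nonzero (L is not identically zero); for ν = 0 the closed span is {0} while 𝒜₂ is infinite dimensional, so the claim as printed fails in that case. *)

(* Defs.v *)
(* L^2 functions are genuine functions; the identification of a.e. equal
   functions is made explicit where it matters, in [isometric]. *)
From HB Require Import structures.
From mathcomp Require Export all_boot all_order all_algebra.
From mathcomp Require Export all_classical all_reals all_analysis.
From mathcomp Require Import complex.

Set Implicit Arguments.
Unset Strict Implicit.
Unset Printing Implicit Defensive.

Import Order.TTheory GRing.Theory Num.Theory numFieldNormedType.Exports.

Local Open Scope classical_set_scope.
Local Open Scope ring_scope.

Notation leb R := (@lebesgue_measure R).

Section Lsq.
Context d (T : measurableType d) (R : realType).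
Variable mu : {measure set T -> \bar R}.

Definition Lsq : set (T -> R) := [set f | f \in Lfun mu 2%:E].

Definition L2dot (f g : T -> R) : R := (\int[mu]_x (f x * g x))%R.

Definition L2cvg (f : nat -> T -> R) (g : T -> R) : Prop :=
  'N[mu]_2%:E[EFin \o (fun x => f n x - g x)%R]%E @[n --> \oo] --> 0%E.

End Lsq.

(* [A] and [B], with inner products [dotA] and [dotB] and functions identified
   when a.e. equal, are isometric: there is a linear bijection preserving the
   inner products. *)
Definition isometric (R : realType)
    (d1 : measure_display) (T1 : measurableType d1)
    (mu1 : {measure set T1 -> \bar R})
    (A : set (T1 -> R)) (dotA : (T1 -> R) -> (T1 -> R) -> R)
    (d2 : measure_display) (T2 : measurableType d2)
    (mu2 : {measure set T2 -> \bar R})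
    (B : set (T2 -> R)) (dotB : (T2 -> R) -> (T2 -> R) -> R) : Prop :=
  exists U : (T1 -> R) -> (T2 -> R),
    [/\ (forall f, A f -> B (U f)),
        (forall f g, A f -> A g -> (f = g %[ae mu1] <-> U f = U g %[ae mu2])),
        (forall h, B h -> exists2 f, A f & U f = h %[ae mu2]),
        (forall (a : R) f g, A f -> A g ->
           U (fun x => a * f x + g x) = (fun x => a * U f x + U g x) %[ae mu2])
      & (forall f g, A f -> A g -> dotB (U f) (U g) = dotA f g)].

Section complex_functions.
Variable R : realType.
Implicit Types z : R[i].

Definition sqmod z : R := complex.Re z ^+ 2 + complex.Im z ^+ 2.

Definition cexp z : R[i] :=
  Complex (expR (complex.Re z) * cos (complex.Im z))
          (expR (complex.Re z) * sin (complex.Im z)).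

(* Principal branch of z ^ k on the half-plane Re z > 0, where the argument
   of z is atan (Im z / Re z). *)
Definition rhp_pow z (k : R) : R[i] :=
  Complex (sqmod z `^ (k / 2)) 0 *
  cexp (Complex 0 (k * atan (complex.Im z / complex.Re z))).

Definition cintegral d (T : measurableType d) (mu : {measure set T -> \bar R})
    (f : T -> R[i]) : R[i] :=
  Complex (\int[mu]_x complex.Re (f x)) (\int[mu]_x complex.Im (f x)).

End complex_functions.

Section levy.
Context d (Om : measurableType d) (R : realType) (P : probability Om R).
Variable nu : {measure set (measurableTypeR R) -> \bar R}.
Implicit Types X Y : R -> Om -> R.

Definition levy_measure : Prop :=
  [/\ nu [set 0] = 0%E,
      (\int[nu]_x (Num.min (`|x| ^+ 2) 1)%R%:E < +oo)%E
    & (\int[nu]_(x in [set x : R | (1 < `|x|)%R]) (x ^+ 2)%R%:E < +oo)%E].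

Definition levy_exponent (th : R) : R[i] :=
  cintegral nu (fun x : R =>
    cexp (Complex 0 (th * x)) - 1 - Complex 0 (th * x)).

Definition independent_increments X : Prop :=
  forall (n : nat) (t : nat -> R) (B : nat -> set R),
    0 <= t 0%N ->
    (forall i, (i < n)%N -> t i <= t i.+1) ->
    (forall i, measurable (B i)) ->
    P (\bigcap_(i < n) ((fun w => X (t i.+1) w - X (t i) w) @^-1` B i)) =
    (\prod_(i < n) P ((fun w => X (t i.+1) w - X (t i) w)%R @^-1` B i))%E.

Definition stationary_increments X : Prop :=
  forall (s t : R) (B : set R), 0 <= s -> 0 <= t -> measurable B ->
    P ((fun w => X (s + t) w - X s w) @^-1` B) =
    P ((fun w => X t w - X 0 w) @^-1` B).

Definition cadlag X : Prop :=
  forall (w : Om) (t : R),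
    (0 <= t -> X s w @[s --> t^'+] --> X t w) /\
    (0 < t -> cvg (X s w @[s --> t^'-])).

(* Only the values at times t >= 0 matter.  The form of [levy_exponent]
   expresses that there is no Brownian component and no drift. *)
Record levy_process X : Prop := LevyProcess {
  levy_measurable : forall t, 0 <= t -> measurable_fun setT (X t);
  levy_start : {ae P, forall w, X 0 w = 0};
  levy_indep : independent_increments X;
  levy_stat : stationary_increments X;
  levy_cadlag : cadlag X;
  levy_centered : ('E_P[X 1%R] = 0)%E;
  levy_charfun : forall t th, 0 <= t ->
    cintegral P (fun w => cexp (Complex 0 (th * X t w))) =
    cexp (Complex t 0 * levy_exponent th) }.

Definition process_sigma X : set (set Om) :=
  <<s [set X t @^-1` B | t in [set t : R | 0 <= t]
                       & B in [set B : set R | measurable B]] >>.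

Definition independent_processes X Y : Prop :=
  forall A B, process_sigma X A -> process_sigma Y B ->
    P (A `&` B) = (P A * P B)%E.

(* Two Levy processes with the same exponent have the same law, so these are
   independent copies of one Levy process. *)
Definition independent_levy_copies X Y : Prop :=
  [/\ levy_process X, levy_process Y & independent_processes X Y].

Definition two_sided X Y : R -> Om -> R :=
  fun t w => if 0 <= t then X t w else - lim (Y s w @[s --> (- t)^'-]).

End levy.

(* A presentation  sum_(i < n) a_i 1_[t_i, t_(i+1))  of a step function. *)
Record step (R : realType) := Step {
  step_n : nat;
  step_a : nat -> R;
  step_t : nat -> R;
  step_le : forall i, (i < step_n)%N -> step_t i <= step_t i.+1 }.

Section step_integral.
Variable R : realType.

Definition step_fun (s : step R) : R -> R := fun x =>
  \sum_(i < step_n s) step_a s i * \1_(`[step_t s i, step_t s i.+1[) x.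

(* Finitely additive in the intervals, hence independent of the presentation
   of the step function. *)
Definition step_int (Om : Type) (Z : R -> Om -> R) (s : step R) : Om -> R :=
  fun w => \sum_(i < step_n s)
    step_a s i * (Z (step_t s i.+1) w - Z (step_t s i) w).

End step_integral.

Section wiener.
Context d (Om : measurableType d) (R : realType) (P : probability Om R).
Variable L : R -> Om -> R.

(* The Wiener-type integral: L^2 extension of the integral of step functions,
   determined up to a.s. equality. *)
Definition is_wiener_integral (f : R -> R) (X : Om -> R) : Prop :=
  [/\ Lsq (leb R) f, Lsq P X &
      exists s : nat -> step R,
        L2cvg (leb R) (fun n => step_fun (s n)) f /\
        L2cvg P (fun n => step_int L (s n)) X].

Definition wiener_integral (f : R -> R) : Om -> R :=
  xget (fun=> 0) [set X | is_wiener_integral f X].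

End wiener.

Section tflp2.
Variable R : realType.

Definition Gamma (z : R) : R :=
  (\int[leb R]_(x in `]0, +oo[) (x `^ (z - 1) * expR (- x)))%R.

Definition oriented_integral (a b : R) (f : R -> R) : R :=
  if a <= b then (\int[leb R]_(x in `[a, b]) f x)%R
  else - (\int[leb R]_(x in `[b, a]) f x)%R.

Definition pospow (x p : R) : R := if 0 < x then x `^ p else 0.

Definition tempered_pow (d lam x : R) : R :=
  pospow x d * expR (- (lam * Num.max x 0)).

Definition tflp2_kernel (d lam t y : R) : R :=
  tempered_pow d lam (t - y) - tempered_pow d lam (- y) +
  lam * oriented_integral 0 t (fun s => tempered_pow d lam (s - y)).

Context disp (Om : measurableType disp) (P : probability Om R).
Variable L : R -> Om -> R.

Definition tflp2 (d lam : R) : R -> Om -> R := fun t w =>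
  (Gamma (d + 1))^-1 * wiener_integral P L (tflp2_kernel d lam t) w.

Definition Sp_closure (d lam : R) : set (Om -> R) :=
  [set X | Lsq P X /\
     exists f : nat -> step R,
       L2cvg P (fun n => step_int (tflp2 d lam) (f n)) X].

End tflp2.

Section integrands.
Variable R : realType.
Implicit Types (f phi : R -> R) (F : R -> R[i]).

Definition fourier1 f : R -> R[i] := fun w =>
  cintegral (leb R) (fun x => Complex (f x) 0 * cexp (Complex 0 (- (w * x)))).

(* F represents the L^2 Fourier transform of f, defined by extending
   [fourier1] from L^1 `&` L^2. *)
Definition is_fourier2 f F : Prop :=
  [/\ Lsq (leb R) f,
      Lsq (leb R) (fun w => complex.Re (F w)),
      Lsq (leb R) (fun w => complex.Im (F w)) &
      exists h : nat -> R -> R,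
        [/\ (forall n, h n \in Lfun (leb R) 1%:E /\ Lsq (leb R) (h n)),
            L2cvg (leb R) h f &
            (\int[leb R]_w (sqmod (fourier1 (h n) w - F w)%R)%:E)%E
              @[n --> \oo] --> 0%E]].

Definition W2 (lam k : R) : set (R -> R) :=
  [set f | Lsq (leb R) f /\
     exists2 F, is_fourier2 f F &
       (\int[leb R]_w ((lam ^+ 2 + w ^+ 2) `^ k * sqmod (F w))%R%:E < +oo)%E].

Definition is_tempered_deriv (lam k : R) f phi : Prop :=
  Lsq (leb R) phi /\
  exists2 F, is_fourier2 f F &
    is_fourier2 phi (fun w => rhp_pow (Complex lam (- w)) k * F w).

(* Determined up to a.e. equality. *)
Definition tempered_deriv (lam k : R) f : R -> R :=
  xget (fun=> 0) [set phi | is_tempered_deriv lam k f phi].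

Definition A2 (d lam : R) : set (R -> R) :=
  [set f | W2 lam (- d) f /\ exists phi, is_tempered_deriv lam (- d) f phi].

Definition A2dot (d lam : R) f g : R :=
  L2dot (leb R) (tempered_deriv lam (- d) f) (tempered_deriv lam (- d) g).

End integrands.

(* Main.v *)
(* The isometry is [U f = s^-1 int phi_f dL], where [phi_f] is the tempered
   derivative of [f] and [s^2 = int x^2 nu(dx)] is the variance of [L 1].

   By Plancherel, [f |-> phi_f] maps A_2 onto all of L^2(R): on the Fourier side
   it is multiplication by a symbol bounded away from zero.  The Wiener integral
   multiplies inner products by [s^2], because the increments of [L] satisfy
   [E (L t - L s)^2 = s^2 |t - s|], the second moment being read off the
   characteristic function at the origin.

   It remains to see that the closed span of the process is the whole range of
   the Wiener integral, i.e. that its kernels [K_t] have dense span in L^2(R).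
   Up to a factor, [K_t y = h (t - y) - h (- y)] with
   [h x = g x + lam * int_0^x g] and [g x = (x_+)^d e^(- lam x)].  The convolution
   of [h] with [k x = (x_+)^(- d - 1) e^(- lam x)] is a positive multiple of the
   indicator of [x > 0] (a Beta integral).  So a function orthogonal to all
   [K_t - K_s] is orthogonal to all indicators of intervals, hence null. *)
Require Import Defs.
From mathcomp Require Import all_boot all_order all_algebra.
From mathcomp Require Import all_classical all_reals all_analysis.
From mathcomp Require Import measurable_realfun ring lra complex.

Set Implicit Arguments.
Unset Strict Implicit.
Unset Printing Implicit Defensive.

Import Order.TTheory GRing.Theory Num.Theory numFieldNormedType.Exports.

Local Open Scope classical_set_scope.
Local Open Scope ring_scope.

(** * L2 spaces *)

(** Two isometries must be extended from a dense class to all of [L^2], the Hartley transform and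
    the Wiener integral; both come from the single construction [L2_ext]. Everything stays real: a
    real function [q] encodes the Hermitian transform [hat q], so that preimages under the
    fractional derivative are real because the symbol is symmetric under [w |-> - w]. Since
    [tempered_deriv] and [wiener_integral] select arbitrary representatives, the proofs work with
    relations and compare functions only up to a.e. equality. The bound [- 1/2 < d] puts
    [(x_+)^d e^(- lam x)] in [L^2]; the bound [d < 0] makes the exponent [- d - 1] exceed [- 1], so
    that the averaging weight [k] is integrable. The function [h] itself has a positive limit at
    infinity and only its differences lie in [L^2]. Hence the convolution identity is proved
    pointwise, by Tonelli for nonnegative integrands, and orthogonality is averaged over translates
    of [K_t - K_s], which are again differences of kernels. *)

Section L2.
Context d (T : measurableType d) (R : realType) (mu : {measure set T -> \bar R}).
Implicit Types f g h : T -> R.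

Lemma LsqP f : Lsq mu f <->
  measurable_fun setT f /\ (\int[mu]_x (f x ^+ 2)%:E < +oo)%E.
Proof.
split=> [l2f|[mf foo]].
  split; first by move: l2f; rewrite /Lsq /= inE => /andP[]; rewrite inE.
  have /integrableP[_] := Lfun2_integrable_sqr l2f.
  apply: le_lt_trans; rewrite le_eqVlt; apply/orP; left; apply/eqP.
  by apply: eq_integral => x _ /=; rewrite ger0_norm ?sqr_ge0.
rewrite /Lsq /= inE; apply/andP; split; rewrite inE //= /finite_norm unlock poweR_lty//.
rewrite (eq_integral (fun x => (f x ^+ 2)%:E))// => x _ /=.
by rewrite powR_mulrn // real_normK // num_real.
Qed.

Lemma Lsq_measurable f : Lsq mu f -> measurable_fun setT f.
Proof. by case/LsqP. Qed.

Lemma L2dot_integrable f g : Lsq mu f -> Lsq mu g ->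
  mu.-integrable setT (EFin \o (fun x => f x * g x)).
Proof. by move=> lf lg; exact: (Lfun1_integrable _ _).1 (Lfun2_mul_Lfun1 lf lg). Qed.

Lemma LsqD f g : Lsq mu f -> Lsq mu g -> Lsq mu (f + g).
Proof.
move=> lf lg; apply/LsqP; split.
  by apply: measurable_funD; exact: Lsq_measurable.
have := integrableD measurableT (L2dot_integrable lf lf)
   (integrableD measurableT (L2dot_integrable lf lg)
     (integrableD measurableT (L2dot_integrable lf lg) (L2dot_integrable lg lg))).
move/(integrable_lty measurableT); apply: le_lt_trans.
rewrite le_eqVlt; apply/orP; left; apply/eqP; apply: eq_integral => x _ /=.
by rewrite -!EFinD fctE; congr EFin; ring.
Qed.

Lemma LsqZ (a : R) f : Lsq mu f -> Lsq mu (a \*o f).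
Proof.
move=> lf; apply/LsqP; split.
  by apply: measurable_funM => //; exact: Lsq_measurable.
have := integrableZl measurableT (a ^+ 2) (L2dot_integrable lf lf).
move/(integrable_lty measurableT); apply: le_lt_trans.
rewrite le_eqVlt; apply/orP; left; apply/eqP; apply: eq_integral => x _ /=.
by rewrite -EFinM; congr EFin; ring.
Qed.

Lemma LsqN f : Lsq mu f -> Lsq mu (- f).
Proof.
move=> lf; rewrite (_ : - f = (-1) \*o f); first exact: LsqZ.
by apply/funext => x /=; rewrite fctE mulN1r.
Qed.

Lemma LsqB f g : Lsq mu f -> Lsq mu g -> Lsq mu (f - g).
Proof. by move=> lf lg; apply: LsqD => //; exact: LsqN. Qed.

Lemma Lsq0 : Lsq mu (0 : T -> R).
Proof.
apply/LsqP; split; first exact: measurable_cst.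
by rewrite (eq_integral (cst 0%E)) ?integral0// => x _; rewrite /= expr0n.
Qed.

(** Squared norms are used in place of norms: they are polynomial in [L2dot], so Hilbert space
    identities close by [ring] or [lra] without square roots. *)
Definition sqn f : R := L2dot mu f f.

Lemma L2dotC f g : L2dot mu f g = L2dot mu g f.
Proof. by apply: eq_Rintegral => x _; rewrite mulrC. Qed.

Lemma L2dotDl f g h : Lsq mu f -> Lsq mu g -> Lsq mu h ->
  L2dot mu (f + g) h = L2dot mu f h + L2dot mu g h.
Proof.
move=> lf lg lh; rewrite /L2dot -RintegralD//.
- by apply: eq_Rintegral => x _; rewrite fctE mulrDl.
- exact: L2dot_integrable.
- exact: L2dot_integrable.
Qed.

Lemma L2dotZl a f h : Lsq mu f -> Lsq mu h ->
  L2dot mu (a \*o f) h = a * L2dot mu f h.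
Proof.
move=> lf lh; rewrite /L2dot -RintegralZl//; last exact: L2dot_integrable.
by apply: eq_Rintegral => x _; rewrite /= mulrA.
Qed.

Lemma L2dotNl f h : Lsq mu f -> Lsq mu h ->
  L2dot mu (- f) h = - L2dot mu f h.
Proof.
move=> lf lh; rewrite -[RHS]mulN1r -L2dotZl//; congr (L2dot mu _ h).
by apply/funext => x /=; rewrite fctE mulN1r.
Qed.

Lemma L2dotBl f g h : Lsq mu f -> Lsq mu g -> Lsq mu h ->
  L2dot mu (f - g) h = L2dot mu f h - L2dot mu g h.
Proof. by move=> lf lg lh; rewrite L2dotDl ?L2dotNl//; exact: LsqN. Qed.

Lemma L2dotDr f g h : Lsq mu f -> Lsq mu g -> Lsq mu h ->
  L2dot mu h (f + g) = L2dot mu h f + L2dot mu h g.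
Proof. by move=> lf lg lh; rewrite L2dotC L2dotDl// !(L2dotC h). Qed.

Lemma L2dotZr a f h : Lsq mu f -> Lsq mu h ->
  L2dot mu h (a \*o f) = a * L2dot mu h f.
Proof. by move=> lf lh; rewrite L2dotC L2dotZl// L2dotC. Qed.

Lemma L2dotBr f g h : Lsq mu f -> Lsq mu g -> Lsq mu h ->
  L2dot mu h (f - g) = L2dot mu h f - L2dot mu h g.
Proof. by move=> lf lg lh; rewrite L2dotC L2dotBl// !(L2dotC h). Qed.

Lemma sqn_ge0 f : 0 <= sqn f.
Proof. by apply: Rintegral_ge0 => x _; rewrite -expr2 sqr_ge0. Qed.

Lemma sqnE f : Lsq mu f -> (sqn f)%:E = (\int[mu]_x (f x ^+ 2)%:E)%E.
Proof.
move=> lf; rewrite /sqn /L2dot /Rintegral fineK//.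
exact: integrable_fin_num (L2dot_integrable lf lf).
Qed.

Lemma sqnD f g : Lsq mu f -> Lsq mu g ->
  sqn (f + g) = sqn f + 2 * L2dot mu f g + sqn g.
Proof.
move=> lf lg; rewrite /sqn !(L2dotDl, L2dotDr)//; last exact: LsqD.
by rewrite (L2dotC g f); ring.
Qed.

Lemma sqnZ a f : Lsq mu f -> sqn (a \*o f) = a ^+ 2 * sqn f.
Proof.
by move=> lf; rewrite /sqn !(L2dotZl, L2dotZr)//; [ring|exact: LsqZ].
Qed.

Lemma sqnN f : sqn (- f) = sqn f.
Proof. by apply: eq_Rintegral => x _; rewrite fctE mulrNN. Qed.

Lemma sqnBC f g : sqn (f - g) = sqn (g - f).
Proof. by rewrite -opprB sqnN. Qed.

Lemma sqnB f g : Lsq mu f -> Lsq mu g ->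
  sqn (f - g) = sqn f - 2 * L2dot mu f g + sqn g.
Proof.
move=> lf lg; rewrite sqnD ?sqnN; [|by []|exact: LsqN].
by rewrite (L2dotC f) L2dotNl// (L2dotC g); ring.
Qed.

Lemma sqn_eq0 f : Lsq mu f -> sqn f = 0 -> f = 0 %[ae mu].
Proof.
move=> lf s0.
have mf2 : measurable_fun setT (EFin \o (fun x => f x ^+ 2)).
  by apply/measurable_EFinP; apply: measurable_funX; exact: Lsq_measurable.
have : (\int[mu]_x `|(EFin \o (fun x => (f x ^+ 2)%R)) x|)%E = 0%E.
  transitivity (sqn f)%:E; last by rewrite s0.
  rewrite sqnE//; apply: eq_integral => x _ /=.
  by rewrite ger0_norm ?sqr_ge0.
move/(ae_eq_integral_abs mu measurableT mf2).
by apply: filterS => x /= h Tx; move: (h Tx) => -[/eqP]; rewrite sqrf_eq0 => /eqP.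
Qed.

Lemma Lsq_ae_eq f g : measurable_fun setT g -> f = g %[ae mu] ->
  Lsq mu f -> Lsq mu g.
Proof.
move=> mg fg /LsqP[mf foo]; apply/LsqP; split => //.
rewrite -(ge0_ae_eq_integral measurableT _ _ _ _ _ : (\int[mu]_x (f x ^+ 2)%:E)%E = _)//.
- by apply/measurable_EFinP; exact: measurable_funX.
- by apply/measurable_EFinP; exact: measurable_funX.
- by move=> x _; rewrite lee_fin sqr_ge0.
- by move=> x _; rewrite lee_fin sqr_ge0.
- by apply: filterS fg => x h Tx; rewrite h.
Qed.

Lemma L2dot_ae_eq f f' g : Lsq mu f -> Lsq mu f' -> Lsq mu g ->
  f = f' %[ae mu] -> L2dot mu f g = L2dot mu f' g.
Proof.
move=> lf lf' lg ff'; congr fine; apply: ae_eq_integral => //.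
- exact: measurable_int (L2dot_integrable lf lg).
- exact: measurable_int (L2dot_integrable lf' lg).
- by apply: filterS ff' => x h Tx; rewrite h.
Qed.

Lemma sqn_ae_eq f f' : Lsq mu f -> Lsq mu f' -> f = f' %[ae mu] -> sqn f = sqn f'.
Proof.
move=> lf lf' ff'; rewrite /sqn (L2dot_ae_eq lf lf')// L2dotC (L2dot_ae_eq lf lf')//.
Qed.

Lemma sqn0 : sqn (0 : T -> R) = 0.
Proof. by rewrite /sqn /L2dot /Rintegral integral0_eq// => x _; rewrite mul0r. Qed.

Lemma sqnB_eq0 f g : Lsq mu f -> Lsq mu g ->
  (f = g %[ae mu]) <-> sqn (f - g) = 0.
Proof.
move=> lf lg; split => [fg|/sqn_eq0].
  rewrite (@sqn_ae_eq _ 0) ?sqn0//; first exact: LsqB.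
    exact: Lsq0.
  by apply: filterS fg => x h Tx; rewrite !fctE h// subrr.
move=> /(_ (LsqB lf lg)); apply: filterS => x /[apply]; rewrite !fctE => /eqP.
by rewrite subr_eq0 => /eqP.
Qed.

(* Crude but sufficient triangle inequality, from the parallelogram law. *)
Lemma sqnB_tri f g h : Lsq mu f -> Lsq mu g -> Lsq mu h ->
  sqn (f - h) <= 2 * sqn (f - g) + 2 * sqn (g - h).
Proof.
move=> lf lg lh.
have <- : (f - g) + (g - h) = f - h by rewrite addrA subrK.
have := sqn_ge0 ((f - g) - (g - h)).
have l1 := LsqB lf lg; have l2 := LsqB lg lh.
by rewrite (sqnB l1 l2) (sqnD l1 l2); lra.
Qed.

(** The quadratic [t |-> sqn (t f - g)] is nonnegative; the bound is its value at the vertex. *)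
Lemma L2dot_CS f g : Lsq mu f -> Lsq mu g ->
  L2dot mu f g ^+ 2 <= sqn f * sqn g.
Proof.
move=> lf lg.
have key (t : R) : 0 <= sqn f * t ^+ 2 - 2 * t * L2dot mu f g + sqn g.
  have := sqn_ge0 ((t \*o f) - g); rewrite sqnB ?sqnZ ?L2dotZl//; last exact: LsqZ.
  by nra.
have [f0|f0] := eqVneq (sqn f) 0.
  (* With [sqn f = 0] the quadratic is affine in [t]; if its slope were nonzero, this [t] would give
     it the value [- sqn g - 2]. *)
  have := key ((sqn g + 1) / L2dot mu f g); rewrite f0 !mul0r.
  have [->|d0] := eqVneq (L2dot mu f g) 0; first by rewrite expr0n.
  have -> : 2 * ((sqn g + 1) / L2dot mu f g) * L2dot mu f g = 2 * (sqn g + 1).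
    by field.
  by have := sqn_ge0 g; lra.
have f1 : 0 < sqn f by rewrite lt0r f0 sqn_ge0.
have := key (L2dot mu f g / sqn f).
have -> : sqn f * (L2dot mu f g / sqn f) ^+ 2 - 2 * (L2dot mu f g / sqn f) * L2dot mu f g + sqn g
  = (sqn f * sqn g - L2dot mu f g ^+ 2) / sqn f by field.
by rewrite pmulr_lge0 ?invr_gt0// subr_ge0.
Qed.

End L2.

(** * Completeness of [L^2] *)

Section L2_complete.
Context d (T : measurableType d) (R : realType) (mu : {measure set T -> \bar R}).
Implicit Types f g h : T -> R.
Notation sqn := (sqn mu).

Lemma L2cvgP (u : nat -> T -> R) f : (forall n, Lsq mu (u n)) -> Lsq mu f ->
  L2cvg mu u f <-> (sqn (u n - f) @[n --> \oo] --> 0).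
Proof.
move=> lu lf; rewrite /L2cvg.
have E n : 'N[mu]_2%:E[EFin \o (fun x => u n x - f x)%R]%E = (Num.sqrt (sqn (u n - f)))%:E.
  rewrite unlock /= -powR12_sqrt ?sqn_ge0// -poweR_EFin; congr poweR.
  rewrite sqnE; last exact: LsqB.
  by apply: eq_integral => x _ /=; rewrite powR_mulrn// real_normK// num_real.
under eq_fun do rewrite E.
split=> [/fine_cvgP[_ c]|c].
  have -> : (fun n => sqn (u n - f)) = (fun n => Num.sqrt (sqn (u n - f)) * Num.sqrt (sqn (u n - f))).
    by apply/funext => n; rewrite -expr2 sqr_sqrtr// sqn_ge0.
  by rewrite -[X in _ --> X](mulr0 0); exact: cvgM.
apply: cvg_EFin; first exact: nearW.
by rewrite -[X in _ --> X]sqrtr0; apply: continuous_cvg => //; exact: sqrt_continuous.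
Qed.

(** Fatou's lemma, as a bound that survives a.e. limits. The absolute value in the conclusion is
    there because the limit [h] is known to be nonnegative only almost everywhere. *)
Lemma fatou_bound (g : nat -> T -> R) (h : T -> R) (c : \bar R) :
  (forall n, measurable_fun setT (g n)) -> measurable_fun setT h ->
  (forall n x, 0 <= g n x) ->
  {ae mu, forall x, g n x @[n --> \oo] --> h x} ->
  (forall n, \int[mu]_x (g n x)%:E <= c)%E ->
  (\int[mu]_x `|(h x)%:E| <= c)%E.
Proof.
move=> mg mh g0 gh gc.
have mgE n : measurable_fun setT (EFin \o g n) by apply/measurable_EFinP.
have g0E n x : setT x -> (0 <= (EFin \o g n) x)%E by rewrite lee_fin.
apply: le_trans (_ : _ <= limn_einf (fun n => \int[mu]_x (g n x)%:E))%E _.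
  apply: le_trans (fatou mu measurableT mgE g0E).
  rewrite le_eqVlt; apply/orP; left; apply/eqP; apply: ge0_ae_eq_integral => //.
  - by apply: measurableT_comp => //; apply/measurable_EFinP.
  - rewrite (_ : (fun x => _) = -%E \o (fun x => limn_esup (fun n => (- (g n x)%:E)%E))).
      apply: measurableT_comp => //.
      apply: (@measurable_fun_limn_esup _ _ _ _ (fun n x => - (g n x)%:E)%E) => n.
      exact: (measurableT_comp (@oppe_measurable _ setT) (mgE n)).
    by apply/funext => x /=; rewrite (limn_esupN (fun n => (g n x)%:E)) oppeK.
  - move=> x _; rewrite limn_einf_lim; apply: lime_ge; first exact: is_cvg_einfs.
    by apply: nearW => n; apply: le_ereal_inf_tmp => _ [m _ <-]; rewrite lee_fin.
  apply: filterS gh => x gx _.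
  have gxE : (EFin \o g n) x @[n --> \oo] --> (h x)%:E.
    by apply: cvg_EFin => //; exact: nearW.
  rewrite (cvg_limn_einf_sup gxE).1 gee0_abs// lee_fin.
  rewrite -(cvg_lim (@Rhausdorff R) gx); apply: limr_ge; last exact: nearW.
  by apply/cvg_ex; exists (h x).
rewrite limn_einf_lim; apply: lime_le; first exact: is_cvg_einfs.
apply: nearW => n; apply: le_trans (gc n).
by apply: ereal_inf_lbound; exists n => //=.
Qed.

Lemma cvg_of_increment_bound (v w : nat -> R) (S : R) :
  (forall k, `|v k.+1 - v k| <= w k) -> (forall n, \sum_(0 <= k < n) w k <= S) ->
  cvgn v.
Proof.
move=> vw wS.
have sE : series (fun k => v k.+1 - v k) = (fun n => v n - v 0%N).
  by apply/funext => n; rewrite /series /= telescope_sumr.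
have : cvgn (series (fun k => v k.+1 - v k : R^o)).
  apply: normed_cvg; apply: nondecreasing_is_cvgn.
    by apply: nondecreasing_series => n _ _; exact: normr_ge0.
  exists S => _ [n _ <-]; apply: le_trans (wS n).
  by apply: ler_sum => k _; exact: vw.
rewrite sE => /cvg_ex[l cl]; apply/cvg_ex; exists (l + v 0%N).
have : (fun n => (v n - v 0%N) + v 0%N) @ \oo --> l + v 0%N by exact: cvgD cl (cvg_cst _).
by under eq_fun do rewrite subrK.
Qed.

Lemma sum_half_le n : \sum_(0 <= k < n) 2^-1 ^+ k <= 2 :> R.
Proof.
have -> : \sum_(0 <= k < n) 2^-1 ^+ k = 2 - 2 * 2^-1 ^+ n :> R.
  elim: n => [|n IH]; first by rewrite big_geq// expr0 mulr1 subrr.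
  by rewrite big_nat_recr//= IH exprS; field.
by rewrite lerBlDr lerDl mulr_ge0// exprn_ge0.
Qed.

(** Riesz-Fischer: a fast subsequence [v] converges a.e. to the candidate [f], and Fatou applied to
    [u m - v k] with [m] fixed carries the Cauchy estimate over to the whole sequence. *)
Lemma L2_complete (u : nat -> T -> R) : (forall n, Lsq mu (u n)) ->
  (forall e, 0 < e -> exists N, forall m n, (N <= m)%N -> (N <= n)%N ->
     sqn (u m - u n) < e) ->
  exists2 f, Lsq mu f & sqn (u n - f) @[n --> \oo] --> 0.
Proof.
move=> lu cau.
have /choice[N NP] : forall k, exists N : nat, forall m n, (N <= m)%N -> (N <= n)%N ->
     sqn (u m - u n) < 4^-1 ^+ k.
  by move=> k; apply: cau; rewrite exprn_gt0.
pose phi := fix phi k := if k is k'.+1 then maxn (phi k').+1 (N k) else N 0%N.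
have phiN k : (N k <= phi k)%N by case: k => //= k; rewrite leq_maxr.
have philt k : (phi k < phi k.+1)%N by rewrite /= leq_maxl.
have phige k : (k <= phi k)%N by elim: k => // k IH; exact: leq_ltn_trans IH (philt k).
pose v k := u (phi k).
have lv k : Lsq mu (v k) by exact: lu.
have mv k : measurable_fun setT (v k) by exact: Lsq_measurable (lv k).
have vd k : sqn (v k.+1 - v k) <= 4^-1 ^+ k.
  by apply/ltW/NP; rewrite ?phiN// (leq_trans (phiN k))// ltnW.
(* The weight [2^k] spends half of the decay [4^(- k)]: the sum of the [D k] stays integrable, and
   [|a| <= 2^(- k) + 2^k a^2] makes the increments of [v] summable wherever that sum is finite. *)
pose D k x : R := 2 ^+ k * (v k.+1 x - v k x) ^+ 2.
have D0 k x : 0 <= D k x by apply: mulr_ge0; rewrite ?sqr_ge0// exprn_ge0.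
have mD k : measurable_fun setT (EFin \o D k).
  apply/measurable_EFinP; apply: measurable_funM => //.
  by apply: measurable_funX; exact: measurable_funB.
have ID k : (\int[mu]_x (D k x)%:E <= (2^-1 ^+ k)%:E)%E.
  under eq_integral do rewrite EFinM.
  rewrite ge0_integralZl//.
  - rewrite (_ : (\int[mu]_x _)%E = (sqn (v k.+1 - v k))%:E); last first.
      by rewrite sqnE//; exact: LsqB.
    rewrite -EFinM lee_fin (@le_trans _ _ (2 ^+ k * 4^-1 ^+ k))//.
      by rewrite ler_pM2l ?exprn_gt0.
    rewrite -exprMn (_ : 2 * 4^-1 = 2^-1 :> R)//; by field.
  - apply/measurable_EFinP; apply: measurable_funX; exact: measurable_funB.
  - by move=> x _; rewrite lee_fin sqr_ge0.
pose SD x := (\sum_(0 <= k <oo) (D k x)%:E)%E.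
have SD0 x : (0 <= SD x)%E by apply: nneseries_ge0 => k _ _; rewrite lee_fin.
have SDae : {ae mu, forall x, SD x \is a fin_num}.
  have iSD : mu.-integrable setT SD.
    apply/integrableP; split.
      by apply: ge0_emeasurable_sum => [k x _ _|k _]; [rewrite lee_fin|exact: mD].
    under eq_integral do rewrite gee0_abs//.
    rewrite integral_nneseries//; last by move=> k x _; rewrite lee_fin.
    apply: le_lt_trans (ltry 2).
    apply: lime_le.
      by apply: is_cvg_nneseries => k _ _; apply: integral_ge0 => x _; rewrite lee_fin.
    apply: nearW => n; apply: le_trans (_ : (\sum_(0 <= k < n) (2^-1 ^+ k)%:E <= _)%E).
      by apply: lee_sum => k _; exact: ID.
    by rewrite sumEFin lee_fin sum_half_le.
  by have := integrable_ae measurableT iSD; apply: filterS => x /(_ I).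
(* A limit superior is measurable whether or not [v] converges, and it is the limit wherever [v]
   does. *)
pose f x := fine (limn_esup (fun k => (v k x)%:E)).
have mf : measurable_fun setT f.
  apply: measurableT_comp => //.
  by apply: (@measurable_fun_limn_esup _ _ _ _ (fun n x => (v n x)%:E)) => n;
    apply/measurable_EFinP.
have vf : {ae mu, forall x, v k x @[k --> \oo] --> f x}.
  apply: filterS SDae => x Sx.
  have /cvg_ex[l vl] : cvgn (fun k => v k x).
    apply: (@cvg_of_increment_bound _ (fun k => 2^-1 ^+ k + D k x) (2 + fine (SD x))) => [k|n].
      rewrite /D; set a := v k.+1 x - v k x.
      have p0 : 0 < 2 ^+ k :> R by rewrite exprn_gt0.
      rewrite exprVn; set p := 2 ^+ k in p0 *.
      have -> : a ^+ 2 = `|a| ^+ 2 by rewrite real_normK ?num_real.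
      have := normr_ge0 a; set b := `|a| => b0.
      rewrite -(ler_pM2l p0) mulrDr mulfV ?gt_eqF//.
      by have := sqr_ge0 (p * b - 1); nra.
    rewrite big_split /= lerD ?sum_half_le//.
    rewrite -lee_fin fineK// -sumEFin; apply: nneseries_lim_ge => k _ _.
    by rewrite lee_fin.
  rewrite /f; have : (v k x)%:E @[k --> \oo] --> l%:E by apply: cvg_EFin => //; exact: nearW.
  by move/cvg_limn_einf_sup => -[_ ->].
have uf e : 0 < e -> exists N, forall m, (N <= m)%N ->
    (\int[mu]_x ((u m x - f x) ^+ 2)%:E <= e%:E)%E.
  move=> e0; have [M MP] := cau e e0; exists M => m Mm.
  have := @fatou_bound (fun k x => (u m x - v (k + M)%N x) ^+ 2) (fun x => (u m x - f x) ^+ 2) e%:E.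
  rewrite (eq_integral (fun x => ((u m x - f x) ^+ 2)%:E)); last first.
    by move=> x _; rewrite gee0_abs// lee_fin sqr_ge0.
  apply.
  - by move=> k; apply: measurable_funX; apply: measurable_funB => //; exact: Lsq_measurable (lu m).
  - by apply: measurable_funX; apply: measurable_funB => //; exact: Lsq_measurable (lu m).
  - by move=> k x; rewrite sqr_ge0.
  - apply: filterS vf => x vx.
    have vx' : v (k + M)%N x @[k --> \oo] --> f x by rewrite (cvg_shiftn M (fun k => v k x)).
    by apply: (cvgM (cvgB (cvg_cst (u m x)) vx') (cvgB (cvg_cst (u m x)) vx')).
  - move=> k; rewrite -[leLHS](sqnE (LsqB (lu m) (lv (k + M)%N))) lee_fin.
    by apply/ltW/MP => //; rewrite (leq_trans _ (phige _))// leq_addl.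
have lB m e : (\int[mu]_x ((u m x - f x) ^+ 2)%:E <= e%:E)%E -> Lsq mu (u m - f).
  move=> h; apply/LsqP; split; last exact: le_lt_trans h (ltry _).
  by apply: measurable_funB => //; exact: Lsq_measurable (lu m).
have lf : Lsq mu f.
  have [M MP] := uf 1 ltr01.
  rewrite (_ : f = u M - (u M - f)); last by rewrite opprB addrC subrK.
  by apply: LsqB => //; exact: lB (MP M _).
exists f => //; apply/cvgr0Pnorm_le => e e0; have [M MP] := uf e e0.
exists M => // m /= Mm; rewrite ger0_norm ?sqn_ge0// -lee_fin sqnE; last exact: LsqB.
exact: MP.
Qed.

End L2_complete.

(** * Continuity of the inner product, and density from orthogonality *)

Section L2_limits.
Context d (T : measurableType d) (R : realType) (mu : {measure set T -> \bar R}).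
Implicit Types (f g h : T -> R) (u v : nat -> T -> R).
Notation sqn := (sqn mu).
Notation Lsq := (Lsq mu).
Notation dot := (L2dot mu).
Notation cvg2 u f := (sqn (u n - f) @[n --> \oo] --> 0).

Lemma cvg0_le (a b : nat -> R) : (forall n, 0 <= a n) -> (forall n, a n <= b n) ->
  b n @[n --> \oo] --> 0 -> a n @[n --> \oo] --> 0.
Proof.
move=> a0 ab b0; apply: squeeze_cvgr (cvg_cst 0) b0.
by apply: nearW => n; rewrite a0 ab.
Qed.

Lemma cvg0_sqr (a : nat -> R) : a n ^+ 2 @[n --> \oo] --> 0 -> a n @[n --> \oo] --> 0.
Proof.
move=> a2; apply/norm_cvg0P.
have -> : (fun n => `|a n|) = (fun n => Num.sqrt (a n ^+ 2)).
  by apply/funext => n; rewrite sqrtr_sqr.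
by rewrite -[X in _ --> X]sqrtr0; apply: continuous_cvg => //; exact: sqrt_continuous.
Qed.

Lemma cvg2_dotl u f g : (forall n, Lsq (u n)) -> Lsq f -> Lsq g -> cvg2 u f ->
  dot (u n) g @[n --> \oo] --> dot f g.
Proof.
move=> lu lf lg uf; apply/subr_cvg0; apply: cvg0_sqr.
apply: (@cvg0_le _ (fun n => sqn (u n - f) * sqn g)) => [n|n|].
- exact: sqr_ge0.
- by rewrite -L2dotBl// L2dot_CS//; exact: LsqB.
- by rewrite -[X in _ --> X](mul0r (sqn g)); apply: cvgM uf (cvg_cst _).
Qed.

Lemma cvg2_dot u v f g : (forall n, Lsq (u n)) -> (forall n, Lsq (v n)) ->
  Lsq f -> Lsq g -> cvg2 u f -> cvg2 v g ->
  dot (u n) (v n) @[n --> \oo] --> dot f g.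
Proof.
move=> lu lv lf lg uf vg.
have -> : (fun n => dot (u n) (v n)) =
    (fun n => dot (u n - f) (v n - g) + (dot (u n) g + (dot (v n) f - dot f g))).
  apply/funext => n; rewrite L2dotBl//; last exact: LsqB.
  by rewrite !L2dotBr// (L2dotC _ f (v n)); ring.
rewrite [X in _ --> X](_ : _ = 0 + (dot f g + (dot g f - dot f g))); last first.
  by rewrite (L2dotC _ g f); ring.
apply: cvgD; last first.
  apply: cvgD; first exact: cvg2_dotl.
  by apply: cvgB; [exact: cvg2_dotl|exact: cvg_cst].
apply: cvg0_sqr; apply: (@cvg0_le _ (fun n => sqn (u n - f) * sqn (v n - g))) => [n|n|].
- exact: sqr_ge0.
- by apply: L2dot_CS; exact: LsqB.
- by rewrite -[X in _ --> X](mul0r 0); exact: cvgM.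
Qed.

Lemma cvg2_lin a u v f g : (forall n, Lsq (u n)) -> (forall n, Lsq (v n)) ->
  Lsq f -> Lsq g -> cvg2 u f -> cvg2 v g ->
  cvg2 (fun n => a \*o u n + v n) (a \*o f + g).
Proof.
move=> lu lv lf lg uf vg.
apply: (@cvg0_le _ (fun n => 2 * (a ^+ 2 * sqn (u n - f)) + 2 * sqn (v n - g))) => [n|n|].
- exact: sqn_ge0.
- have -> : (a \*o u n + v n) - (a \*o f + g) = (a \*o (u n - f)) - (g - v n).
    by apply/funext => x; rewrite !fctE /=; ring.
  rewrite -sqnZ; last exact: LsqB.
  rewrite (sqnBC _ (v n)).
  have l1 := LsqZ a (LsqB (lu n) lf); have l2 := LsqB lg (lv n).
  have := sqnB_tri l1 (Lsq0 _) l2.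
  by rewrite subr0 sub0r sqnN.
- rewrite -[X in _ --> X](_ : 2 * (a ^+ 2 * 0) + 2 * 0 = 0); last by rewrite !mulr0 addr0.
  apply: cvgD; apply: cvgM => //; try exact: cvg_cst.
  by apply: cvgM => //; exact: cvg_cst.
Qed.

Lemma cvg2B u v f g : (forall n, Lsq (u n)) -> (forall n, Lsq (v n)) ->
  Lsq f -> Lsq g -> cvg2 u f -> cvg2 v g ->
  cvg2 (fun n => u n - v n) (f - g).
Proof.
move=> lu lv lf lg uf vg; have := cvg2_lin (-1) lv lu lg lf vg uf.
have E (p q : T -> R) : -1 \*o q + p = p - q.
  by apply/funext => x; rewrite !fctE /= mulN1r addrC.
by rewrite E; under eq_fun do rewrite E.
Qed.

Lemma cvg2_sqnB u v f g : (forall n, Lsq (u n)) -> (forall n, Lsq (v n)) ->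
  Lsq f -> Lsq g -> cvg2 u f -> cvg2 v g ->
  sqn (u n - v n) @[n --> \oo] --> sqn (f - g).
Proof.
move=> lu lv lf lg uf vg; apply: cvg2_dot; try by move=> *; exact: LsqB.
- exact: cvg2B.
- exact: cvg2B.
Qed.

Lemma cvg2_uniq u f g : (forall n, Lsq (u n)) -> Lsq f -> Lsq g ->
  cvg2 u f -> cvg2 u g -> f = g %[ae mu].
Proof.
move=> lu lf lg uf ug; apply/sqnB_eq0 => //.
have h : sqn (u n - u n) @[n --> \oo] --> 0.
  by rewrite (_ : (fun n => _) = cst 0); [exact: cvg_cst|apply/funext => n; rewrite subrr sqn0].
exact: (cvg_unique (@Rhausdorff R) (cvg2_sqnB lu lu lf lg uf ug) h).
Qed.

Lemma cvg2_ae u f g : (forall n, Lsq (u n)) -> Lsq f -> Lsq g ->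
  f = g %[ae mu] -> cvg2 u f -> cvg2 u g.
Proof.
move=> lu lf lg fg; rewrite (_ : (fun n => sqn (u n - f)) = fun n => sqn (u n - g))//.
apply/funext => n; apply: sqn_ae_eq; [exact: LsqB|exact: LsqB|].
by apply: filterS fg => x h Tx; rewrite !fctE h.
Qed.

Lemma cvg2_cauchy u f : (forall n, Lsq (u n)) -> Lsq f -> cvg2 u f ->
  forall e, 0 < e -> exists N, forall m n, (N <= m)%N -> (N <= n)%N ->
     sqn (u m - u n) < e.
Proof.
move=> lu lf /cvgr0Pnorm_lt uf e e0.
have e4 : 0 < e / 4 by lra.
have [N _ NP] := uf _ e4; exists N => m n Nm Nn.
have := sqnB_tri (lu m) lf (lu n); rewrite (sqnBC _ f).
have := NP _ Nm; have := NP _ Nn; rewrite /= !ger0_norm ?sqn_ge0//.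
lra.
Qed.

(** The projection argument, for a subspace [M] that may fail to be closed: a minimising sequence
    for the distance from [f] to [M] converges to some [p] with [f - p] orthogonal to [M], so
    [f = p] a.e. and the minimising sequence itself is the witness. *)
Lemma L2_perp_dense (M : set (T -> R)) : (forall f, M f -> Lsq f) -> M 0 ->
  (forall a f g, M f -> M g -> M (a \*o f + g)) ->
  (forall f, Lsq f -> (forall m, M m -> dot f m = 0) -> f = 0 %[ae mu]) ->
  forall f, Lsq f -> exists2 u, (forall n, M (u n)) & cvg2 u f.
Proof.
move=> lM M0 Mlin Mperp f lf.
pose E := [set sqn (f - m) | m in M].
have infE : has_inf E.
  split; first by exists (sqn (f - 0)), 0.
  by exists 0 => _ [m _ <-]; exact: sqn_ge0.
pose de := inf E.
have deP m : M m -> de <= sqn (f - m).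
  by move=> Mm; apply: ge_inf; [exact: infE.2|exists m].
have /choice[u uP] : forall n : nat, exists m, M m /\ sqn (f - m) < de + n.+1%:R^-1.
  move=> n; have i0 : 0 < n.+1%:R^-1 :> R by rewrite invr_gt0.
  by have [_ [m Mm <-] h] := inf_adherent i0 infE; exists m.
have Mu n : M (u n) by have [] := uP n.
have lu n : Lsq (u n) by exact: lM.
(* Parallelogram law: the midpoint of [u i] and [u k] lies in [M], hence is at squared distance at
   least [de] from [f]. As [Mlin] only forms [a f + g], the midpoint is built in two
   applications. *)
have udiff i k : sqn (u i - u k) <= 2 * i.+1%:R^-1 + 2 * k.+1%:R^-1.
  have := Mlin 2^-1 _ _ (Mu k) M0; rewrite addr0 => Mk.
  have Mh := Mlin 2^-1 _ _ (Mu i) Mk.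
  have := deP _ Mh.
  have -> : f - (2^-1 \*o u i + 2^-1 \*o u k) = 2^-1 \*o ((f - u i) + (f - u k)).
    by apply/funext => x; rewrite !fctE /=; field.
  have l1 := LsqB lf (lu i); have l2 := LsqB lf (lu k).
  rewrite sqnZ; last exact: LsqD.
  have -> : u i - u k = (f - u k) - (f - u i).
    by apply/funext => x; rewrite !fctE /=; ring.
  rewrite (sqnB l2 l1) (sqnD l1 l2) (L2dotC _ (f - u k)).
  have [_ h1] := uP i; have [_ h2] := uP k.
  have -> : 2^-1 ^+ 2 = 4^-1 :> R by field.
  by move: h1 h2; move: (i.+1%:R^-1) (k.+1%:R^-1) => a b; lra.
have inv0 : (n.+1%:R^-1 : R) @[n --> \oo] --> 0 by exact: cvg_harmonic.
have [p lp up] : exists2 p, Lsq p & cvg2 u p.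
  apply: L2_complete => // e e0.
  have e4 : 0 < e / 4 by lra.
  have /cvgr0Pnorm_lt/(_ _ e4)[N _ NP] := inv0.
  exists N => m n Nm Nn; apply: le_lt_trans (udiff m n) _.
  have := NP _ Nm; have := NP _ Nn; rewrite /= !ger0_norm ?invr_ge0//.
  by move: (m.+1%:R^-1) (n.+1%:R^-1) => a b; lra.
exists u => //; apply: (@cvg2_ae u p) => //.
have lfp := LsqB lf lp.
have : f - p = 0 %[ae mu].
  apply: Mperp => // m Mm.
  have lm := lM _ Mm.
  (* Moving [u n] by [- t m] inside [M] cannot bring it closer to [f] than the infimum; in the limit
     this is a quadratic inequality in [t] without constant term, which forces the linear
     coefficient to vanish. *)
  have key (t : R) : 0 <= t ^+ 2 * sqn m - 2 * t * dot (f - p) m.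
    have b n : 0 <= n.+1%:R^-1 - 2 * t * dot (f - u n) m + t ^+ 2 * sqn m.
      have lfu := LsqB lf (lu n).
      have := deP _ (Mlin t _ _ Mm (Mu n)).
      have -> : f - (t \*o m + u n) = (f - u n) - (t \*o m).
        by apply/funext => x; rewrite !fctE /=; ring.
      rewrite sqnB ?sqnZ ?L2dotZr//; last exact: LsqZ.
      by have [_] := uP n; move: (n.+1%:R^-1) => a; lra.
    have c : n.+1%:R^-1 - 2 * t * dot (f - u n) m + t ^+ 2 * sqn m @[n --> \oo] -->
             0 - 2 * t * dot (f - p) m + t ^+ 2 * sqn m.
      apply: cvgD; last exact: cvg_cst.
      apply: cvgB => //; apply: cvgM; first exact: cvg_cst.
      apply: cvg2_dotl => //; first by move=> n; exact: LsqB.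
      apply: cvg2B => //.
      by rewrite (_ : (fun n => _) = cst 0); [exact: cvg_cst|apply/funext => n; rewrite subrr sqn0].
    have : 0 <= 0 - 2 * t * dot (f - p) m + t ^+ 2 * sqn m.
      rewrite -(cvg_lim (@Rhausdorff R) c); apply: limr_ge; last exact: nearW.
      by apply/cvg_ex; eexists; exact: c.
    by lra.
  have [m0|m0] := eqVneq (sqn m) 0.
    by have := key 1; have := key (-1); rewrite m0; lra.
  have sm : 0 < sqn m by rewrite lt0r m0 sqn_ge0.
  have := key (dot (f - p) m / sqn m).
  have -> : (dot (f - p) m / sqn m) ^+ 2 * sqn m - 2 * (dot (f - p) m / sqn m) * dot (f - p) m
    = - (dot (f - p) m ^+ 2 / sqn m) by field.
  rewrite oppr_ge0 pmulr_lle0 ?invr_gt0// => h.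
  have : dot (f - p) m ^+ 2 == 0 by rewrite eq_le h sqr_ge0.
  by rewrite sqrf_eq0 => /eqP.
by apply: filterS => x h Tx; move: (h Tx); rewrite !fctE => /eqP; rewrite subr_eq0 => /eqP.
Qed.

End L2_limits.

(** * Continuous extensions and step functions *)

Section L2_extension.
Context d1 (T1 : measurableType d1) d2 (T2 : measurableType d2) (R : realType).
Context (mu1 : {measure set T1 -> \bar R}) (mu2 : {measure set T2 -> \bar R}).
(** The index [i] stands for a presentation of an element of the dense class. The image [j i]
    depends on the presentation and not on the function [e i]; [iso] ensures that two presentations
    of one function have a.e. equal images. The instances take [c] to be [2 * pi] for the Hartley
    transform and the variance for the Wiener integral. *)
Variables (I : Type) (e : I -> T1 -> R) (j : I -> T2 -> R) (c : R).
Hypothesis le : forall i, Lsq mu1 (e i).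
Hypothesis lj : forall i, Lsq mu2 (j i).
Hypothesis iso : forall i k, sqn mu2 (j i - j k) = c * sqn mu1 (e i - e k).
Hypothesis dense : forall f, Lsq mu1 f ->
  exists s : nat -> I, sqn mu1 (e (s n) - f) @[n --> \oo] --> 0.
Hypothesis lin : forall (a : R) i k, exists m,
  e m = a \*o e i + e k /\ j m = a \*o j i + j k.
Implicit Types (f g : T1 -> R) (X Y : T2 -> R).

(* The graph of the continuous extension of [e i |-> j i].  Being a relation,
   it needs no choice of representatives of a.e. classes. *)
Definition L2_ext f X := [/\ Lsq mu1 f, Lsq mu2 X &
  exists s : nat -> I, sqn mu1 (e (s n) - f) @[n --> \oo] --> 0 /\
                       sqn mu2 (j (s n) - X) @[n --> \oo] --> 0].

Lemma L2_ext_exists f : Lsq mu1 f -> exists X, L2_ext f X.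
Proof.
move=> lf; have [s sf] := dense lf.
have [|X lX sX] := @L2_complete _ _ _ mu2 (fun n => j (s n)) (fun n => lj _).
  move=> r r0.
  have c1 : 0 < `|c| + 1 by rewrite ltr_wpDl.
  have rc : 0 < r / (`|c| + 1) by rewrite divr_gt0.
  have [N NP] := cvg2_cauchy (fun n => le (s n)) lf sf rc.
  exists N => m n Nm Nn; rewrite iso.
  have := NP _ _ Nm Nn; rewrite ltr_pdivlMr// mulrC; apply: le_lt_trans.
  by apply: ler_wpM2r; [exact: sqn_ge0|rewrite (le_trans (ler_norm _))// lerDl].
by exists X; split => //; exists s.
Qed.

Lemma L2_ext_iso f g X Y : L2_ext f X -> L2_ext g Y ->
  sqn mu2 (X - Y) = c * sqn mu1 (f - g).
Proof.
move=> [lf lX [s [sf sX]]] [lg lY [t [tg tY]]].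
have c2 := cvg2_sqnB (fun n => lj (s n)) (fun n => lj (t n)) lX lY sX tY.
have c1 := cvg2_sqnB (fun n => le (s n)) (fun n => le (t n)) lf lg sf tg.
have E : (fun n => sqn mu2 (j (s n) - j (t n))) = (fun n => c * sqn mu1 (e (s n) - e (t n))).
  by apply/funext => n; rewrite iso.
rewrite E in c2.
exact: (cvg_unique (@Rhausdorff R) c2 (cvgM (cvg_cst c) c1)).
Qed.

Lemma L2_ext_lin a f g X Y : L2_ext f X -> L2_ext g Y ->
  L2_ext (a \*o f + g) (a \*o X + Y).
Proof.
move=> [lf lX [s [sf sX]]] [lg lY [t [tg tY]]].
split; [by apply: LsqD => //; exact: LsqZ|by apply: LsqD => //; exact: LsqZ|].
have /choice[w wP] n := lin a (s n) (t n).
exists w; split.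
  have -> : (fun n => sqn mu1 (e (w n) - (a \*o f + g))) =
            (fun n => sqn mu1 ((a \*o e (s n) + e (t n)) - (a \*o f + g))).
    by apply/funext => n; rewrite (wP n).1.
  exact: cvg2_lin.
have -> : (fun n => sqn mu2 (j (w n) - (a \*o X + Y))) =
          (fun n => sqn mu2 ((a \*o j (s n) + j (t n)) - (a \*o X + Y))).
  by apply/funext => n; rewrite (wP n).2.
exact: cvg2_lin.
Qed.

Lemma L2_ext_ae f f' X X' : L2_ext f X -> Lsq mu1 f' -> Lsq mu2 X' ->
  f = f' %[ae mu1] -> X = X' %[ae mu2] -> L2_ext f' X'.
Proof.
move=> [lf lX [s [sf sX]]] lf' lX' ff' XX'; split => //.
by exists s; split; [exact: cvg2_ae sf|exact: cvg2_ae sX].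
Qed.

Lemma L2_ext0 : L2_ext 0 0.
Proof.
have [X fX] := L2_ext_exists (Lsq0 mu1).
have := L2_ext_lin (-1) fX fX.
rewrite [X in L2_ext X _](_ : _ = 0); last first.
  by apply/funext => x; rewrite !fctE /= mulr0 addr0.
by rewrite [X in L2_ext _ X](_ : _ = 0)//; apply/funext => x; rewrite !fctE /= mulN1r addNr.
Qed.

(** Polarisation: [L2_ext_iso] is applied to the pairs [(f, 0)], [(g, 0)] and [(f, g)]. *)
Lemma L2_ext_dot f g X Y : L2_ext f X -> L2_ext g Y ->
  L2dot mu2 X Y = c * L2dot mu1 f g.
Proof.
move=> fX gY; have [lf lX _] := fX; have [lg lY _] := gY.
have h1 := L2_ext_iso fX L2_ext0; have h2 := L2_ext_iso gY L2_ext0.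
have h3 := L2_ext_iso fX gY.
move: h1 h2 h3; rewrite !subr0 (sqnB lX lY) (sqnB lf lg); lra.
Qed.

(** By the isometry the images [Z n] converge to any image of [f]; uniqueness of limits identifies
    that image with [X]. *)
Lemma L2_ext_closed (F : nat -> T1 -> R) (Z : nat -> T2 -> R) f X :
  (forall n, L2_ext (F n) (Z n)) -> Lsq mu1 f -> Lsq mu2 X ->
  sqn mu1 (F n - f) @[n --> \oo] --> 0 ->
  sqn mu2 (Z n - X) @[n --> \oo] --> 0 -> L2_ext f X.
Proof.
move=> FZ lf lX Ff ZX.
have [X' fX'] := L2_ext_exists lf.
have [_ lX' _] := fX'.
apply: (L2_ext_ae fX') => //; first exact: (filterS _ filterT).
apply: cvg2_uniq ZX => //; first by move=> n; have [] := FZ n.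
rewrite (_ : (fun n => _) = (fun n => c * sqn mu1 (F n - f))).
  by rewrite -[X in _ --> X](mulr0 c); apply: cvgM => //; exact: cvg_cst.
by apply/funext => n; rewrite (L2_ext_iso (FZ n) fX').
Qed.

End L2_extension.

(** * Step integrals as linear combinations *)

Section step_algebra.
Variable R : realType.

Definition lincomb (Om : Type) (Z : R -> Om -> R) (l : seq (R * R)) : Om -> R :=
  fun w => \sum_(p <- l) p.1 * Z p.2 w.

(* By summation by parts, the step integrals of [Z] are exactly the
   combinations [lincomb Z l] with [wsum l = 0]. *)
Definition wsum (l : seq (R * R)) : R := \sum_(p <- l) p.1.

Lemma abel_sum (z c : nat -> R) n :
  \sum_(0 <= i < n.+1) c i * z i =
  (\sum_(0 <= i < n.+1) c i) * z n -
  \sum_(0 <= i < n) (\sum_(0 <= k < i.+1) c k) * (z i.+1 - z i).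
Proof.
elim: n => [|n IH]; first by rewrite !big_nat1 big_geq// subr0.
rewrite big_nat_recr//= IH [in RHS]big_nat_recr//= [X in _ = _ - X]big_nat_recr//=.
set s := \sum_(0 <= i < n.+1) c i; ring.
Qed.

(** After sorting the times, summation by parts gives the interval from [t i] to [t i.+1] minus the
    partial sum of the weights as its coefficient; the boundary term carries the total weight, which
    is zero. One [s] serves every [Om] and [Z], so that algebra done on presentations holds for step
    functions and for step integrals at once. *)
Lemma lincomb_step (l : seq (R * R)) : wsum l = 0 ->
  exists s : step R, forall Om (Z : R -> Om -> R), step_int Z s = lincomb Z l.
Proof.
move=> wl; pose r := (fun p q : R * R => p.2 <= q.2).
have rtot : total r by move=> p q; exact: le_total.
have rtrans : transitive r by move=> p q s; exact: le_trans.
pose l' := sort r l.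
have pl : perm_eq l' l by rewrite perm_sort.
case: (ltnP 0 (size l')) => [sl|]; last first.
  rewrite leqn0 size_eq0 => /eqP l0.
  exists (@Step R 0 (fun=> 0) (fun=> 0) (fun i h => lexx _)) => Om Z.
  apply/funext => w; rewrite /step_int /= big_ord0 /lincomb -(perm_big _ pl) l0.
  by rewrite big_nil.
pose c i := (nth (0, 0) l' i).1; pose t i := (nth (0, 0) l' i).2.
have tle i : (i < (size l').-1)%N -> t i <= t i.+1.
  move=> il; apply: (sortedP (0, 0) (sort_sorted rtot l)).
  by rewrite -[X in (_ < X)%N](prednK sl).
exists (@Step R _ (fun i => - \sum_(0 <= k < i.+1) c k) t tle) => Om Z.
apply/funext => w; rewrite /step_int /lincomb /= -(perm_big _ pl) /=.
rewrite (big_nth (0, 0)) -(prednK sl) (abel_sum (fun i => Z (t i) w) c).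
have -> : \sum_(0 <= i < (size l').-1.+1) c i = 0.
  by rewrite prednK// -(big_nth (0, 0) xpredT (fun p => p.1)) (perm_big _ pl).
rewrite mul0r sub0r big_mkord -sumrN; apply: eq_bigr => i _.
by rewrite mulNr.
Qed.

Definition step_seq (s : step R) : seq (R * R) :=
  flatten [seq [:: (step_a s i, step_t s i.+1); (- step_a s i, step_t s i)] |
    i <- iota 0 (step_n s)].

Lemma step_seqE (s : step R) Om (Z : R -> Om -> R) : lincomb Z (step_seq s) = step_int Z s.
Proof.
apply/funext => w; rewrite /lincomb /step_seq big_flatten /= big_map /step_int.
transitivity (\sum_(0 <= i < step_n s)
    step_a s i * (Z (step_t s i.+1) w - Z (step_t s i) w)); last by rewrite big_mkord.
by rewrite /index_iota subn0; apply: eq_bigr => i _; rewrite big_cons big_seq1 /=; ring.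
Qed.

Lemma wsum_step_seq (s : step R) : wsum (step_seq s) = 0.
Proof.
rewrite /wsum /step_seq big_flatten /= big_map big1// => i _.
by rewrite big_cons big_seq1 /= subrr.
Qed.

Lemma step_int_lin (a : R) (s t : step R) : exists r : step R,
  forall Om (Z : R -> Om -> R), step_int Z r = a \*o step_int Z s + step_int Z t.
Proof.
have [|r rP] := @lincomb_step ([seq (a * p.1, p.2) | p <- step_seq s] ++ step_seq t).
  by rewrite /wsum big_cat big_map /= -mulr_sumr -/(wsum _) -/(wsum _) !wsum_step_seq mulr0 addr0.
exists r => Om Z; rewrite rP; apply/funext => w.
rewrite fctE /= -!step_seqE /lincomb big_cat big_map /= mulr_sumr.
by congr (_ + _); apply: eq_bigr => p _; rewrite mulrA.
Qed.

(** A step function is the step integral of the deterministic process [t |-> 1_(x < t)], which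
    brings it under the algebra of [step_int]. *)
Lemma step_fun_int (s : step R) :
  step_fun s = step_int (fun t x : R => (x < t)%R%:R) s.
Proof.
apply/funext => x; rewrite /step_fun /step_int; apply: eq_bigr => i _; congr (_ * _).
have tt := step_le (ltn_ord i).
rewrite indicE mem_setE in_itv /=.
case: (ltP x (step_t s i)) => h1; case: (ltP x (step_t s i.+1)) => h2 //=; rewrite ?subrr ?subr0//.
by have := le_lt_trans (le_trans tt h2) h1; rewrite ltxx.
Qed.

Definition one_step (a b : R) (ab : a <= b) : step R :=
  @Step R 1 (fun=> 1) (fun i => if i is 0%N then a else b)
    (fun i (h : (i < 1)%N) => match i with 0%N => ab | _ => lexx b end).

Lemma one_step_int (a b : R) (ab : a <= b) Om (Z : R -> Om -> R) :
  step_int Z (one_step ab) = Z b - Z a.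
Proof. by apply/funext => w; rewrite /step_int /= big_ord1 mul1r. Qed.

End step_algebra.

(** * Translation, reflection and scaling of Lebesgue integrals *)

Section lebesgue_change.
Variable R : realType.
Notation mu := (leb R).
Implicit Types (f : R -> \bar R) (a b : R).

Notation RT := (measurableTypeR R).

Lemma measurable_shift b : measurable_fun [set: RT] (fun x : RT => x + b : RT).
Proof. exact: measurable_funD. Qed.

Lemma lebesgue_measure_shift b (A : set R) : measurable A ->
  pushforward mu (fun x : RT => x + b : RT) A = mu A.
Proof.
move=> mA; apply/esym/lebesgue_measure_unique => //=.
  exact: measurable_shift.
move=> _ _ [[u v]] _ <-; rewrite /= /pushforward.
rewrite (_ : _ @^-1` _ = `](u - b), (v - b)]%classic); last first.
  by apply/seteqP; split => x /=; rewrite !in_itv /= ltrBlDr lerBrDr.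
rewrite !lebesgue_measure_itv/= !lte_fin ltrD2r.
by case: ifP => // _; rewrite -!EFinD; congr EFin; ring.
Qed.

Lemma lebesgue_measure_scale a (a0 : 0 < a) (A : set R) : measurable A ->
  (a%:E * pushforward mu (fun x : RT => (a * x)%R : RT) A)%E = mu A.
Proof.
have ma : measurable_fun [set: RT] (fun x : RT => a * x : RT) by exact: measurable_funM.
move=> mA; apply/esym.
apply: (@lebesgue_measure_unique R (mscale (NngNum (ltW a0))
  (measure_function_pushforward__canonical__measure_function_Measure mu ma))) => //.
move=> _ [[u v]] _ <-; rewrite /= /mscale /= /pushforward.
rewrite (_ : _ @^-1` _ = `](u / a), (v / a)]%classic); last first.
  by apply/seteqP; split => x /=; rewrite !in_itv /= ltr_pdivrMr// ler_pdivlMr// mulrC.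
rewrite !lebesgue_measure_itv/= !lte_fin ltr_pM2r ?invr_gt0//.
case: ifP => // _; last by rewrite mule0.
by rewrite -!EFinD -EFinM; congr EFin; field; rewrite gt_eqF.
Qed.

Lemma ge0_integral_shift b f : measurable_fun setT f -> (forall x, 0 <= f x)%E ->
  (\int[mu]_x f (x + b)%R = \int[mu]_x f x)%E.
Proof.
move=> mf f0.
rewrite -[LHS](@ge0_integral_pushforward _ _ _ _ _ _ (measurable_shift b) mu setT f)//.
apply: eq_measure_integral => [|mb A mA _]; first exact: measurable_shift.
exact: lebesgue_measure_shift.
Qed.

Lemma ge0_integral_opp f : measurable_fun setT f -> (forall x, 0 <= f x)%E ->
  (\int[mu]_x f (- x)%R = \int[mu]_x f x)%E.
Proof.
move=> mf f0.
have mo : measurable_fun [set: RT] (fun x : RT => - x : RT) by exact: oppr_measurable.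
rewrite -[LHS](@ge0_integral_pushforward _ _ _ _ _ _ mo mu setT f)//.
by apply: eq_measure_integral => A mA _; exact: lebesgue_measureN.
Qed.

Lemma ge0_integral_scale a f : 0 < a -> measurable_fun setT f -> (forall x, 0 <= f x)%E ->
  (a%:E * \int[mu]_x f (a * x)%R = \int[mu]_x f x)%E.
Proof.
move=> a0 mf f0.
have ma : measurable_fun [set: RT] (fun x : RT => a * x : RT) by exact: measurable_funM.
rewrite -[X in (_ * X)%E](@ge0_integral_pushforward _ _ _ _ _ _ ma mu setT f)//.
have := @ge0_integral_mscale _ _ R
  (measure_function_pushforward__canonical__measure_function_Measure mu ma) setT measurableT (NngNum (ltW a0)) f mf.
move=> <- //; apply: eq_measure_integral => A mA _.
exact: lebesgue_measure_scale.
Qed.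

Lemma integral_shift b f : measurable_fun setT f ->
  (\int[mu]_x f (x + b)%R = \int[mu]_x f x)%E.
Proof.
move=> mf; rewrite integralE [RHS]integralE.
rewrite -(@ge0_integral_shift b f^\+%E)//; last exact: measurable_funepos.
rewrite -(@ge0_integral_shift b f^\-%E)//; last exact: measurable_funeneg.
by congr (_ - _)%E; apply: eq_integral => x _; rewrite ?funeposE ?funenegE.
Qed.

Lemma integral_opp f : measurable_fun setT f ->
  (\int[mu]_x f (- x)%R = \int[mu]_x f x)%E.
Proof.
move=> mf; rewrite integralE [RHS]integralE.
rewrite -(@ge0_integral_opp f^\+%E)//; last exact: measurable_funepos.
rewrite -(@ge0_integral_opp f^\-%E)//; last exact: measurable_funeneg.
by congr (_ - _)%E; apply: eq_integral => x _; rewrite ?funeposE ?funenegE.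
Qed.

Lemma Lsq_shift b (g : R -> R) : Lsq mu g -> Lsq mu (fun x => g (x + b)).
Proof.
move=> /LsqP[mg goo]; apply/LsqP; split.
  exact: measurableT_comp (measurable_shift b).
rewrite (@ge0_integral_shift b (fun x => (g x ^+ 2)%:E))//.
  by apply/measurable_EFinP; exact: measurable_funX.
by move=> x; rewrite lee_fin sqr_ge0.
Qed.

Lemma sqn_shift b (g : R -> R) : Lsq mu g -> sqn mu (fun x => g (x + b)) = sqn mu g.
Proof.
move=> lg; apply: EFin_inj; rewrite !sqnE//; last exact: Lsq_shift.
apply: (@ge0_integral_shift b (fun x => (g x ^+ 2)%:E)).
  by apply/measurable_EFinP; apply: measurable_funX; exact: Lsq_measurable lg.
by move=> x; rewrite lee_fin sqr_ge0.
Qed.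

Lemma Lsq_opp (g : R -> R) : Lsq mu g -> Lsq mu (fun x => g (- x)).
Proof.
move=> /LsqP[mg goo]; apply/LsqP; split; first exact: measurableT_comp.
rewrite (@ge0_integral_opp (fun x => (g x ^+ 2)%:E))//.
  by apply/measurable_EFinP; exact: measurable_funX.
by move=> x; rewrite lee_fin sqr_ge0.
Qed.

Lemma sqn_opp (g : R -> R) : Lsq mu g -> sqn mu (fun x => g (- x)) = sqn mu g.
Proof.
move=> lg; apply: EFin_inj; rewrite !sqnE//; last exact: Lsq_opp.
apply: (@ge0_integral_opp (fun x => (g x ^+ 2)%:E)).
  by apply/measurable_EFinP; apply: measurable_funX; exact: Lsq_measurable lg.
by move=> x; rewrite lee_fin sqr_ge0.
Qed.

End lebesgue_change.

(** * Density of step functions in [L^2(R)] *)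

Section step_dense.
Variable R : realType.
Notation mu := (leb R).

Lemma integral_sqr_indic (a b : R) :
  (\int[mu]_x ((\1_(`[a, b[) x : R) ^+ 2)%:E = mu `[a, b[)%E.
Proof.
transitivity (\int[mu]_x (\1_(`[a, b[) x)%:E)%E; last by rewrite integral_indic// setIT.
by apply: eq_integral => x _; rewrite indicE; case: (_ \in _); rewrite ?expr1n ?expr0n.
Qed.

Lemma Lsq_indic (a b : R) : Lsq mu \1_(`[a, b[).
Proof.
apply/LsqP; split; first exact: measurable_indic.
by rewrite integral_sqr_indic lebesgue_measure_itv; case: ifP => _; rewrite -?EFinD ltry.
Qed.

Lemma sqn_indic (a b : R) : a <= b -> sqn mu \1_(`[a, b[) = b - a.
Proof.
move=> ab; apply: EFin_inj; rewrite sqnE; last exact: Lsq_indic.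
rewrite integral_sqr_indic lebesgue_measure_itv /= lte_fin; case: ltP => // ba.
by have -> : a = b by [apply/eqP; rewrite eq_le ab ba]; rewrite subrr.
Qed.

(** Lebesgue differentiation: the primitive of [f] is constant, so its a.e. derivative [f] is zero.
    The cut-off to [[- n, n)] is needed because a square integrable function need not be integrable
    on the line. *)
Lemma indic_perp (f : R -> R) : Lsq mu f ->
  (forall a b, a <= b -> L2dot mu f \1_(`[a, b[) = 0) -> f = 0 %[ae mu].
Proof.
move=> lf f0.
pose g (n : nat) x : R := f x * \1_(`[- n%:R, n%:R[) x.
have ig n : mu.-integrable setT (EFin \o g n).
  exact: L2dot_integrable lf (Lsq_indic _ _).
have g0 n : {ae mu, forall x, g n x = 0}.
  have h1 y : mu.-integrable `]-oo, y] (EFin \o g n).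
    exact: (integrableS measurableT).
  have := FTC1Ny h1 (open_integrable_locally openT (ig n)).
  apply: filterS; first exact: (ae_filter_ringOfSetsType mu).
  move=> x [_ <-].
  rewrite (_ : (fun x => _) = cst 0) ?derive1_cst//.
  apply/funext => y; rewrite -Rintegral_itv_bndo_bndc; last exact: (integrableS measurableT).
  (* [y] is clamped to [[- n, n]], so that integrating [g n] up to [y] is integrating [f] over
     [[- n, b)]. *)
  pose b := Num.max (- n%:R) (Num.min n%:R y).
  have nn : (- n%:R : R) <= n%:R by rewrite (@le_trans _ _ 0)// oppr_le0.
  rewrite -(f0 (- n%:R) b); last by rewrite /b le_max lexx.
  rewrite Rintegral_mkcond; apply: eq_Rintegral => z _.
  rewrite patchE /g !indicE !mem_setE !in_itv /= /b lt_max lt_min.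
  by case: (ltP z y) => zy; case: (leP (- n%:R) z) => h //=; rewrite ?andbT ?andbF ?mulr0.
have : {ae mu, forall x, forall n, g n x = 0}.
  by apply/ae_foralln.
apply: filterS; first exact: (ae_filter_ringOfSetsType mu).
move=> x gx _.
have [n nx] : exists n : nat, `|x| < n%:R.
  by exists (Num.bound `|x|); apply: archi_boundP.
have := gx n; rewrite /g indicE mem_setE in_itv /=.
move: nx; rewrite ltr_norml => /andP[/ltW -> ->]; by rewrite mulr1.
Qed.

Lemma Lsq_step_fun (s : step R) : Lsq mu (step_fun s).
Proof.
rewrite /step_fun; elim: (step_n s) => [|n IH].
  rewrite (_ : (fun x => _) = 0); first exact: Lsq0.
  by apply/funext => x; rewrite big_ord0.
rewrite (_ : (fun x => _) = step_a s n \*o \1_(`[step_t s n, step_t s n.+1[) +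
   (fun x => \sum_(i < n) step_a s i * \1_(`[step_t s i, step_t s i.+1[) x)).
  by apply: LsqD => //; apply: LsqZ; exact: Lsq_indic.
by apply/funext => x; rewrite big_ord_recr /= addrC.
Qed.

Lemma step_fun_one (a b : R) (ab : a <= b) : step_fun (one_step ab) = \1_(`[a, b[).
Proof. by apply/funext => x; rewrite /step_fun /= big_ord1 mul1r. Qed.

Lemma step_fun_lin (a : R) (s t : step R) : exists r : step R,
  step_fun r = a \*o step_fun s + step_fun t.
Proof. by have [r rP] := step_int_lin a s t; exists r; rewrite !step_fun_int. Qed.

Lemma step_dense (f : R -> R) : Lsq mu f ->
  exists s : nat -> step R, sqn mu (step_fun (s n) - f) @[n --> \oo] --> 0.
Proof.
move=> lf.
pose M := range (@step_fun R).
have lM g : M g -> Lsq mu g by move=> [s _ <-]; exact: Lsq_step_fun.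
have M0 : M 0.
  exists (one_step (lexx 0)) => //; rewrite step_fun_one; apply/funext => x.
  by rewrite set_itvco0 ?indic0.
have Mlin (a : R) g h : M g -> M h -> M (a \*o g + h).
  by move=> [s _ <-] [t _ <-]; have [r rE] := step_fun_lin a s t; exists r.
have Mperp g : Lsq mu g -> (forall m, M m -> L2dot mu g m = 0) -> g = 0 %[ae mu].
  move=> lg gM; apply: indic_perp => // a b ab; apply: gM.
  by exists (one_step ab) => //; exact: step_fun_one.
have [u uM uf] := @L2_perp_dense _ _ _ mu M lM M0 Mlin Mperp f lf.
have /choice[s sP] : forall n, exists s, step_fun s = u n by move=> n; have [s _ <-] := uM n; exists s.
by exists s; under eq_fun do rewrite sP.
Qed.

End step_dense.

(** * Fubini's theorem for real-valued integrals *)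

Section real_fubini.
Context d1 d2 (T1 : measurableType d1) (T2 : measurableType d2) (R : realType).
Variables (m1 : {sigma_finite_measure set T1 -> \bar R}).
Variables (m2 : {sigma_finite_measure set T2 -> \bar R}).

(** The inner integral is finite for almost every [x] only, and [fine] truncates it elsewhere; the
    two iterated integrals therefore have a.e. equal integrands. *)
Lemma Rint_fubiniF (F : T1 * T2 -> R) :
  (m1 \x m2)%E.-integrable setT (EFin \o F) ->
  \int[m1]_x \int[m2]_y F (x, y) = fine (\int[m1]_x \int[m2]_y (F (x, y))%:E)%E.
Proof.
move=> iF; congr fine; apply: ae_eq_integral => //.
- apply/measurable_EFinP; apply: measurableT_comp => //.
  exact: (measurable_fubini_F iF).
- exact: (measurable_fubini_F iF).
- have := integrable_ae measurableT (integrable_fubini_F iF).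
  apply: filterS => x /(_ I) h _.
  by rewrite /Rintegral fineK.
Qed.

Lemma Rint_fubiniG (F : T1 * T2 -> R) :
  (m1 \x m2)%E.-integrable setT (EFin \o F) ->
  \int[m2]_y \int[m1]_x F (x, y) = fine (\int[m2]_y \int[m1]_x (F (x, y))%:E)%E.
Proof.
move=> iF; congr fine; apply: ae_eq_integral => //.
- apply/measurable_EFinP; apply: measurableT_comp => //.
  exact: (measurable_fubini_G iF).
- exact: (measurable_fubini_G iF).
- have := ae_integrable2 iF; apply: filterS => x h _.
  by rewrite /Rintegral fineK//; apply: (integrable_fin_num measurableT h).
Qed.

Lemma RFubini (F : T1 * T2 -> R) :
  (m1 \x m2)%E.-integrable setT (EFin \o F) ->
  \int[m1]_x \int[m2]_y F (x, y) = \int[m2]_y \int[m1]_x F (x, y).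
Proof.
move=> iF; rewrite Rint_fubiniF// Rint_fubiniG//; congr fine.
exact: (Fubini iF).
Qed.

Lemma Rint_prod (F : T1 * T2 -> R) :
  (m1 \x m2)%E.-integrable setT (EFin \o F) ->
  \int[(m1 \x m2)%E]_z F z = \int[m1]_x \int[m2]_y F (x, y).
Proof.
by move=> iF; rewrite Rint_fubiniF// /Rintegral (integral12_prod_meas1 iF).
Qed.

Lemma integrable_prod_bounded (f : T1 -> R) (g : T2 -> R) (K : T1 * T2 -> R) (C : R) :
  m1.-integrable setT (EFin \o f) -> m2.-integrable setT (EFin \o g) ->
  measurable_fun setT K -> (forall z, `|K z| <= C) ->
  (m1 \x m2)%E.-integrable setT (EFin \o (fun z => f z.1 * g z.2 * K z)).
Proof.
move=> /integrableP[mf foo] /integrableP[mg goo] mK KC.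
have mf' : measurable_fun setT f by apply/measurable_EFinP.
have mg' : measurable_fun setT g by apply/measurable_EFinP.
have mfg : measurable_fun [set: T1 * T2] (fun z : T1 * T2 => f z.1 * g z.2).
  by apply: measurable_funM; apply: measurableT_comp => //.
(* [0 <= C] is read off at some point, so the empty product space is treated apart. *)
have [z0|z0] := pselect (exists z : T1 * T2, True); last first.
  apply/integrableP; split.
    by apply/measurable_EFinP; apply: measurable_funM.
  rewrite integral0_eq// => x _; exfalso; apply: z0; by exists x.
have C0 : 0 <= C by case: z0 => z _; exact: le_trans (KC z).
apply: (@le_integrable _ _ _ _ _ _ _ (EFin \o (fun z => C * (f z.1 * g z.2)))) => //.
- by apply/measurable_EFinP; apply: measurable_funM.
- move=> z _; rewrite /= lee_fin mulrC !normrM (ger0_norm C0).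
  by apply: ler_wpM2r => //; rewrite mulr_ge0.
apply: (@eq_integrable _ _ _ _ _ measurableT (fun z => C%:E * (f z.1 * g z.2)%:E)%E) => //.
apply: integrableZl => //.
apply/integrable12ltyP; first exact/measurable_EFinP.
under eq_integral => x _.
  under eq_integral => y _ do rewrite /= normrM EFinM.
  rewrite ge0_integralZl//; last by apply/measurable_EFinP; exact: measurableT_comp.
  over.
rewrite ge0_integralZr//.
- by apply: lte_mul_pinfty; rewrite ?integral_ge0// ge0_fin_numE// integral_ge0.
- by apply/measurable_EFinP; exact: measurableT_comp.
- exact: integral_ge0.
Qed.

End real_fubini.

(** * Continuity of translations in [L^2(R)] *)

Section translation.
Variable R : realType.
Notation mu := (leb R).
Implicit Types (f g : R -> R) (b : nat -> R).

(** The difference vanishes outside the two intervals of radius [|t|] around the endpoints, each of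
    length [2 |t|]. *)
Lemma sqn_indic_shift (a c t : R) : a <= c ->
  sqn mu ((fun x => \1_(`[a, c[) (x + t)) - \1_(`[a, c[)) <= 4 * `|t|.
Proof.
move=> ac; have t0 := normr_ge0 t.
have l1 := Lsq_shift t (Lsq_indic a c).
rewrite -lee_fin sqnE; last by apply: LsqB => //; exact: Lsq_indic.
have ->: (4 * `|t|)%:E = (\int[mu]_x (\1_(`[(a - `|t|), (a + `|t|)[) x + \1_(`[(c - `|t|), (c + `|t|)[) x)%:E)%E.
  have I u v : (\int[mu]_x (\1_(`[u, v[) x : R)%:E = mu `[u, v[)%E by rewrite integral_indic// setIT.
  under eq_integral do rewrite EFinD.
  rewrite ge0_integralD//; try (by move=> x _; rewrite lee_fin);
    try (by apply/measurable_EFinP; exact: measurable_indic).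
  rewrite !I !lebesgue_measure_itv /= !lte_fin.
  case: ltP => h1; case: ltP => h2; rewrite -?EFinD ?adde0 ?add0e -?EFinD; congr EFin; lra.
apply: ge0_le_integral => //.
- by move=> x _; rewrite lee_fin sqr_ge0.
- apply/measurable_EFinP; apply: measurable_funX; apply: measurable_funB.
    exact: Lsq_measurable l1.
  exact: measurable_indic.
- by apply/measurable_EFinP; apply: measurable_funD; exact: measurable_indic.
move=> x _; rewrite lee_fin !fctE !indicE !mem_setE !in_itv /=.
have tt : - `|t| <= t by rewrite lerNl ler_normr lexx orbT.
have tt' : t <= `|t| by exact: ler_norm.
case: (leP a x) => h1; case: (ltP x c) => h2; case: (leP a (x + t)) => h3;
 case: (ltP (x + t) c) => h4 /=; rewrite ?subrr ?expr0n ?subr0 ?sub0r ?sqrrN ?expr1n /= ?addr_ge0//;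
 case: (leP (a - `|t|) x) => h5; case: (ltP x (a + `|t|)) => h6;
 case: (leP (c - `|t|) x) => h7; case: (ltP x (c + `|t|)) => h8 //=; lra.
Qed.

Lemma translation_step (s : step R) b : b n @[n --> \oo] --> 0 ->
  sqn mu ((fun x => step_fun s (x + b n)) - step_fun s) @[n --> \oo] --> 0.
Proof.
move=> b0; rewrite /step_fun.
pose F m x := \sum_(i < m) step_a s i * \1_(`[step_t s i, step_t s i.+1[) x.
have key m : (m <= step_n s)%N -> Lsq mu (F m) /\
    (sqn mu ((fun x => F m (x + b n)) - F m) @[n --> \oo] --> 0).
  elim: m => [_|m IH mn].
    have F0 : F 0%N = 0 by apply/funext => x; rewrite /F big_ord0.
    split; first by rewrite F0; exact: Lsq0.
    rewrite (_ : (fun n => _) = cst 0); first exact: cvg_cst.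
    by apply/funext => n; rewrite F0 subr0 sqn0.
  have [lF cF] := IH (ltnW mn).
  pose E := \1_(`[step_t s m, step_t s m.+1[) : R -> R.
  have lE : Lsq mu E by exact: Lsq_indic.
  have FS : F m.+1 = step_a s m \*o E + F m.
    by apply/funext => x; rewrite /F big_ord_recr /= addrC.
  split; first by rewrite FS; apply: LsqD => //; exact: LsqZ.
  have FSn n : (fun x => F m.+1 (x + b n)) =
      step_a s m \*o (fun x => E (x + b n)) + (fun x => F m (x + b n)).
    by apply/funext => x; rewrite /F big_ord_recr /= addrC.
  rewrite (_ : (fun n => _) = (fun n => sqn mu ((step_a s m \*o (fun x => E (x + b n)) +
     (fun x => F m (x + b n))) - (step_a s m \*o E + F m)))); last first.
    by apply/funext => n; rewrite FSn FS.
  apply: (@cvg2_lin _ _ _ mu _ (fun n x => E (x + b n)) (fun n x => F m (x + b n))) => //.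
  - by move=> n; exact: Lsq_shift.
  - by move=> n; exact: Lsq_shift.
  apply: (@cvg0_le _ _ (fun n => 4 * `|b n|)) => [n|n|].
  - exact: sqn_ge0.
  - by apply: sqn_indic_shift; exact: step_le.
  - rewrite -[X in _ --> X](mulr0 4); apply: cvgM; first exact: cvg_cst.
    by rewrite -[X in _ --> X](@normr0 _ R); apply: cvg_norm.
by have [] := key _ (leqnn _).
Qed.

Lemma translation_continuous f b : Lsq mu f -> b n @[n --> \oo] --> 0 ->
  sqn mu ((fun x => f (x + b n)) - f) @[n --> \oo] --> 0.
Proof.
move=> lf b0; have [s sf] := step_dense lf.
apply/cvgr0Pnorm_lt => e e0.
(* [sqnB_tri] is used twice below, so the three errors enter with factors 2, 4 and 4, which add up
   to [e / 2]. *)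
have e20 : 0 < e / 20 by lra.
have /cvgr0Pnorm_lt/(_ _ e20)[N _ NP] := sf.
have := NP N (leqnn N); rewrite ger0_norm ?sqn_ge0// => sN.
have /cvgr0Pnorm_lt/(_ _ e20)[M _ MP] := translation_step (s N) b0.
exists M => // n /= Mn; have := MP n Mn; rewrite !ger0_norm ?sqn_ge0// => tn.
have ls := Lsq_step_fun (s N).
have lfn := Lsq_shift (b n) lf; have lsn := Lsq_shift (b n) ls.
have h1 := sqnB_tri lfn lsn lf; have h2 := sqnB_tri lsn ls lf.
have h3 : sqn mu ((fun x => f (x + b n)) - (fun x => step_fun (s N) (x + b n))) =
          sqn mu (step_fun (s N) - f).
  by rewrite -(sqn_shift (b n) (LsqB ls lf)) sqnBC.
lra.
Qed.

End translation.

(** * The Hartley transform and Plancherel's theorem *)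

Section poisson.
Variable R : realType.
Notation mu := (leb R).
Implicit Types e s x y : R.

Lemma set_itv_ge0 : [set x : R | 0 <= x] = `[0, +oo[%classic.
Proof. by apply/seteqP; split => x /=; rewrite in_itv /= andbT. Qed.

(** The integrand has [1 + cos] instead of [cos] so as to be nonnegative, as the fundamental theorem
    on a half-line requires for [integral_cos_exp_half]; the extra [1] is subtracted again in
    [Rintegral_cos_exp]. *)
Lemma cos_exp_primitive e s (w : R) : 0 < e ->
  is_derive w 1 (fun w => expR (- (e * w)) *
     (- e^-1 + (s * sin (s * w) - e * cos (s * w)) / (e ^+ 2 + s ^+ 2)))
    ((1 + cos (s * w)) * expR (- (e * w))).
Proof.
move=> e0.
have p0 : e ^+ 2 + s ^+ 2 != 0 by rewrite gt_eqF// ltr_pwDl ?exprn_gt0 ?sqr_ge0.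
have dl (c : R) : is_derive w 1 (fun w => c * w) c.
  have h := is_deriveZ c (is_derive_id w (1 : R)).
  by apply: is_derive_eq h _; rewrite /GRing.scale /= mulr1.
have ds : is_derive w 1 (fun w => sin (s * w)) (cos (s * w) * s).
  have := @is_derive1_comp R sin (fun w => s * w) w (cos (s * w)) s (is_derive_sin _) (dl s).
  by [].
have dc : is_derive w 1 (fun w => cos (s * w)) (- sin (s * w) * s).
  have := @is_derive1_comp R cos (fun w => s * w) w (- sin (s * w)) s (is_derive_cos _) (dl s).
  by [].
have de : is_derive w 1 (fun w => expR (- (e * w))) (expR (- (e * w)) * (- e)).
  have dn : is_derive w 1 (fun w => - (e * w)) (- e).
    by apply: is_deriveN; exact: dl.
  have := @is_derive1_comp R expR (fun w => - (e * w)) w (expR (- (e * w))) (- e) (is_derive_expR _) dn.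
  by [].
have dg : is_derive w 1 (fun w => - e^-1 + (s * sin (s * w) - e * cos (s * w)) / (e ^+ 2 + s ^+ 2))
   ((s * (cos (s * w) * s) - e * (- sin (s * w) * s)) / (e ^+ 2 + s ^+ 2)).
  rewrite (_ : (fun w => _) = (fun w => - e^-1 + (s / (e ^+ 2 + s ^+ 2) * sin (s * w) +
     (- e / (e ^+ 2 + s ^+ 2)) * cos (s * w)))); last by apply/funext => x; set q := (_ + _)^-1; ring.
  by apply: is_derive_eq; rewrite /GRing.scale /=; field.
have := is_deriveM de dg.
move=> h; apply: is_derive_eq h _; rewrite /GRing.scale /=; field.
by rewrite p0 gt_eqF.
Qed.

Lemma integral_cos_exp_half e s : 0 < e ->
  (\int[mu]_(w in `[0%R, +oo[) ((1 + cos (s * w)) * expR (- (e * `|w|)))%:E =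
   (e^-1 + e / (e ^+ 2 + s ^+ 2))%:E)%E.
Proof.
move=> e0.
have p0 : e ^+ 2 + s ^+ 2 != 0 by rewrite gt_eqF// ltr_pwDl ?exprn_gt0 ?sqr_ge0.
pose F w := expR (- (e * w)) *
     (- e^-1 + (s * sin (s * w) - e * cos (s * w)) / (e ^+ 2 + s ^+ 2)).
have dF w := @cos_exp_primitive e s w e0.
have cF : continuous F.
  by move=> w; apply: differentiable_continuous; apply/derivable1_diffP; have [] := dF w.
rewrite (@ge0_continuous_FTC2y _ _ F 0 0).
- rewrite /F !mulr0 oppr0 expR0 sin0 cos0 -EFinD; congr EFin; field.
  by rewrite p0 gt_eqF.
- move=> w _; apply: mulr_ge0; last exact: expR_ge0.
  by have := cos_geN1 (s * w); lra.
- apply: continuous_subspaceT => w.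
  apply: cvgM; first apply: cvgD; first exact: cvg_cst.
    by apply: continuous_comp; [apply: cvgM; [exact: cvg_cst|exact: cvg_id]|exact: continuous_cos].
  apply: continuous_comp; last exact: continuous_expR.
  apply: cvgN; apply: cvgM; first exact: cvg_cst.
  exact: norm_continuous.
- pose C := e^-1 + (`|s| + e) / (e ^+ 2 + s ^+ 2).
  have FC w : `|F w| <= expR (- (e * w)) * C.
    rewrite /F normrM (gtr0_norm (expR_gt0 _)) ler_wpM2l ?expR_ge0//.
    rewrite (le_trans (ler_normD _ _))// normrN gtr0_norm ?invr_gt0// lerD2l.
    have pp : 0 < e ^+ 2 + s ^+ 2 by rewrite ltr_pwDl ?exprn_gt0 ?sqr_ge0.
    rewrite normrM normfV (gtr0_norm pp) ler_wpM2r ?invr_ge0 ?(ltW pp)//.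
    rewrite (le_trans (ler_normB _ _))// !normrM (gtr0_norm e0) lerD//.
      by rewrite -[leRHS]mulr1 ler_wpM2l// sin_max.
    by rewrite -[leRHS]mulr1 ler_wpM2l ?(ltW e0)// cos_max.
  have lim0 : expR (- (e * w)) * C @[w --> +oo] --> 0.
    rewrite -[X in _ --> X](mul0r C); apply: cvgM; last exact: cvg_cst.
    have /cvgr0Pnorm_lt h := @cvgr_expR R.
    apply/cvgr0Pnorm_lt => r r0; have [M [_ MP]] := h r r0.
    exists (M / e); split; first exact: num_real.
    by move=> w /= ww; apply: (MP (e * w)); rewrite /= mulrC -ltr_pdivrMr.
  apply: norm_cvg0; apply: squeeze_cvgr (cvg_cst 0) lim0.
  by apply: nearW => w; rewrite normr_ge0 FC.
- by move=> w _; have [] := dF w.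
- by apply: cvg_at_right_filter; exact: cF.
- move=> w; rewrite in_itv /= andbT => w0.
  by rewrite derive1E (ger0_norm (ltW w0)); have [_ ->] := dF w.
Qed.

Lemma continuous_cos_exp e s :
  continuous (fun w : R => (1 + cos (s * w)) * expR (- (e * `|w|))).
Proof.
move=> w; apply: cvgM; first apply: cvgD; first exact: cvg_cst.
  by apply: continuous_comp; [apply: cvgM; [exact: cvg_cst|exact: cvg_id]|exact: continuous_cos].
apply: continuous_comp; last exact: continuous_expR.
apply: cvgN; apply: cvgM; first exact: cvg_cst.
exact: norm_continuous.
Qed.

Lemma integral_1cos_exp e s : 0 < e ->
  (\int[mu]_w ((1 + cos (s * w)) * expR (- (e * `|w|)))%:E =
   (2 * (e^-1 + e / (e ^+ 2 + s ^+ 2)))%:E)%E.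
Proof.
move=> e0; rewrite (ge0_symfun_integralT (f := fun w => (1 + cos (s * w)) * expR (- (e * `|w|)))).
- by rewrite set_itv_ge0 integral_cos_exp_half// -EFinM.
- move=> w; apply: mulr_ge0; last exact: expR_ge0.
  by have := cos_geN1 (s * w); lra.
- exact: continuous_cos_exp.
- by move=> w; rewrite /= mulrN cosN normrN.
Qed.

Lemma integrable_1cos_exp e s : 0 < e ->
  mu.-integrable setT (EFin \o (fun w => (1 + cos (s * w)) * expR (- (e * `|w|)))).
Proof.
move=> e0; apply/integrableP; split.
  by apply/measurable_EFinP; apply: continuous_measurable_fun; exact: continuous_cos_exp.
under eq_integral => w _.
  rewrite gee0_abs; last first.
    rewrite lee_fin; apply: mulr_ge0; last exact: expR_ge0.
    by have := cos_geN1 (s * w); lra.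
  over.
by rewrite integral_1cos_exp// ltry.
Qed.

Lemma integrable_expN e : 0 < e ->
  mu.-integrable setT (EFin \o (fun w => expR (- (e * `|w|)))).
Proof.
move=> e0.
have h := integrableZl measurableT (2^-1) (integrable_1cos_exp 0 e0).
apply: (eq_integrable _ _ _ _ h) => // w _ /=.
by rewrite mul0r cos0 -EFinM; congr EFin; field.
Qed.

Lemma Rintegral_cos_exp e s : 0 < e ->
  \int[mu]_w (cos (s * w) * expR (- (e * `|w|))) = 2 * e / (e ^+ 2 + s ^+ 2).
Proof.
move=> e0.
have p0 : e ^+ 2 + s ^+ 2 != 0 by rewrite gt_eqF// ltr_pwDl ?exprn_gt0 ?sqr_ge0.
have E t : \int[mu]_w ((1 + cos (t * w)) * expR (- (e * `|w|))) = 2 * (e^-1 + e / (e ^+ 2 + t ^+ 2)).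
  by rewrite /Rintegral integral_1cos_exp.
have E0 : \int[mu]_w expR (- (e * `|w|)) = 2 * e^-1.
  rewrite (_ : \int[mu]_w _ = 2^-1 * \int[mu]_w ((1 + cos (0 * w)) * expR (- (e * `|w|)))).
    by rewrite E; field; rewrite gt_eqF// andbT expr0n addr0 expf_neq0 ?gt_eqF.
  rewrite -RintegralZl//; last exact: integrable_1cos_exp.
  by apply: eq_Rintegral => w _; rewrite mul0r cos0; field.
transitivity (\int[mu]_w ((1 + cos (s * w)) * expR (- (e * `|w|))) - \int[mu]_w expR (- (e * `|w|))).
  rewrite -RintegralB//; [|exact: integrable_1cos_exp|exact: integrable_expN].
  by apply: eq_Rintegral => w _; ring.
by rewrite E E0; field; rewrite p0 gt_eqF.
Qed.

Lemma Rintegral_odd (f : R -> R) : mu.-integrable setT (EFin \o f) ->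
  (forall x, f (- x) = - f x) -> \int[mu]_x f x = 0.
Proof.
move=> intf fodd.
have mf : measurable_fun setT (EFin \o f) by case/integrableP: intf.
have : \int[mu]_x f x = - \int[mu]_x f x.
  rewrite -[RHS]mulN1r -RintegralZl// /Rintegral -(integral_opp mf); congr fine.
  by apply: eq_integral => x _ /=; rewrite fodd mulN1r.
lra.
Qed.

(** Hartley's real substitute for the complex exponential. Evaluated at [w * x] it is a symmetric
    kernel, which makes the transform self-adjoint. *)
Definition cas (x : R) : R := cos x + sin x.

Lemma continuous_cas : continuous cas.
Proof. by move=> x; apply: cvgD; [exact: continuous_cos|exact: continuous_sin]. Qed.

Lemma cas_bound x : `|cas x| <= 2.
Proof.
rewrite /cas (le_trans (ler_normD _ _))//.
by have := cos_max x; have := sin_max x; lra.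
Qed.

Lemma casM x y : cas x * cas y = cos (x - y) + sin (x + y).
Proof. by rewrite /cas cosB sinD; ring. Qed.

Lemma measurable_cas_mul x : measurable_fun setT (fun w : R => cas (w * x)).
Proof.
have c : continuous (fun w : R => cas (w * x)).
  move=> w; apply: (@continuous_comp R R R (fun w => w * x) cas w); last exact: continuous_cas.
  by apply: cvgM; [exact: cvg_id|exact: cvg_cst].
exact: continuous_measurable_fun.
Qed.

(** In [casM] the term [sin (x + y)] becomes odd in [w] and integrates to zero; what remains depends
    on [x - y] alone and is the Poisson kernel. *)
Lemma Rintegral_cas_exp e x y : 0 < e ->
  \int[mu]_w (cas (w * x) * cas (w * y) * expR (- (e * `|w|))) =
  2 * e / (e ^+ 2 + (x - y) ^+ 2).
Proof.
move=> e0.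
have mexp : measurable_fun setT (fun w : R => expR (- (e * `|w|))).
  by have /integrableP[/measurable_EFinP] := integrable_expN e0.
have i1 : mu.-integrable setT (EFin \o (fun w => cos ((x - y) * w) * expR (- (e * `|w|)))).
  apply: le_integrable (integrable_expN e0) => //.
    apply/measurable_EFinP; apply: measurable_funM => //.
    apply: continuous_measurable_fun => w.
    by apply: continuous_comp; [apply: cvgM; [exact: cvg_cst|exact: cvg_id]|exact: continuous_cos].
  move=> w _ /=; rewrite lee_fin normrM -[leRHS]mul1r.
  by apply: ler_wpM2r => //; exact: cos_max.
have i2 : mu.-integrable setT (EFin \o (fun w => sin ((x + y) * w) * expR (- (e * `|w|)))).
  apply: le_integrable (integrable_expN e0) => //.
    apply/measurable_EFinP; apply: measurable_funM => //.
    apply: continuous_measurable_fun => w.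
    by apply: continuous_comp; [apply: cvgM; [exact: cvg_cst|exact: cvg_id]|exact: continuous_sin].
  move=> w _ /=; rewrite lee_fin normrM -[leRHS]mul1r.
  by apply: ler_wpM2r => //; exact: sin_max.
have o2 : \int[mu]_w (sin ((x + y) * w) * expR (- (e * `|w|))) = 0.
  by apply: Rintegral_odd => // w; rewrite mulrN sinN normrN mulNr.
rewrite -(Rintegral_cos_exp (x - y) e0) -[RHS]addr0 -o2 -RintegralD//.
by apply: eq_Rintegral => w _; rewrite casM -mulrBr -mulrDr mulrDl !(mulrC w).
Qed.

(** This total mass is the origin of the constant [2 * pi] in Plancherel's identity. *)
Lemma integral_cauchy : (\int[mu]_z (2 / (1 + z ^+ 2))%:E = (2 * pi)%:E)%E.
Proof.
have c1 : continuous (fun z : R => 2 / (1 + z ^+ 2)).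
  move=> z; apply: cvgM; first exact: cvg_cst.
  apply: cvgV; first by rewrite gt_eqF// ltr_pwDl ?sqr_ge0.
  by apply: cvgD; [exact: cvg_cst|exact: exprn_continuous].
have p0 (z : R) : 0 <= 2 / (1 + z ^+ 2) by rewrite divr_ge0// addr_ge0// sqr_ge0.
rewrite (ge0_symfun_integralT (f := fun z => 2 / (1 + z ^+ 2)))//; last first.
  by move=> z; rewrite /= sqrrN.
rewrite set_itv_ge0 (@ge0_continuous_FTC2y _ _ (fun z => 2 * atan z) 0 (2 * (pi / 2))).
- by rewrite atan0 mulr0 sube0 -EFinM; congr EFin; field.
- by [].
- exact: continuous_subspaceT.
- by apply: cvgM; [exact: cvg_cst|exact: cvgy_atan].
- by move=> x _; apply: derivableM => //; have [] := is_derive1_atan x.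
- by apply: cvg_at_right_filter; apply: cvgM; [exact: cvg_cst|exact: continuous_atan].
- move=> x _; rewrite derive1E.
  have h := is_deriveZ (2 : R) (is_derive1_atan x).
  by have [_ ->] := h.
Qed.

Lemma integrable_cauchy : mu.-integrable setT (EFin \o (fun z => 2 / (1 + z ^+ 2))).
Proof.
apply/integrableP; split.
  apply/measurable_EFinP; apply: continuous_measurable_fun => z.
  apply: cvgM; first exact: cvg_cst.
  apply: cvgV; first by rewrite gt_eqF// ltr_pwDl ?sqr_ge0.
  by apply: cvgD; [exact: cvg_cst|exact: exprn_continuous].
under eq_integral => w _.
  rewrite gee0_abs; last by rewrite lee_fin divr_ge0// addr_ge0// sqr_ge0.
  over.
by rewrite integral_cauchy ltry.
Qed.

Lemma fin_num_mulrl (e : R) (X : \bar R) : 0 < e -> (e%:E * X)%E \is a fin_num ->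
  X \is a fin_num.
Proof. by move=> e0; case: X => [r| |]//; rewrite ?gt0_muley ?gt0_muleNy ?lte_fin. Qed.

Lemma Rintegral_scale (G : R -> R) e : 0 < e -> mu.-integrable setT (EFin \o G) ->
  e * \int[mu]_z G (e * z) = \int[mu]_z G z.
Proof.
move=> e0 iG.
have [mG _] := (integrableP _ _ _ iG).
have fp := integrable_pos_fin_num measurableT iG.
have fn := integrable_neg_fin_num measurableT iG.
rewrite [RHS]/Rintegral integralE.
have mp : measurable_fun setT (EFin \o G)^\+%E by exact: measurable_funepos.
have mn : measurable_fun setT (EFin \o G)^\-%E by exact: measurable_funeneg.
have sp := ge0_integral_scale e0 mp (fun x => funepos_ge0 _ x).
have sn := ge0_integral_scale e0 mn (fun x => funeneg_ge0 _ x).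
rewrite -sp -sn in fp fn *.
have fp' := fin_num_mulrl e0 fp; have fn' := fin_num_mulrl e0 fn.
rewrite -muleBr ?fin_num_adde_defl//; last by rewrite fin_numN.
rewrite fineM//; last by rewrite fin_numB fp' fn'.
congr (_ * fine _); rewrite integralE; congr (_ - _)%E; apply: eq_integral => z _.
  by rewrite !funeposE.
by rewrite !funenegE.
Qed.

End poisson.

Section real_dominated.
Context d (T : measurableType d) (R : realType) (mu : {measure set T -> \bar R}).

Lemma Rdominated_cvg (f_ : nat -> T -> R) (f g : T -> R) :
  (forall n, measurable_fun setT (f_ n)) -> measurable_fun setT f ->
  {ae mu, forall x, f_ n x @[n --> \oo] --> f x} ->
  mu.-integrable setT (EFin \o g) ->
  (forall n x, `|f_ n x| <= g x) ->
  mu.-integrable setT (EFin \o f) /\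
  (\int[mu]_x f_ n x @[n --> \oo] --> \int[mu]_x f x).
Proof.
move=> mf_ mf ff ig fg.
have [] := @dominated_convergence _ _ _ mu setT measurableT (fun n => EFin \o f_ n) (EFin \o f) (EFin \o g).
- by move=> n; apply/measurable_EFinP.
- exact/measurable_EFinP.
- by apply: filterS ff => x h _; apply: cvg_EFin => //; exact: nearW.
- exact: ig.
- by apply: aeW => x n _ /=; rewrite lee_fin.
move=> intf _ h; split => //.
have : (\int[mu]_x (f_ n x)%:E)%E @[n --> \oo] --> (\int[mu]_x f x)%:E.
  by rewrite /Rintegral fineK//; exact: integrable_fin_num intf.
by move/fine_cvgP => [].
Qed.

End real_dominated.

(** * Plancherel's identity for integrable functions *)

Section plancherel.
Variable R : realType.
Notation mu := (leb R).
Notation L1 f := (mu.-integrable setT (EFin \o (f : R -> R))).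
Implicit Types (f g : R -> R) (e x y z w : R).

(* For real [f] this determines the Fourier transform ([fourier1_hat]), but it
   is real, self-adjoint, and its square is [2 * pi]. *)
Definition hartley f (w : R) : R := \int[mu]_x (f x * cas (w * x)).

Lemma L1_measurable f : L1 f -> measurable_fun setT f.
Proof. by case/integrableP => /measurable_EFinP. Qed.

Lemma measurable_casM : measurable_fun [set: R * R] (fun z : R * R => cas (z.1 * z.2)).
Proof.
have c : measurable_fun [set: R] (@cas R) by apply: continuous_measurable_fun; exact: continuous_cas.
by apply: (measurableT_comp c); apply: measurable_funM.
Qed.

Lemma L1_mul_bounded f g (C : R) : L1 f -> measurable_fun setT g ->
  (forall x, `|g x| <= C) -> L1 (fun x => f x * g x).
Proof.
move=> l1 mg gC; have mf := L1_measurable l1.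
have C0 : 0 <= C by exact: le_trans (gC 0).
apply: (le_integrable measurableT _ _ (integrableZl measurableT C l1)).
  by apply/measurable_EFinP; exact: measurable_funM.
move=> x _; rewrite /= lee_fin !normrM (ger0_norm C0) mulrC.
by apply: ler_wpM2r.
Qed.

Lemma L1_cas f w : L1 f -> L1 (fun x => f x * cas (w * x)).
Proof.
move=> l1; apply: (L1_mul_bounded l1 _ (fun x => cas_bound _)).
under eq_fun do rewrite mulrC.
exact: measurable_cas_mul.
Qed.

Lemma measurable_hartley f : L1 f -> measurable_fun setT (hartley f).
Proof.
move=> l1; have mf := L1_measurable l1.
pose F (z : R * R) := (f z.2 * cas (z.1 * z.2))%:E.
have mF : measurable_fun setT F.
  apply/measurable_EFinP; apply: measurable_funM; last exact: measurable_casM.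
  exact: measurableT_comp.
apply: measurableT_comp => //.
rewrite (_ : (fun w => _) = (fun w => (\int[mu]_x F^\+ (w, x) - \int[mu]_x F^\- (w, x))%E)); last first.
  apply/funext => w; rewrite integralE; congr (_ - _)%E; apply: eq_integral => x _.
    by rewrite !funeposE.
  by rewrite !funenegE.
apply: emeasurable_funB.
- apply: (@measurable_fun_fubini_tonelli_F _ _ _ _ _ mu F^\+%E); first exact: measurable_funepos.
  by move=> z; exact: funepos_ge0.
- apply: (@measurable_fun_fubini_tonelli_F _ _ _ _ _ mu F^\-%E); first exact: measurable_funeneg.
  by move=> z; exact: funeneg_ge0.
Qed.

Lemma hartley_bound f w : L1 f -> `|hartley f w| <= 2 * \int[mu]_x `|f x|.
Proof.
move=> l1; have l1n : L1 (fun x => `|f x|) by exact: integrable_norm.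
rewrite -RintegralZl//.
apply: le_trans (le_normr_Rintegral measurableT (L1_cas w l1)) _.
apply: le_Rintegral => //.
- by apply: integrable_norm => //; exact: L1_cas.
- exact: (integrableZl measurableT 2 l1n).
- by move=> x _; rewrite normrM mulrC ler_wpM2r//; exact: cas_bound.
Qed.

Lemma hartley_lin a f g : L1 f -> L1 g ->
  hartley (a \*o f + g) = a \*o hartley f + hartley g.
Proof.
move=> lf lg; apply/funext => w; rewrite !fctE /= /hartley.
have lc := L1_cas w lf; have lcg := L1_cas w lg.
rewrite -RintegralZl// -RintegralD//.
- by apply: eq_Rintegral => x _; rewrite /=; ring.
- exact: (integrableZl measurableT a lc).
Qed.

(** Fubini, together with the symmetry of [cas (w * x)] in its two arguments. *)
Lemma hartley_mult f g : L1 f -> L1 g ->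
  \int[mu]_w (hartley f w * g w) = \int[mu]_x (f x * hartley g x).
Proof.
move=> lf lg.
have i2 := @integrable_prod_bounded _ _ _ _ R mu mu g f (fun z : R * R => cas (z.1 * z.2)) 2 lg lf
  measurable_casM (fun z : R * R => cas_bound (z.1 * z.2)).
have := RFubini i2 => /= h.
transitivity (\int[mu]_w \int[mu]_x (g w * f x * cas (w * x))).
  apply: eq_Rintegral => w _; rewrite /hartley mulrC -RintegralZl//; last exact: L1_cas.
  by apply: eq_Rintegral => x _; rewrite mulrA.
rewrite h; apply: eq_Rintegral => x _.
rewrite /hartley -RintegralZl//; last exact: L1_cas.
by apply: eq_Rintegral => y _; rewrite (mulrC x); ring.
Qed.

(** The autocorrelation of [f]; it equals [sqn mu f] at [0], is bounded by that value, and is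
    continuous there because translations are. *)
Definition autocor f (z : R) : R := L2dot mu f (fun x => f (x + z)).

Lemma autocor_bound f z : Lsq mu f -> `|autocor f z| <= sqn mu f.
Proof.
move=> lf; have := L2dot_CS lf (Lsq_shift z lf).
rewrite sqn_shift// -expr2 -/(autocor f z) => h.
by rewrite -ler_sqr ?nnegrE ?normr_ge0 ?sqn_ge0// real_normK ?num_real.
Qed.

Lemma autocor_cvg f (b : nat -> R) : Lsq mu f -> b n @[n --> \oo] --> 0 ->
  autocor f (b n) @[n --> \oo] --> sqn mu f.
Proof.
move=> lf b0; rewrite /autocor; under eq_fun do rewrite L2dotC.
apply: cvg2_dotl => //; first by move=> n; exact: Lsq_shift.
exact: translation_continuous.
Qed.

Lemma integrable_autocor_prod f : L1 f ->
  (mu \x mu)%E.-integrable setT (EFin \o (fun z : R * R => f z.2 * f (z.2 + z.1))).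
Proof.
move=> lf; have mf := L1_measurable lf.
have madd : measurable_fun [set: R * R] (fun z : R * R => z.2 + z.1).
  exact: measurable_funD.
have mF : measurable_fun [set: R * R] (fun z : R * R => f z.2 * f (z.2 + z.1)).
  apply: measurable_funM; first exact: measurableT_comp.
  exact: (measurableT_comp mf madd).
apply/integrable21ltyP; first exact/measurable_EFinP.
have E y : (\int[mu]_x `|(EFin \o (fun z : R * R => (f z.2 * f (z.2 + z.1))%R)) (x, y)| =
   `|f y|%:E * \int[mu]_x `|f x|%:E)%E.
  under eq_integral => x _ do rewrite /= normrM EFinM.
  rewrite ge0_integralZl//.
  - congr (_ * _)%E.
    have mn : measurable_fun setT (fun x => `|f x|%:E).
      by apply/measurable_EFinP; exact: measurableT_comp.
    rewrite -[RHS](ge0_integral_shift y mn)//.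
    by apply: eq_integral => x _; rewrite addrC.
  - apply/measurable_EFinP; apply: measurableT_comp => //.
    by apply: (measurableT_comp mf); exact: measurable_funD.
rewrite [X in (X < _)%E](_ : _ = (\int[mu]_y (`|f y|%:E * \int[mu]_x `|f x|%:E))%E); last first.
  by apply: eq_integral => y _; exact: E.
have [_ foo] := integrableP _ _ _ lf.
rewrite ge0_integralZr//.
- by apply: lte_mul_pinfty; rewrite ?integral_ge0// ge0_fin_numE// integral_ge0.
- by apply/measurable_EFinP; exact: measurableT_comp.
- exact: integral_ge0.
Qed.

Lemma integrable_autocor f : L1 f -> L1 (autocor f).
Proof.
move=> lf; have h := integrable_fubini_F (integrable_autocor_prod lf).
have [mh _] := integrableP _ _ _ h.
apply: le_integrable h => //; first by apply/measurable_EFinP; apply: measurableT_comp.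
move=> z _; rewrite /= /autocor /L2dot /Rintegral /fubini_F /=.
by case: (integral _ _ _) => [r| |]//=; rewrite normr0 leey.
Qed.

(* The damping factor makes Fubini applicable; its cosine transform is the
   Poisson kernel, an approximate identity as [e] tends to [0]. *)
Lemma hartley_poisson e f : 0 < e -> L1 f -> Lsq mu f ->
  \int[mu]_w (hartley f w ^+ 2 * expR (- (e * `|w|))) =
  \int[mu]_z (2 / (1 + z ^+ 2) * autocor f (e * z)).
Proof.
move=> e0 lf l2f; have mf := L1_measurable lf.
pose E w := expR (- (e * `|w|)).
have lE : L1 E by exact: integrable_expN.
pose P z := 2 * e / (e ^+ 2 + z ^+ 2).
have lG : L1 (fun w => E w * hartley f w).
  apply: (L1_mul_bounded lE); first exact: measurable_hartley.
  by move=> w; exact: hartley_bound.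
(* [hartley_mult] moves the transform from [f] to the damped wave [w |-> E w * cas (x * w)], whose
   transform is the Poisson kernel centred at [x]. *)
have HG x : hartley (fun w => E w * hartley f w) x = \int[mu]_z (f (x + z) * P z).
  have lg : L1 (fun w => E w * cas (x * w)) by exact: L1_cas.
  transitivity (\int[mu]_w (hartley f w * (E w * cas (x * w)))).
    by apply: eq_Rintegral => w _; ring.
  rewrite hartley_mult//.
  have Hg y : hartley (fun w => E w * cas (x * w)) y = P (y - x).
    rewrite /P -(Rintegral_cas_exp y x e0); apply: eq_Rintegral => w _.
    by rewrite (mulrC w y) (mulrC w x) /E; ring.
  under eq_Rintegral => y _ do rewrite Hg.
  have mP : measurable_fun setT P.
    apply: continuous_measurable_fun => z; apply: cvgM; first exact: cvg_cst.
    apply: cvgV; first by rewrite gt_eqF// ltr_pwDl ?exprn_gt0 ?sqr_ge0.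
    by apply: cvgD; [exact: cvg_cst|exact: exprn_continuous].
  rewrite /Rintegral -(integral_shift x (f := fun y => (f y * P (y - x))%:E)).
    by congr fine; apply: eq_integral => z _; rewrite addrK addrC.
  apply/measurable_EFinP; apply: measurable_funM => //.
  by apply: (measurableT_comp mP); exact: measurable_funD.
have P0 z : 0 <= P z.
  by rewrite /P divr_ge0 ?mulr_ge0 ?(ltW e0)// addr_ge0 ?sqr_ge0.
have Pb z : `|P z| <= 2 / e.
  rewrite ger0_norm// /P ler_pdivrMr ?ltr_pwDl ?exprn_gt0 ?sqr_ge0//.
  rewrite mulrDr (_ : 2 / e * e ^+ 2 = 2 * e); last by field; rewrite gt_eqF.
  by rewrite lerDl mulr_ge0 ?sqr_ge0// divr_ge0// ltW.
have mP : measurable_fun setT P.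
  apply: continuous_measurable_fun => z; apply: cvgM; first exact: cvg_cst.
  apply: cvgV; first by rewrite gt_eqF// ltr_pwDl ?exprn_gt0 ?sqr_ge0.
  by apply: cvgD; [exact: cvg_cst|exact: exprn_continuous].
have iF : (mu \x mu)%E.-integrable setT (EFin \o (fun z : R * R => f z.2 * f (z.2 + z.1) * P z.1)).
  have h := integrable_autocor_prod lf.
  have [/measurable_EFinP mh _] := integrableP _ _ _ h.
  apply: (le_integrable measurableT _ _ (integrableZl measurableT (2 / e) h)).
    by apply/measurable_EFinP; apply: measurable_funM => //; exact: measurableT_comp.
  move=> z _; rewrite /= lee_fin normrM [leRHS]normrM mulrC ler_wpM2r//.
  by rewrite (le_trans (Pb _))// ler_norm.
transitivity (\int[mu]_w (hartley f w * (E w * hartley f w))).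
  by apply: eq_Rintegral => w _; rewrite /E; ring.
rewrite hartley_mult//.
transitivity (\int[mu]_x \int[mu]_z (f x * f (x + z) * P z)).
  apply: eq_Rintegral => x _; rewrite HG -RintegralZl//.
    by apply: eq_Rintegral => z _; rewrite mulrA.
  apply: (@L1_mul_bounded (fun z => f (x + z)) P (2 / e)) => //.
  apply/integrableP; split.
    by apply/measurable_EFinP; apply: (measurableT_comp mf); exact: measurable_funD.
  have [_ foo] := integrableP _ _ _ lf; apply: le_lt_trans foo.
  rewrite -(ge0_integral_shift x (f := fun y => `|f y|%:E))//.
    by rewrite le_eqVlt; apply/orP; left; apply/eqP; apply: eq_integral => y _; rewrite addrC.
  by apply/measurable_EFinP; exact: measurableT_comp.
rewrite -(RFubini iF) /=.
transitivity (\int[mu]_z (P z * autocor f z)).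
  apply: eq_Rintegral => z _; rewrite /autocor /L2dot -RintegralZl//.
    by apply: eq_Rintegral => x _; ring.
  by apply: L2dot_integrable => //; exact: Lsq_shift.
have lc : L1 (fun z => 2 / (1 + z ^+ 2) * autocor f (e * z)).
  apply: (@L1_mul_bounded _ (fun z => autocor f (e * z)) (sqn mu f) (integrable_cauchy R)); last first.
    by move=> z; exact: autocor_bound.
  apply: (measurableT_comp (L1_measurable (integrable_autocor lf))).
  exact: measurable_funM.
(* The substitution [z |-> e z] turns the Poisson kernel into the fixed weight [2 / (1 + z ^+ 2)]
   and moves [e] into the argument of [autocor]. *)
rewrite -(Rintegral_scale e0).
  rewrite [X in e * X](_ : _ = e^-1 * \int[mu]_z (2 / (1 + z ^+ 2) * autocor f (e * z))).
    by rewrite mulrA mulfV ?mul1r// gt_eqF.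
  rewrite -RintegralZl//; apply: eq_Rintegral => z _; rewrite mulrA /P; congr (_ * _); field.
  have p1 : 0 < 1 + z ^+ 2 by rewrite ltr_pwDl ?sqr_ge0.
  have p2 : 0 < e ^+ 2 + e ^+ 2 * z ^+ 2 by rewrite ltr_pwDl ?exprn_gt0// mulr_ge0 ?sqr_ge0.
  by rewrite !gt_eqF// exprMn.
under eq_fun do rewrite mulrC.
exact: (L1_mul_bounded (integrable_autocor lf) mP Pb).
Qed.

(** The damped integral [A n] has two limits as the damping disappears: on the autocorrelation side
    dominated convergence gives [2 * pi * sqn mu f], on the transform side monotone convergence
    gives the integral of [hartley f ^+ 2]. The latter need not be known finite beforehand, so
    square integrability comes out of the same comparison. *)
Lemma plancherel_L1 f : L1 f -> Lsq mu f ->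
  Lsq mu (hartley f) /\ sqn mu (hartley f) = 2 * pi * sqn mu f.
Proof.
move=> lf l2f; have mH := measurable_hartley lf.
pose e n : R := n.+1%:R^-1.
have e0 n : 0 < e n by rewrite invr_gt0.
have ecvg : e n @[n --> \oo] --> 0 by exact: cvg_harmonic.
pose A n := \int[mu]_w (hartley f w ^+ 2 * expR (- (e n * `|w|))).
have iA n : L1 (fun w => hartley f w ^+ 2 * expR (- (e n * `|w|))).
  rewrite (_ : (fun w => _) = (fun w => expR (- (e n * `|w|)) * hartley f w ^+ 2)); last first.
    by apply/funext => w; rewrite mulrC.
  apply: (@L1_mul_bounded _ (fun w => hartley f w ^+ 2) ((2 * \int[mu]_x `|f x|) ^+ 2)
    (integrable_expN (e0 n))).
    exact: measurable_funX.
  move=> w; rewrite normrX ler_sqr ?nnegrE//; first exact: hartley_bound.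
  by apply: le_trans (hartley_bound 0 lf).
have A1 : A n @[n --> \oo] --> 2 * pi * sqn mu f.
  have -> : A = fun n => \int[mu]_z (2 / (1 + z ^+ 2) * autocor f (e n * z)).
    by apply/funext => n; exact: hartley_poisson.
  have -> : 2 * pi * sqn mu f = \int[mu]_z (2 / (1 + z ^+ 2) * sqn mu f).
    by rewrite RintegralZr//; [rewrite /Rintegral integral_cauchy|exact: integrable_cauchy].
  have mc := L1_measurable (integrable_cauchy R).
  have ic := integrableZr measurableT (sqn mu f) (integrable_cauchy R).
  apply: (Rdominated_cvg _ _ _ ic _).2.
  - move=> n; apply: measurable_funM => //.
    apply: (measurableT_comp (L1_measurable (integrable_autocor lf))).
    exact: measurable_funM.
  - exact: measurable_funM.
  - apply: aeW => z /=; apply: cvgM; first exact: cvg_cst.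
    apply: autocor_cvg => //; rewrite -[X in _ --> X](mul0r z).
    by apply: cvgM => //; exact: cvg_cst.
  - move=> n z /=; rewrite normrM ger0_norm; last by rewrite divr_ge0// addr_ge0// sqr_ge0.
    by rewrite ler_wpM2l ?autocor_bound// divr_ge0// addr_ge0// sqr_ge0.
have A2 : (\int[mu]_w (hartley f w ^+ 2 * expR (- (e n * `|w|)))%:E)%E @[n --> \oo] -->
    (\int[mu]_w (hartley f w ^+ 2)%:E)%E.
  have h := @cvg_monotone_convergence _ _ _ mu setT measurableT
    (fun n w => (hartley f w ^+ 2 * expR (- (e n * `|w|)))%:E).
  rewrite [X in _ --> X](_ : _ = (\int[mu]_w limn (fun n => (hartley f w ^+ 2 * expR (- (e n * `|w|)))%:E))%E).
    apply: h.
    - by move=> n; have [] := integrableP _ _ _ (iA n).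
    - by move=> n x _; rewrite lee_fin mulr_ge0 ?sqr_ge0 ?expR_ge0.
    - move=> w _ n m nm; rewrite lee_fin ler_wpM2l ?sqr_ge0// ler_expR lerN2 ler_wpM2r//.
      by rewrite lef_pV2 ?posrE// ler_nat ltnS.
  apply: eq_integral => w _; apply/esym/cvg_lim => //.
  apply: cvg_EFin; first exact: nearW.
  rewrite -[X in _ --> X]mulr1; apply: cvgM; first exact: cvg_cst.
  rewrite -expR0; apply: continuous_cvg; first exact: continuous_expR.
  rewrite -[X in _ --> X]oppr0 -(mul0r `|w|); apply: cvgN.
  by apply: cvgM => //; exact: cvg_cst.
have A3 : (\int[mu]_w (hartley f w ^+ 2)%:E = (2 * pi * sqn mu f)%:E)%E.
  apply: cvg_unique A2 _ => //.
  apply: cvg_EFin; last exact: A1.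
  by apply: nearW => n; exact: integrable_fin_num (iA n).
have lH : Lsq mu (hartley f) by apply/LsqP; rewrite A3 ltry.
by split => //; apply: EFin_inj; rewrite sqnE.
Qed.

End plancherel.

Section ae_tools.
Context d (T : measurableType d) (R : realType) (mu : {measure set T -> \bar R}).

Lemma ae_mono (P Q : T -> Prop) : (forall x, P x -> Q x) ->
  {ae mu, forall x, P x} -> {ae mu, forall x, Q x}.
Proof. by move=> PQ; apply: filterS. Qed.

Lemma ae_and (P Q : T -> Prop) : {ae mu, forall x, P x} -> {ae mu, forall x, Q x} ->
  {ae mu, forall x, P x /\ Q x}.
Proof. by apply: filterS2. Qed.

End ae_tools.

(** * The Hartley transform on [L^2(R)] *)

Section hartley_L2.
Variable R : realType.
Notation mu := (leb R).
Notation L1 f := (mu.-integrable setT (EFin \o (f : R -> R))).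
Implicit Types (f g p q : R -> R) (w x : R).

Lemma L1_step_fun (s : step R) : L1 (step_fun s).
Proof.
rewrite /step_fun; elim: (step_n s) => [|n IH].
  rewrite (_ : EFin \o _ = cst 0%E); first exact: integrable0.
  by apply/funext => x /=; rewrite big_ord0.
have h := integrableZl measurableT (step_a s n)
  (integrable_indic_itv (step_t s n) (step_t s n.+1) true true).
apply: eq_integrable (integrableD measurableT h IH) => // x _ /=.
by rewrite big_ord_recr /= addrC.
Qed.

Lemma L1_lin (a : R) f g : L1 f -> L1 g -> L1 (a \*o f + g).
Proof.
move=> lf lg.
by apply: eq_integrable (integrableD measurableT (integrableZl measurableT a lf) lg).
Qed.

Definition L12 := {h : R -> R | L1 h /\ Lsq mu h}.

Definition L2_hartley : (R -> R) -> (R -> R) -> Prop :=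
  @L2_ext _ _ _ _ R mu mu L12 (fun h => sval h) (fun h => hartley (sval h)).

Let le (i : L12) : Lsq mu (sval i). Proof. by case: i => h []. Qed.

Let lj (i : L12) : Lsq mu (hartley (sval i)).
Proof. by case: i => h [l1 l2]; case: (plancherel_L1 l1 l2). Qed.

Let opp1E (u v : R -> R) : u - v = -1 \*o v + u.
Proof. by apply/funext => x; rewrite !fctE /= mulN1r addrC. Qed.

Let iso (i k : L12) : sqn mu (hartley (sval i) - hartley (sval k)) =
  2 * pi * sqn mu (sval i - sval k).
Proof.
case: i => h [h1 h2]; case: k => g [g1 g2] /=.
rewrite !opp1E -hartley_lin//.
apply: (plancherel_L1 _ _).2; last by apply: LsqD => //; exact: LsqZ.
exact: L1_lin.
Qed.

Let dense f : Lsq mu f ->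
  exists s : nat -> L12, sqn mu (sval (s n) - f) @[n --> \oo] --> 0.
Proof.
move=> /step_dense[s sf].
by exists (fun n => exist _ (step_fun (s n)) (conj (L1_step_fun _) (Lsq_step_fun _))).
Qed.

Let lin (a : R) (i k : L12) : exists m : L12,
  sval m = a \*o sval i + sval k /\
  hartley (sval m) = a \*o hartley (sval i) + hartley (sval k).
Proof.
case: i => h [h1 h2]; case: k => g [g1 g2] /=.
have l1 : L1 (a \*o h + g) by exact: L1_lin.
have l2 : Lsq mu (a \*o h + g) by apply: LsqD => //; exact: LsqZ.
by exists (exist (fun h => L1 h /\ Lsq mu h) _ (conj l1 l2)); split => //=; rewrite hartley_lin.
Qed.

Lemma L2_hartley_exists f : Lsq mu f -> exists q, L2_hartley f q.
Proof. exact: (L2_ext_exists le lj iso dense). Qed.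

Lemma L2_hartley_iso f g p q : L2_hartley f p -> L2_hartley g q ->
  sqn mu (p - q) = 2 * pi * sqn mu (f - g).
Proof. exact: (L2_ext_iso le lj iso). Qed.

Lemma L2_hartley_dot f g p q : L2_hartley f p -> L2_hartley g q ->
  L2dot mu p q = 2 * pi * L2dot mu f g.
Proof. exact: (L2_ext_dot le lj iso dense lin). Qed.

Lemma L2_hartley_lin a f g p q : L2_hartley f p -> L2_hartley g q ->
  L2_hartley (a \*o f + g) (a \*o p + q).
Proof. exact: (L2_ext_lin le lj lin). Qed.

Lemma L2_hartley_ae f f' p p' : L2_hartley f p -> Lsq mu f' -> Lsq mu p' ->
  f = f' %[ae mu] -> p = p' %[ae mu] -> L2_hartley f' p'.
Proof. exact: (L2_ext_ae le lj). Qed.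

Lemma L2_hartley_ae_eq f g p q : L2_hartley f p -> L2_hartley g q ->
  (f = g %[ae mu]) <-> (p = q %[ae mu]).
Proof.
move=> fp gq; have [lf lp _] := fp; have [lg lq _] := gq.
have pi0 : 2 * pi != 0 :> R by rewrite mulf_neq0// gt_eqF// pi_gt0.
split => /sqnB_eq0 h; apply/sqnB_eq0 => //; move: h => /(_ lf lg) || move: h => /(_ lp lq).
  by rewrite (L2_hartley_iso fp gq) => ->//; rewrite mulr0.
by rewrite (L2_hartley_iso fp gq) => /eqP; rewrite mulf_eq0 (negbTE pi0) => /eqP.
Qed.

Lemma L2_hartley_sym f g p q : L2_hartley f p -> L2_hartley g q ->
  L2dot mu p g = L2dot mu f q.
Proof.
move=> [lf lp [s [sf sp]]] [lg lq [t [tg tq]]].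
have c1 := cvg2_dot (fun n => lj (s n)) (fun n => le (t n)) lp lg sp tg.
have c2 := cvg2_dot (fun n => le (s n)) (fun n => lj (t n)) lf lq sf tq.
have E : (fun n => L2dot mu (hartley (sval (s n))) (sval (t n))) =
         (fun n => L2dot mu (sval (s n)) (hartley (sval (t n)))).
  apply/funext => n; apply: hartley_mult.
    by case: (s n) => ? [].
  by case: (t n) => ? [].
rewrite E in c1; exact: (cvg_unique (@Rhausdorff R) c1 c2).
Qed.

(** The transform [H] is self-adjoint and multiplies inner products by [2 * pi], hence
    [H (H q) = 2 * pi * q]: the difference of the two sides is orthogonal to itself. So [q] is the
    transform of [H q / (2 * pi)]. *)
Lemma L2_hartley_onto q : Lsq mu q -> exists f, L2_hartley f q.
Proof.
move=> lq; have [p qp] := L2_hartley_exists lq.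
have [_ lp _] := qp; have [r pr] := L2_hartley_exists lp.
have [_ lr _] := pr.
pose c : R := 2 * pi.
have c0 : c != 0 by rewrite mulf_neq0// gt_eqF// pi_gt0.
have lcq := LsqZ c lq.
have l1 := LsqB lr lcq.
have rq : r = c \*o q %[ae mu].
  apply/sqnB_eq0 => //; rewrite {1}/sqn L2dotBl// L2dotZl//.
  have [u gu] := L2_hartley_exists l1.
  by rewrite (L2_hartley_sym pr gu) (L2_hartley_dot qp gu) subrr.
have h0 : L2_hartley 0 0 by exact: (L2_ext0 le lj iso dense lin).
have h := L2_hartley_lin c^-1 pr h0.
exists (c^-1 \*o p + 0); apply: (L2_hartley_ae h) => //.
- by have [] := h.
- exact: aeW.
- apply: (ae_mono _ rq) => x e Tx; rewrite !fctE /= e//= addr0.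
  by rewrite mulKf.
Qed.

End hartley_L2.

(** * From the Hartley to the Fourier transform *)

Section fourier.
Variable R : realType.
Notation mu := (leb R).
Notation L1 f := (mu.-integrable setT (EFin \o (f : R -> R))).
Implicit Types (f g p q : R -> R) (w x : R) (z : R[i]).

Lemma cReM z1 z2 : complex.Re (z1 * z2) = complex.Re z1 * complex.Re z2 - complex.Im z1 * complex.Im z2.
Proof. by case: z1; case: z2. Qed.

Lemma cImM z1 z2 : complex.Im (z1 * z2) = complex.Re z1 * complex.Im z2 + complex.Im z1 * complex.Re z2.
Proof. by case: z1; case: z2. Qed.

Lemma cReB z1 z2 : complex.Re (z1 - z2) = complex.Re z1 - complex.Re z2.
Proof. by case: z1; case: z2. Qed.

Lemma cImB z1 z2 : complex.Im (z1 - z2) = complex.Im z1 - complex.Im z2.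
Proof. by case: z1; case: z2. Qed.

Lemma sqmod_ge0 z : 0 <= sqmod z.
Proof. by rewrite addr_ge0 ?sqr_ge0. Qed.

Lemma sqmodM z1 z2 : sqmod (z1 * z2) = sqmod z1 * sqmod z2.
Proof. by rewrite /sqmod cReM cImM; ring. Qed.

(** If [q] is the Hartley transform of a real [f], its even part is the cosine transform and its odd
    part the sine transform. The kernel [e^(- i w x)] takes the latter with a minus sign, which
    [oddp] includes; so [q] is recovered as [evenp q - oddp q]. *)
Definition evenp q : R -> R := fun w => (q w + q (- w)) / 2.
Definition oddp q : R -> R := fun w => - (q w - q (- w)) / 2.
Definition hat q : R -> R[i] := fun w => Complex (evenp q w) (oddp q w).

Lemma fourier1_hat f : L1 f -> fourier1 f = hat (hartley f).
Proof.
move=> lf; apply/funext => w; rewrite /fourier1 /cintegral /hat /evenp /oddp /hartley.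
have h1 := L1_cas w lf; have h2 := L1_cas (- w) lf.
have E1 : \int[mu]_x (f x * cas (w * x)) + \int[mu]_x (f x * cas (- w * x)) =
    2 * \int[mu]_x complex.Re (Complex (f x) 0 * cexp (Complex 0 (- (w * x)))).
  rewrite -RintegralD// -RintegralZl//.
    by apply: eq_Rintegral => x _; rewrite cReM /= expR0 /cas mulNr cosN sinN; ring.
  apply: (eq_integrable _ _ _ _ (integrableZl measurableT 2^-1 (integrableD measurableT h1 h2))) => // x _.
  by rewrite [in RHS]/comp cReM /= expR0 /cas mulNr cosN sinN; congr EFin; field.
have E2 : \int[mu]_x (f x * cas (w * x)) - \int[mu]_x (f x * cas (- w * x)) =
    - 2 * \int[mu]_x complex.Im (Complex (f x) 0 * cexp (Complex 0 (- (w * x)))).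
  rewrite -RintegralB// -RintegralZl//.
    by apply: eq_Rintegral => x _; rewrite cImM /= expR0 /cas mulNr cosN sinN; ring.
  apply: (eq_integrable _ _ _ _ (integrableZl measurableT (- 2^-1) (integrableB measurableT h1 h2))) => // x _.
  by rewrite [in RHS]/comp cImM /= expR0 /cas mulNr cosN sinN; congr EFin; field.
by rewrite E1 E2; congr Complex; field.
Qed.

Lemma Lsq_evenp q : Lsq mu q -> Lsq mu (evenp q).
Proof.
move=> lq; have l' := Lsq_opp lq.
rewrite (_ : evenp q = 2^-1 \*o (q + (fun w => q (- w)))).
  by apply: LsqZ; exact: LsqD.
by apply/funext => w; rewrite /evenp !fctE /= mulrC.
Qed.

Lemma Lsq_oddp q : Lsq mu q -> Lsq mu (oddp q).
Proof.
move=> lq; have l' := Lsq_opp lq.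
rewrite (_ : oddp q = (- 2^-1) \*o (q - (fun w => q (- w)))).
  by apply: LsqZ; exact: LsqB.
by apply/funext => w; rewrite /oddp !fctE /=; field.
Qed.

(** The parallelogram law for [q] and its reflection, which have the same norm. *)
Lemma sqn_hat q : Lsq mu q -> sqn mu (evenp q) + sqn mu (oddp q) = sqn mu q.
Proof.
move=> lq; have l' := Lsq_opp lq.
have -> : evenp q = 2^-1 \*o (q + (fun w => q (- w))).
  by apply/funext => w; rewrite /evenp !fctE /= mulrC.
have -> : oddp q = (- 2^-1) \*o (q - (fun w => q (- w))).
  by apply/funext => w; rewrite /oddp !fctE /=; field.
rewrite sqnZ; last exact: LsqD.
rewrite sqnZ; last exact: LsqB.
rewrite (sqnD lq l') (sqnB lq l') sqn_opp//; by field.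
Qed.

Lemma evenpB p q : evenp (p - q) = evenp p - evenp q.
Proof. by apply/funext => w; rewrite /evenp !fctE; field. Qed.

Lemma oddpB p q : oddp (p - q) = oddp p - oddp q.
Proof. by apply/funext => w; rewrite /oddp !fctE; field. Qed.

Lemma hatK q : evenp q - oddp q = q.
Proof. by apply/funext => w; rewrite /evenp /oddp !fctE; field. Qed.

Lemma integral_sqmod (G : R -> R[i]) : Lsq mu (fun w => complex.Re (G w)) ->
  Lsq mu (fun w => complex.Im (G w)) ->
  (\int[mu]_w (sqmod (G w))%:E)%E =
  (sqn mu (fun w => complex.Re (G w)) + sqn mu (fun w => complex.Im (G w)))%:E.
Proof.
move=> lr li; rewrite EFinD !sqnE// -ge0_integralD//.
- by move=> x _; rewrite lee_fin sqr_ge0.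
- by apply/measurable_EFinP; apply: measurable_funX; exact: Lsq_measurable lr.
- by move=> x _; rewrite lee_fin sqr_ge0.
- by apply/measurable_EFinP; apply: measurable_funX; exact: Lsq_measurable li.
Qed.

(** By [hatK] the only candidate is [q = Re F - Im F]. The sequence [h] that defines [F] also has
    Hartley transforms converging to [q]; their even and odd parts then converge both to those of
    [q] and to [Re F] and [Im F], so that the Hermitian symmetry of [F] follows from uniqueness of
    limits. *)
Lemma is_fourier2_hartley f F : is_fourier2 f F ->
  exists2 q, L2_hartley f q & {ae mu, forall w, F w = hat q w}.
Proof.
move=> [lf lr li [h [lh hf hF]]].
have l1 n : L1 (h n) by apply/Lfun1_integrable; case: (lh n).
have l2 n : Lsq mu (h n) by case: (lh n).
pose s n : L12 R := exist _ (h n) (conj (l1 n) (l2 n)).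
pose u n := hartley (h n).
have lu n : Lsq mu (u n) by case: (plancherel_L1 (l1 n) (l2 n)).
have lB n : Lsq mu (fun w => complex.Re (fourier1 (h n) w - F w)) /\
    Lsq mu (fun w => complex.Im (fourier1 (h n) w - F w)).
  rewrite fourier1_hat//; split.
    rewrite (_ : (fun w => _) = evenp (u n) - (fun w => complex.Re (F w))).
      by apply: LsqB => //; exact: Lsq_evenp.
    by apply/funext => w; rewrite cReB.
  rewrite (_ : (fun w => _) = oddp (u n) - (fun w => complex.Im (F w))).
    by apply: LsqB => //; exact: Lsq_oddp.
  by apply/funext => w; rewrite cImB.
have {}hF : sqn mu (evenp (u n) - (fun w => complex.Re (F w))) +
            sqn mu (oddp (u n) - (fun w => complex.Im (F w))) @[n --> \oo] --> 0.
  move: hF => /fine_cvgP[_]; apply: cvg_trans; apply: near_eq_cvg; apply: nearW => n /=.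
  have [lr' li'] := lB n; rewrite integral_sqmod//=.
  rewrite fourier1_hat//; congr (sqn mu _ + sqn mu _); apply/funext => w.
    by rewrite cReB.
  by rewrite cImB.
have er : sqn mu (evenp (u n) - (fun w => complex.Re (F w))) @[n --> \oo] --> 0.
  by apply: cvg0_le hF => n; rewrite ?sqn_ge0// lerDl sqn_ge0.
have ei : sqn mu (oddp (u n) - (fun w => complex.Im (F w))) @[n --> \oo] --> 0.
  by apply: cvg0_le hF => n; rewrite ?sqn_ge0// lerDr sqn_ge0.
pose q : R -> R := (fun w => complex.Re (F w)) - (fun w => complex.Im (F w)).
have lq : Lsq mu q by exact: LsqB.
have uq : sqn mu (u n - q) @[n --> \oo] --> 0.
  have := cvg2B (fun n => Lsq_evenp (lu n)) (fun n => Lsq_oddp (lu n)) lr li er ei.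
  rewrite (_ : (fun n => _) = (fun n => sqn mu (u n - q)))//.
  by apply/funext => n; rewrite hatK.
exists q; first by split => //; exists s; split => //; apply/L2cvgP.
have c1 : sqn mu (evenp (u n) - evenp q) @[n --> \oo] --> 0.
  apply: cvg0_le uq => n; first exact: sqn_ge0.
  rewrite -evenpB -(sqn_hat (LsqB (lu n) lq)) lerDl; exact: sqn_ge0.
have c2 : sqn mu (oddp (u n) - oddp q) @[n --> \oo] --> 0.
  apply: cvg0_le uq => n; first exact: sqn_ge0.
  rewrite -oddpB -(sqn_hat (LsqB (lu n) lq)) lerDr; exact: sqn_ge0.
have a1 := cvg2_uniq (fun n => Lsq_evenp (lu n)) lr (Lsq_evenp lq) er c1.
have a2 := cvg2_uniq (fun n => Lsq_oddp (lu n)) li (Lsq_oddp lq) ei c2.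
apply: (ae_mono _ (ae_and a1 a2)) => w [/(_ I) h1 /(_ I) h2]; rewrite /hat -h1 -h2.
by case: (F w).
Qed.

Lemma hartley_is_fourier2 f q F : L2_hartley f q ->
  measurable_fun setT (fun w => complex.Re (F w)) ->
  measurable_fun setT (fun w => complex.Im (F w)) ->
  {ae mu, forall w, F w = hat q w} -> is_fourier2 f F.
Proof.
move=> [lf lq [s [sf sq]]] mr mi Fq.
have a1 : evenp q = (fun w => complex.Re (F w)) %[ae mu].
  move: Fq; apply: ae_mono.
  by move=> w -> _.
have a2 : oddp q = (fun w => complex.Im (F w)) %[ae mu].
  move: Fq; apply: ae_mono.
  by move=> w -> _.
have lr := @Lsq_ae_eq _ _ _ mu _ _ mr a1 (Lsq_evenp lq).
have li := @Lsq_ae_eq _ _ _ mu _ _ mi a2 (Lsq_oddp lq).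
split => //; exists (fun n => sval (s n)).
have l1 n : L1 (sval (s n)) by case: (s n) => ? [].
have l2 n : Lsq mu (sval (s n)) by case: (s n) => ? [].
split; first by move=> n; split => //; apply/Lfun1_integrable.
  exact/L2cvgP.
pose u n := hartley (sval (s n)).
have lu n : Lsq mu (u n) by case: (plancherel_L1 (l1 n) (l2 n)).
have E n : (\int[mu]_w (sqmod (fourier1 (sval (s n)) w - F w)%R)%:E)%E = (sqn mu (u n - q))%:E.
  have e1 : sqn mu (evenp (u n) - (fun w => complex.Re (F w))) = sqn mu (evenp (u n - q)).
    rewrite evenpB; apply: sqn_ae_eq.
    - by apply: LsqB => //; exact: Lsq_evenp.
    - by apply: LsqB; exact: Lsq_evenp.
    - move: a1; apply: ae_mono.
      by move=> w h _; rewrite !fctE h.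
  have e2 : sqn mu (oddp (u n) - (fun w => complex.Im (F w))) = sqn mu (oddp (u n - q)).
    rewrite oddpB; apply: sqn_ae_eq.
    - by apply: LsqB => //; exact: Lsq_oddp.
    - by apply: LsqB; exact: Lsq_oddp.
    - move: a2; apply: ae_mono.
      by move=> w h _; rewrite !fctE h.
  have r1 : (fun w => complex.Re (fourier1 (sval (s n)) w - F w)) = evenp (u n) - (fun w => complex.Re (F w)).
    by apply/funext => w; rewrite cReB fourier1_hat.
  have r2 : (fun w => complex.Im (fourier1 (sval (s n)) w - F w)) = oddp (u n) - (fun w => complex.Im (F w)).
    by apply/funext => w; rewrite cImB fourier1_hat.
  rewrite integral_sqmod.
  - by rewrite r1 r2 e1 e2 sqn_hat//; exact: LsqB.
  - by rewrite r1; apply: LsqB => //; exact: Lsq_evenp.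
  - by rewrite r2; apply: LsqB => //; exact: Lsq_oddp.
under eq_fun do rewrite E.
by apply: cvg_EFin => //; exact: nearW.
Qed.

End fourier.

(** * Tempered fractional derivatives *)

Section tempered.
Variable R : realType.
Notation mu := (leb R).
Variables (lam k : R).
Hypothesis lam0 : 0 < lam.
Hypothesis k0 : 0 < k.
Implicit Types (f g p q phi psi : R -> R) (w x : R).

Definition symbol (w : R) : R[i] := rhp_pow (Complex lam (- w)) k.

Lemma sqmod_arg_gt0 w : 0 < lam ^+ 2 + w ^+ 2.
Proof. by rewrite ltr_pwDl ?exprn_gt0 ?sqr_ge0. Qed.

Lemma Re_sym w : complex.Re (symbol w) =
  (lam ^+ 2 + w ^+ 2) `^ (k / 2) * cos (k * atan (- w / lam)).
Proof. by rewrite /symbol /rhp_pow cReM /= expR0 /sqmod /= sqrrN; ring. Qed.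

Lemma Im_sym w : complex.Im (symbol w) =
  (lam ^+ 2 + w ^+ 2) `^ (k / 2) * sin (k * atan (- w / lam)).
Proof. by rewrite /symbol /rhp_pow cImM /= expR0 /sqmod /= sqrrN; ring. Qed.

(** With [Im_symN] this is the Hermitian symmetry of the symbol: multiplying or dividing by it keeps
    transforms of real functions among transforms of real functions. *)
Lemma Re_symN w : complex.Re (symbol (- w)) = complex.Re (symbol w).
Proof. by rewrite !Re_sym sqrrN mulNr mulNr atanN mulrN cosN. Qed.

Lemma Im_symN w : complex.Im (symbol (- w)) = - complex.Im (symbol w).
Proof. by rewrite !Im_sym sqrrN mulNr mulNr atanN mulrN sinN mulrN. Qed.

Lemma sqmod_sym w : sqmod (symbol w) = (lam ^+ 2 + w ^+ 2) `^ k.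
Proof.
rewrite /sqmod Re_sym Im_sym !exprMn -mulrDr cos2Dsin2 mulr1.
rewrite -[LHS]powR_mulrn ?powR_ge0// -powRrM; congr (_ `^ _); by field.
Qed.

Lemma sqmod_sym_gt0 w : 0 < sqmod (symbol w).
Proof. by rewrite sqmod_sym powR_gt0// sqmod_arg_gt0. Qed.

(** The minimum is attained at [w = 0]. This lower bound makes division by the symbol a bounded
    operation on [L^2]. *)
Lemma sqmod_sym_ge w : lam `^ (2 * k) <= sqmod (symbol w).
Proof.
rewrite sqmod_sym powRrM powR_mulrn ?(ltW lam0)//.
rewrite ge0_ler_powR ?(ltW k0)// ?nnegrE ?sqr_ge0 ?(ltW (sqmod_arg_gt0 w))//.
by rewrite lerDl sqr_ge0.
Qed.

Lemma measurable_arg_powR (r : R) : measurable_fun setT (fun w : R => (lam ^+ 2 + w ^+ 2) `^ r).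
Proof.
have mp : measurable_fun [set: R] ((@powR R)^~ r) by exact: measurable_powR.
have mq : measurable_fun setT (fun w : R => lam ^+ 2 + w ^+ 2).
  by apply: measurable_funD => //; exact: measurable_funX.
exact: (measurableT_comp mp mq).
Qed.

Lemma measurable_Re_sym : measurable_fun setT (fun w => complex.Re (symbol w)).
Proof.
under eq_fun do rewrite Re_sym.
apply: measurable_funM.
  exact: measurable_arg_powR.
apply: continuous_measurable_fun => w.
apply: continuous_comp; last exact: continuous_cos.
apply: cvgM; first exact: cvg_cst.
apply: continuous_comp; last exact: continuous_atan.
by apply: cvgM; [apply: cvgN; exact: cvg_id|exact: cvg_cst].
Qed.

Lemma measurable_Im_sym : measurable_fun setT (fun w => complex.Im (symbol w)).
Proof.
under eq_fun do rewrite Im_sym.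
apply: measurable_funM.
  exact: measurable_arg_powR.
apply: continuous_measurable_fun => w.
apply: continuous_comp; last exact: continuous_sin.
apply: cvgM; first exact: cvg_cst.
apply: continuous_comp; last exact: continuous_atan.
by apply: cvgM; [apply: cvgN; exact: cvg_id|exact: cvg_cst].
Qed.

(** Trades the complex representatives for real Hartley transforms, to which linearity, injectivity
    and surjectivity of [L2_hartley] apply directly. *)
Lemma is_tempered_derivP f phi : is_tempered_deriv lam k f phi <->
  exists q p, [/\ L2_hartley f q, L2_hartley phi p &
    {ae mu, forall w, symbol w * hat q w = hat p w}].
Proof.
split.
  move=> [_ [F /is_fourier2_hartley[q fq Fq] /is_fourier2_hartley[p php Fp]]].
  exists q, p; split => //.
  by apply: (ae_mono _ (ae_and Fq Fp)) => w [-> <-].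
move=> [q [p [fq php e]]].
have [lf lq _] := fq; have [lphi lp _] := php.
have me := Lsq_measurable (Lsq_evenp lq); have mo := Lsq_measurable (Lsq_oddp lq).
split => //; exists (hat q).
  by apply: hartley_is_fourier2 fq _ _ _ => //=; exact: aeW.
apply: (hartley_is_fourier2 php) e.
  under eq_fun do rewrite cReM /=.
  by apply: measurable_funB; apply: measurable_funM => //; [exact: measurable_Re_sym|exact: measurable_Im_sym].
under eq_fun do rewrite cImM /=.
by apply: measurable_funD; apply: measurable_funM => //; [exact: measurable_Re_sym|exact: measurable_Im_sym].
Qed.

Lemma hat_inj_ae p q : {ae mu, forall w, hat p w = hat q w} -> p = q %[ae mu].
Proof.
by apply: ae_mono => w h _; rewrite -(hatK p) -(hatK q) !fctE; case: h => -> ->.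
Qed.

(** [hat] also evaluates its argument at [- w], so the exceptional null set has to be reflected. *)
Lemma ae_hat p q : p = q %[ae mu] -> {ae mu, forall w, hat p w = hat q w}.
Proof.
move=> pq.
have pqN : {ae mu, forall w, p (- w) = q (- w)}.
  have [A [mA A0 sA]] := pq.
  exists (-%R @^-1` A); split.
  - by rewrite -[X in measurable X]setTI; apply: oppr_measurable.
  - have := lebesgue_measureN mA; by rewrite /pushforward A0.
  - by move=> w /= h; apply: sA => /= /(_ I).
by apply: (ae_mono _ (ae_and pq pqN)) => w [/(_ I) h1 h2]; rewrite /hat /evenp /oddp h1 h2.
Qed.

Lemma tempered_deriv_ae f g phi psi :
  is_tempered_deriv lam k f phi -> is_tempered_deriv lam k g psi ->
  (f = g %[ae mu]) <-> (phi = psi %[ae mu]).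
Proof.
move=> /is_tempered_derivP[q [p [fq phip e1]]] /is_tempered_derivP[q' [p' [gq psip e2]]].
split=> h.
  apply/(L2_hartley_ae_eq phip psip)/hat_inj_ae.
  have := ae_hat ((L2_hartley_ae_eq fq gq).1 h).
  by move/(ae_and (ae_and e1 e2)); apply: ae_mono => w [[<- <-] ->].
apply/(L2_hartley_ae_eq fq gq)/hat_inj_ae.
have := ae_hat ((L2_hartley_ae_eq phip psip).1 h).
move/(ae_and (ae_and e1 e2)); apply: ae_mono => w [[h1 h2] h3].
apply: (@mulfI _ (symbol w)); last by rewrite h1 h2 h3.
apply/eqP => s0; have := sqmod_sym_gt0 w; rewrite s0 /sqmod /=.
by rewrite expr0n /= addr0 ltxx.
Qed.

Lemma tempered_deriv_lin (a : R) f g phi psi :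
  is_tempered_deriv lam k f phi -> is_tempered_deriv lam k g psi ->
  is_tempered_deriv lam k (a \*o f + g) (a \*o phi + psi).
Proof.
move=> /is_tempered_derivP[q [p [fq phip e1]]] /is_tempered_derivP[q' [p' [gq psip e2]]].
apply/is_tempered_derivP; exists (a \*o q + q'), (a \*o p + p'); split.
- exact: L2_hartley_lin.
- exact: L2_hartley_lin.
have hatD u v w : hat (a \*o u + v) w = Complex a 0 * hat u w + hat v w.
  rewrite /hat /evenp /oddp !fctE /=.
  by apply/eqP; rewrite eq_complex /=; apply/andP; split; apply/eqP; field.
apply: (ae_mono _ (ae_and e1 e2)) => w [h1 h2].
by rewrite !hatD mulrDr mulrCA h1 h2.
Qed.

(** The weight in [W2] is the squared modulus of the symbol, so the weighted integral is that of the
    transform of [phi]. *)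
Lemma tempered_deriv_W2 f phi : is_tempered_deriv lam k f phi -> W2 lam k f.
Proof.
move=> [lphi [F fF [_ lRe lIm _]]]; have [lf _ _ _] := fF.
split => //; exists F => //.
under eq_integral do rewrite -sqmod_sym -sqmodM.
by rewrite (integral_sqmod lRe lIm) ltry.
Qed.

(** The transform of [phi] is divided by the symbol. The quotient is Hermitian, hence [hat q] for a
    real [q], and [q] is square integrable by [sqmod_sym_ge]; surjectivity of the Hartley transform
    then supplies [f]. *)
Lemma tempered_deriv_onto phi : Lsq mu phi ->
  exists2 f, W2 lam k f & is_tempered_deriv lam k f phi.
Proof.
move=> lphi; have [p php] := L2_hartley_exists lphi.
have [_ lp _] := php.
pose a w := complex.Re (symbol w); pose b w := complex.Im (symbol w).
pose S w := sqmod (symbol w).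
have S0 w : S w != 0 by rewrite gt_eqF// sqmod_sym_gt0.
have SE w : S w = a w ^+ 2 + b w ^+ 2 by [].
have aN w : a (- w) = a w by exact: Re_symN.
have bN w : b (- w) = - b w by exact: Im_symN.
have SN w : S (- w) = S w by rewrite !SE aN bN sqrrN.
have eN w : evenp p (- w) = evenp p w by rewrite /evenp opprK addrC.
have oN w : oddp p (- w) = - oddp p w by rewrite /oddp opprK; field.
(* [Fr] and [Fi] are the real and imaginary parts of [hat p] times the conjugate of the symbol,
   divided by its squared modulus. *)
pose Fr w := (a w * evenp p w + b w * oddp p w) / S w.
pose Fi w := (a w * oddp p w - b w * evenp p w) / S w.
pose q : R -> R := fun w => Fr w - Fi w.
have FrN w : Fr (- w) = Fr w by rewrite /Fr aN bN SN eN oN mulrNN.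
have FiN w : Fi (- w) = - Fi w by rewrite /Fi aN bN SN eN oN; field.
have hq w : hat q w = Complex (Fr w) (Fi w).
  by rewrite /hat /evenp /oddp /q FrN FiN; congr Complex; field.
have mS : measurable_fun setT S.
  by apply: measurable_funD; apply: measurable_funX; [exact: measurable_Re_sym|exact: measurable_Im_sym].
have mSV : measurable_fun setT (fun w => (S w)^-1).
  under eq_fun do rewrite /S sqmod_sym -powRN.
  exact: measurable_arg_powR.
have me := Lsq_measurable (Lsq_evenp lp); have mo := Lsq_measurable (Lsq_oddp lp).
have ma := measurable_Re_sym; have mb := measurable_Im_sym.
have mFr : measurable_fun setT Fr.
  by apply: measurable_funM => //; apply: measurable_funD; apply: measurable_funM.
have mFi : measurable_fun setT Fi.
  by apply: measurable_funM => //; apply: measurable_funB; apply: measurable_funM.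
have symF w : symbol w * hat q w = hat p w.
  have sE : symbol w = Complex (a w) (b w) by rewrite /a /b; case: (symbol w).
  rewrite hq sE; apply/eqP; rewrite eq_complex /=.
  move: (S0 w); rewrite /Fr /Fi !SE; move: (a w) (b w) => A B h.
  by apply/andP; split; apply/eqP; field.
pose c := lam `^ (2 * k).
have c0 : 0 < c by exact: powR_gt0.
have lG : (\int[mu]_w (sqmod (hat p w))%:E)%E = (sqn mu p)%:E.
  rewrite integral_sqmod; [|exact: Lsq_evenp|exact: Lsq_oddp].
  by rewrite -(sqn_hat lp).
have lq : Lsq mu q.
  apply/LsqP; split; first exact: measurable_funB.
  have mG : measurable_fun setT (fun w => (sqmod (hat p w))%:E).
    by apply/measurable_EFinP; apply: measurable_funD; exact: measurable_funX.
  (* The factor 2 comes from [(Fr - Fi)^2 <= 2 (Fr^2 + Fi^2)], the factor [c^-1] from the lower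
     bound on the symbol. *)
  apply: (@le_lt_trans _ _ (\int[mu]_w ((2 / c)%:E * (sqmod (hat p w))%:E))%E); last first.
    rewrite ge0_integralZl//.
    - by rewrite lG -EFinM ltry.
    - by move=> w _; rewrite lee_fin sqmod_ge0.
    - by rewrite lee_fin divr_ge0// ltW.
  apply: ge0_le_integral => //.
  - by move=> w _; rewrite lee_fin sqr_ge0.
  - by apply/measurable_EFinP; apply: measurable_funX; exact: measurable_funB.
  - by apply: emeasurable_funM => //; exact: measurable_cst.
  move=> w _; rewrite -EFinM lee_fin -symF sqmodM hq -/(S w) /q.
  apply: (@le_trans _ _ (2 * (Fr w ^+ 2 + Fi w ^+ 2))).
    by have := sqr_ge0 (Fr w + Fi w); nra.
  rewrite /sqmod /= -mulrA ler_wpM2l// mulrA ler_peMl ?addr_ge0 ?sqr_ge0//.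
  by rewrite mulrC ler_pdivlMr// mul1r; exact: sqmod_sym_ge.
have [f fq] := L2_hartley_onto lq.
have fphi : is_tempered_deriv lam k f phi.
  by apply/is_tempered_derivP; exists q, p; split => //; exact: aeW.
by exists f => //; exact: tempered_deriv_W2 fphi.
Qed.

End tempered.

(** * Second moments of Levy processes *)

Section trig_bounds.
Variable R : realType.
Implicit Types u x : R.

Lemma sin_abs_le u : `|sin u| <= `|u|.
Proof.
wlog u0 : u / 0 <= u.
  move=> h; case: (leP 0 u) => [/h//|/ltW u0].
  by rewrite -normrN -sinN -[leRHS]normrN; apply: h; rewrite oppr_ge0.
have [c _] := @MVT_segment R sin cos 0 u u0 (fun x _ => is_derive_sin x)
  (continuous_subspaceT (@continuous_sin R)).
rewrite sin0 !subr0 => ->; rewrite normrM -[leRHS]mul1r ler_wpM2r//.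
exact: cos_max.
Qed.

Lemma cos1_half u : 1 - cos u = 2 * sin (u / 2) ^+ 2.
Proof.
have -> : cos u = cos (u / 2 + u / 2) by congr cos; field.
by rewrite cosD -expr2 -expr2 cos2sin2; ring.
Qed.

Lemma cos_taylor u : `|1 - cos u| <= u ^+ 2 / 2.
Proof.
rewrite cos1_half ger0_norm; last by rewrite mulr_ge0// sqr_ge0.
have := sin_abs_le (u / 2); rewrite -ler_sqr ?nnegrE// !real_normK ?num_real//.
have -> : (u / 2) ^+ 2 = u ^+ 2 / 4 by field.
lra.
Qed.

Lemma cos1_abs_le u : `|cos u - 1| <= `|u|.
Proof.
rewrite distrC cos1_half ger0_norm; last by rewrite mulr_ge0// sqr_ge0.
have h1 := sin_abs_le (u / 2); have h2 := sin_max (u / 2).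
rewrite -[sin _ ^+ 2]real_normK ?num_real// expr2.
have -> : `|u| = 2 * `|u / 2| by rewrite normrM (ger0_norm (_ : 0 <= 2^-1))//; field.
by have := normr_ge0 (sin (u / 2)); nra.
Qed.

(** A quadratic remainder suits the application better than the sharper cubic one near zero:
    [x ^+ 2] is integrable for the Levy measure both near zero and at infinity. *)
Lemma sin_taylor u : `|sin u - u| <= u ^+ 2.
Proof.
wlog u0 : u / 0 <= u.
  move=> h; case: (leP 0 u) => [/h//|/ltW u0].
  have := h (- u); rewrite oppr_ge0 sinN -opprD normrN sqrrN; exact.
have dS x : is_derive x 1 (fun v => sin v - v) (cos x - 1).
  exact: is_deriveB (is_derive_sin x) (is_derive_id x 1).
have [c /[!in_itv]/= /andP[c0 cu]] := @MVT_segment R _ _ 0 u u0 (fun x _ => dS x)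
  (continuous_subspaceT (fun x => cvgB (@continuous_sin R x) cvg_id)).
rewrite sin0 !subr0 => ->; rewrite normrM (ger0_norm u0) expr2 ler_wpM2r//.
by rewrite (le_trans (cos1_abs_le c))// ger0_norm.
Qed.

Lemma cvg_sin_quot (th : nat -> R) x : (forall n, 0 < th n) -> th n @[n --> \oo] --> 0 ->
  sin (th n * x) / th n @[n --> \oo] --> x.
Proof.
move=> th0 thc; apply/subr_cvg0; apply: norm_cvg0.
apply: (@cvg0_le _ _ (fun n => th n * x ^+ 2)) => [n|n|].
- exact: normr_ge0.
- have tn : th n != 0 by rewrite gt_eqF.
  have -> : sin (th n * x) / th n - x = (sin (th n * x) - th n * x) / th n by field.
  rewrite normrM (ger0_norm (_ : 0 <= (th n)^-1)) ?invr_ge0 ?(ltW (th0 n))//.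
  rewrite ler_pdivrMr// (le_trans (sin_taylor _))// exprMn expr2.
  by rewrite le_eqVlt; apply/orP; left; apply/eqP; ring.
- by rewrite -[X in _ --> X](mul0r (x ^+ 2)); apply: cvgM => //; exact: cvg_cst.
Qed.

Lemma cvg_cos_quot (th : nat -> R) x : (forall n, 0 < th n) -> th n @[n --> \oo] --> 0 ->
  (1 - cos (th n * x)) / th n ^+ 2 @[n --> \oo] --> x ^+ 2 / 2.
Proof.
move=> th0 thc.
have -> : (fun n => (1 - cos (th n * x)) / th n ^+ 2) =
    (fun n => 2 * ((sin (th n * (x / 2)) / th n) * (sin (th n * (x / 2)) / th n))).
  apply/funext => n; have tn : th n != 0 by rewrite gt_eqF.
  by rewrite cos1_half -mulrA; field.
have -> : x ^+ 2 / 2 = 2 * ((x / 2) * (x / 2)) by field.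
apply: cvgM; first exact: cvg_cst.
by apply: cvgM; exact: cvg_sin_quot.
Qed.

End trig_bounds.

(** * The Levy exponent near the origin *)

Section levy_measure_moments.
Variable R : realType.
Notation RT := (measurableTypeR R).
Variable nu : {measure set RT -> \bar R}.
Hypothesis hnu : levy_measure nu.

Definition levy_var : R := \int[nu]_x x ^+ 2.

(** [x ^+ 2] is at most [min (x ^+ 2) 1] plus its restriction to [|x| > 1], and both are integrable
    by hypothesis. *)
Lemma Lsq_id_levy : Lsq nu (id : R -> R).
Proof.
have [_ h1 h2] := hnu.
apply/LsqP; split; first exact: measurable_id.
have mn : measurable_fun [set: RT] (fun x : RT => `|x| : RT) by exact: measurableT_comp.
pose D := [set x : R | 1 < `|x|].
have mD : measurable (D : set RT).
  rewrite (_ : D = (fun x : RT => `|x| : RT) @^-1` `]1, +oo[).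
    by rewrite -[X in measurable X]setTI; apply: mn.
  by apply/seteqP; split => x /=; rewrite in_itv /= andbT.
have msq : measurable_fun [set: RT] (fun x : R => (x ^+ 2)%:E).
  by apply/measurable_EFinP; exact: measurable_funX.
have mmin : measurable_fun [set: RT] (fun x : R => (Num.min (`|x| ^+ 2) 1)%:E).
  apply/measurable_EFinP; apply: measurable_minr => //; apply: measurable_funX.
  exact: mn.
pose g := (fun x : R => (x ^+ 2)%:E) \_ D.
have mg : measurable_fun [set: RT] g.
  by apply/(measurable_restrictT _ mD); exact: measurable_funS msq.
have g0 x : (0 <= g x)%E.
  by rewrite /g patchE; case: ifP => // _; rewrite lee_fin sqr_ge0.
have m0 (x : R) : (0 <= (Num.min (`|x| ^+ 2) 1)%:E)%E.
  by rewrite lee_fin le_min sqr_ge0 ler01.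
apply: (@le_lt_trans _ _ (\int[nu]_x ((Num.min (`|x| ^+ 2) 1)%:E + g x))%E); last first.
  rewrite ge0_integralD// lte_add_pinfty//.
  by rewrite /g -integral_mkcond.
apply: ge0_le_integral => //.
- by move=> x _; rewrite lee_fin sqr_ge0.
- exact: emeasurable_funD.
move=> x _; rewrite /g patchE; case: ifPn => [_|/negP h].
  by rewrite -EFinD lee_fin lerDr le_min sqr_ge0 ler01.
rewrite adde0 lee_fin le_min real_normK ?num_real// lexx /=.
have {}h : `|x| <= 1 by rewrite leNgt; apply/negP => h1'; apply: h; rewrite inE.
by rewrite -[x ^+ 2]real_normK ?num_real// expr_le1.
Qed.

Lemma levy_varE : levy_var = sqn nu (id : R -> R).
Proof. by apply: eq_Rintegral => x _; rewrite expr2. Qed.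

Lemma levy_var_ge0 : 0 <= levy_var.
Proof. by rewrite levy_varE sqn_ge0. Qed.

(** If the second moment vanished, [nu] would be carried by the origin, where it has no mass. *)
Lemma levy_var_gt0 : nu [set: RT] <> 0%E -> 0 < levy_var.
Proof.
move=> nu0; rewrite lt0r levy_var_ge0 andbT; apply/eqP; rewrite levy_varE => s0.
apply: nu0; have [n0 _ _] := hnu.
have [A [mA A0 sA]] := sqn_eq0 Lsq_id_levy s0.
apply/eqP; rewrite -measure_le0.
have -> : [set: RT] = [set 0 : R] `|` A.
  apply/seteqP; split => // x _; have [->|x0] := eqVneq x 0; [by left|right].
  by apply: sA => /= /(_ I) x00; rewrite x00 eqxx in x0.
have m1 : measurable ([set 0 : R] : set RT) by exact: measurable_set1.
apply: le_trans (measureU2 nu m1 mA) _.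
by move: n0 A0 => /= -> ->; rewrite adde0.
Qed.

Lemma integrable_sqr_levy : nu.-integrable [set: RT] (EFin \o (fun x : R => x ^+ 2)).
Proof. exact: L2dot_integrable Lsq_id_levy Lsq_id_levy. Qed.

Definition psi_re (th : R) : R := \int[nu]_x (cos (th * x) - 1).
Definition psi_im (th : R) : R := \int[nu]_x (sin (th * x) - th * x).

Lemma levy_exponentE th : levy_exponent nu th = Complex (psi_re th) (psi_im th).
Proof.
rewrite /levy_exponent /cintegral; congr Complex; apply: eq_Rintegral => x _.
  by rewrite /= expR0; ring.
by rewrite /= expR0; ring.
Qed.

Lemma measurable_fun_mulcos th : measurable_fun [set: RT] (fun x : R => cos (th * x)).
Proof.
apply: continuous_measurable_fun => w.
by apply: continuous_comp; [apply: cvgM; [exact: cvg_cst|exact: cvg_id]|exact: continuous_cos].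
Qed.

Lemma measurable_fun_mulsin th : measurable_fun [set: RT] (fun x : R => sin (th * x)).
Proof.
apply: continuous_measurable_fun => w.
by apply: continuous_comp; [apply: cvgM; [exact: cvg_cst|exact: cvg_id]|exact: continuous_sin].
Qed.

(** The compensator [th * x] leaves a quadratic bound in [th], so the phase of the characteristic
    function is negligible to first order. This gives mean zero and removes the phase from the
    second-order quotient. *)
Lemma psi_im_bound th : `|psi_im th| <= th ^+ 2 * levy_var.
Proof.
have i2 := integrableZl measurableT (th ^+ 2) integrable_sqr_levy.
have i1 : nu.-integrable [set: RT] (EFin \o (fun x : R => sin (th * x) - th * x)).
  apply: le_integrable i2 => //.
    apply/measurable_EFinP; apply: measurable_funB; first exact: measurable_fun_mulsin.
    exact: measurable_funM.
  move=> x _; rewrite /= lee_fin (le_trans (sin_taylor _))// exprMn.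
  exact: ler_norm.
apply: le_trans (le_normr_Rintegral measurableT i1) _.
rewrite /levy_var -RintegralZl//; last exact: integrable_sqr_levy.
apply: le_Rintegral => //; first exact: integrable_norm.
by move=> x _; rewrite (le_trans (sin_taylor _))// exprMn.
Qed.

Lemma psi_re_bound th : - (th ^+ 2 * levy_var / 2) <= psi_re th <= 0.
Proof.
have i2 := integrableZl measurableT (th ^+ 2 / 2) integrable_sqr_levy.
have b x : `|cos (th * x) - 1| <= th ^+ 2 / 2 * x ^+ 2.
  by rewrite distrC (le_trans (cos_taylor _))// exprMn mulrAC.
have i1 : nu.-integrable [set: RT] (EFin \o (fun x : R => cos (th * x) - 1)).
  apply: le_integrable i2 => //.
    apply/measurable_EFinP; apply: measurable_funB => //; exact: measurable_fun_mulcos.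
  by move=> x _; rewrite /= lee_fin (le_trans (b x))// ler_norm.
apply/andP; split; last first.
  rewrite -oppr_ge0 -mulN1r -RintegralZl//; apply: Rintegral_ge0 => x _.
  by have := cos_le1 (th * x); lra.
have : `|psi_re th| <= th ^+ 2 / 2 * levy_var.
  apply: le_trans (le_normr_Rintegral measurableT i1) _.
  rewrite /levy_var -RintegralZl//; last exact: integrable_sqr_levy.
  by apply: le_Rintegral => //; exact: integrable_norm.
by rewrite ler_norml mulrAC => /andP[].
Qed.

Lemma psi_re_cvg (th : nat -> R) : (forall n, 0 < th n) -> th n @[n --> \oo] --> 0 ->
  psi_re (th n) / th n ^+ 2 @[n --> \oo] --> - (levy_var / 2).
Proof.
move=> th0 thc.
have i2 := integrableZr measurableT (2^-1) integrable_sqr_levy.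
have b (t x : R) : `|1 - cos (t * x)| <= t ^+ 2 / 2 * x ^+ 2.
  by rewrite (le_trans (cos_taylor _))// exprMn mulrAC.
have i1 n : nu.-integrable [set: RT] (EFin \o (fun x : R => 1 - cos (th n * x))).
  apply: (le_integrable measurableT _ _ (integrableZl measurableT (th n ^+ 2 / 2) integrable_sqr_levy)) => //.
    apply/measurable_EFinP; apply: measurable_funB => //; exact: measurable_fun_mulcos.
  by move=> x _; rewrite /= lee_fin (le_trans (b _ _))// ler_norm.
have -> : (fun n => psi_re (th n) / th n ^+ 2) =
   (fun n => - \int[nu]_x ((1 - cos (th n * x)) / th n ^+ 2)).
  apply/funext => n; rewrite RintegralZr// -mulNr; congr (_ * _).
  rewrite -mulN1r -RintegralZl//; apply: eq_Rintegral => x _; ring.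
apply: cvgN.
have -> : levy_var / 2 = \int[nu]_x (x ^+ 2 / 2).
  by rewrite RintegralZr//; exact: integrable_sqr_levy.
apply: (Rdominated_cvg _ _ _ i2 _).2.
- move=> n; apply: measurable_funM => //; apply: measurable_funB => //; exact: measurable_fun_mulcos.
- by apply: measurable_funM => //; exact: measurable_funX.
- by apply: aeW => x; exact: cvg_cos_quot.
- move=> n x /=; rewrite normrM (ger0_norm (_ : 0 <= (th n ^+ 2)^-1)); last first.
    by rewrite invr_ge0 sqr_ge0.
  rewrite ler_pdivrMr ?exprn_gt0//.
  by rewrite (le_trans (b _ _))// le_eqVlt; apply/orP; left; apply/eqP; ring.
Qed.

End levy_measure_moments.

(** * First and second moments from the characteristic function *)

Section levy_moments.
Context d (Om : measurableType d) (R : realType) (P : probability Om R).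
Notation RT := (measurableTypeR R).
Variable nu : {measure set RT -> \bar R}.
Hypothesis hnu : levy_measure nu.
Variable X : R -> Om -> R.
Hypothesis hX : levy_process P nu X.
Notation s2 := (levy_var nu).

Lemma charfun_re t th : 0 <= t -> \int[P]_w cos (th * X t w) =
  expR (t * psi_re nu th) * cos (t * psi_im nu th).
Proof.
move=> t0; have := levy_charfun hX th t0.
rewrite levy_exponentE /cintegral => /(congr1 (@complex.Re R)) /=.
rewrite !mul0r subr0 addr0 => <-.
by apply: eq_Rintegral => w _; rewrite expR0 mul1r.
Qed.

Lemma charfun_im t th : 0 <= t -> \int[P]_w sin (th * X t w) =
  expR (t * psi_re nu th) * sin (t * psi_im nu th).
Proof.
move=> t0; have := levy_charfun hX th t0.
rewrite levy_exponentE /cintegral => /(congr1 (@complex.Im R)) /=.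
rewrite !mul0r subr0 addr0 => <-.
by apply: eq_Rintegral => w _; rewrite expR0 mul1r.
Qed.

Definition theta n : R := n.+1%:R^-1.

Lemma theta_gt0 n : 0 < theta n. Proof. by rewrite invr_gt0. Qed.

Lemma theta_cvg : theta n @[n --> \oo] --> 0. Proof. exact: cvg_harmonic. Qed.

Lemma psi_im_cvg : psi_im nu (theta n) / theta n @[n --> \oo] --> 0.
Proof.
apply: norm_cvg0; apply: (@cvg0_le _ _ (fun n => theta n * s2)) => [n|n|].
- exact: normr_ge0.
- rewrite normrM (ger0_norm (_ : 0 <= (theta n)^-1)) ?invr_ge0 ?(ltW (theta_gt0 n))//.
  rewrite ler_pdivrMr ?theta_gt0// (le_trans (psi_im_bound hnu _))// expr2.
  by rewrite le_eqVlt; apply/orP; left; apply/eqP; ring.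
- by rewrite -[X in _ --> X](mul0r s2); apply: cvgM; [exact: theta_cvg|exact: cvg_cst].
Qed.

(* Tends to half the second moment of [X t], and is computed from the
   characteristic function. *)
Definition cosquot t n : R := \int[P]_w ((1 - cos (theta n * X t w)) / theta n ^+ 2).

Lemma measurable_cosX t th : 0 <= t -> measurable_fun setT (fun w => cos (th * X t w)).
Proof.
move=> t0; apply: (measurableT_comp (measurable_fun_mulcos th)).
exact: (levy_measurable hX t0).
Qed.

Lemma measurable_sinX t th : 0 <= t -> measurable_fun setT (fun w => sin (th * X t w)).
Proof.
move=> t0; apply: (measurableT_comp (measurable_fun_mulsin th)).
exact: (levy_measurable hX t0).
Qed.

Lemma bounded_integrableP (f : Om -> R) (C : R) : measurable_fun setT f ->
  (forall w, `|f w| <= C) -> P.-integrable setT (EFin \o f).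
Proof.
move=> mf fC.
apply: (@le_integrable _ _ _ P setT measurableT _ (EFin \o cst C)).
  exact/measurable_EFinP.
  by move=> w _; rewrite /= lee_fin (le_trans (fC w))// ler_norm.
exact: finite_measure_integrable_cst.
Qed.

Lemma integrable_1cosX t th : 0 <= t -> P.-integrable setT (EFin \o (fun w => 1 - cos (th * X t w))).
Proof.
move=> t0; apply: (@bounded_integrableP _ 2).
  by apply: measurable_funB => //; exact: measurable_cosX.
by move=> w; rewrite (le_trans (ler_normB _ _))// normr1; have := cos_max (th * X t w); lra.
Qed.

Lemma integrable_cosX t th : 0 <= t -> P.-integrable setT (EFin \o (fun w => cos (th * X t w))).
Proof.
by move=> t0; apply: (@bounded_integrableP _ 1); [exact: measurable_cosX|move=> w; exact: cos_max].
Qed.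

Lemma cosquotE t n : 0 <= t -> cosquot t n =
  (1 - expR (t * psi_re nu (theta n)) * cos (t * psi_im nu (theta n))) / theta n ^+ 2.
Proof.
move=> t0; rewrite /cosquot.
have ic := integrable_cosX (theta n) t0.
have i1 : P.-integrable setT (EFin \o cst 1) by exact: finite_measure_integrable_cst.
rewrite RintegralZr//; last exact: integrable_1cosX.
rewrite RintegralB// charfun_re// Rintegral_cst//.
by rewrite (congr1 fine (probability_setT P) : fine (P [set: Om]) = 1) mul1r.
Qed.

(** Write [1 - e^(t a) cos (t b)] as [(1 - e^(t a)) + e^(t a) (1 - cos (t b))]. The second term is
    of order [b^2], negligible against [theta^2]; the first is squeezed between [- t a / (1 - t a)]
    and [- t a], and [psi_re_cvg] gives the limit of both bounds. *)
Lemma cosquot_cvg t : 0 <= t -> cosquot t n @[n --> \oo] --> t * s2 / 2.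
Proof.
move=> t0.
pose a n := psi_re nu (theta n); pose b n := psi_im nu (theta n).
have a0 n : a n <= 0 by have /andP[] := psi_re_bound hnu (theta n).
have aq := psi_re_cvg hnu theta_gt0 theta_cvg.
have -> : (cosquot t) = (fun n => (1 - expR (t * a n)) / theta n ^+ 2 +
    expR (t * a n) * (1 - cos (t * b n)) / theta n ^+ 2).
  by apply/funext => n; rewrite cosquotE// -/(a n) -/(b n); field; rewrite gt_eqF ?theta_gt0.
rewrite -[X in _ --> X]addr0; apply: cvgD; last first.
  apply: (@cvg0_le _ _ (fun n => t ^+ 2 / 2 * ((b n / theta n) * (b n / theta n)))) => [n|n|].
  - rewrite mulr_ge0 ?invr_ge0 ?sqr_ge0// mulr_ge0 ?expR_ge0// subr_ge0; exact: cos_le1.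
  - rewrite ler_pdivrMr ?exprn_gt0 ?theta_gt0//.
    apply: (@le_trans _ _ (1 - cos (t * b n))).
      rewrite ler_piMl ?subr_ge0 ?cos_le1// -expR0 ler_expR.
      by rewrite mulr_ge0_le0.
    rewrite (le_trans (ler_norm _))// (le_trans (cos_taylor _))//.
    rewrite le_eqVlt; apply/orP; left; apply/eqP; field.
    by rewrite gt_eqF ?theta_gt0.
  - rewrite -[X in _ --> X](mulr0 (t ^+ 2 / 2)); apply: cvgM; first exact: cvg_cst.
    by rewrite -[X in _ --> X](mulr0 0); apply: cvgM; exact: psi_im_cvg.
have ac : a n @[n --> \oo] --> 0.
  have -> : a = (fun n => a n / theta n ^+ 2 * (theta n * theta n)).
    by apply/funext => n; rewrite -expr2 mulfVK// gt_eqF// exprn_gt0// theta_gt0.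
  rewrite -[X in _ --> X](_ : - (s2 / 2) * (0 * 0) = 0); last by rewrite !mulr0.
  by apply: cvgM => //; apply: cvgM; exact: theta_cvg.
have up : (- t) * (a n / theta n ^+ 2) @[n --> \oo] --> t * s2 / 2.
  have -> : t * s2 / 2 = (- t) * (- (s2 / 2)) by ring.
  by apply: cvgM => //; exact: cvg_cst.
have lo : (- t) * (a n / theta n ^+ 2) / (1 - t * a n) @[n --> \oo] --> t * s2 / 2.
  rewrite -[X in _ --> X](_ : t * s2 / 2 / (1 - t * 0) = _); last by rewrite mulr0 subr0 divr1.
  apply: cvgM => //; apply: cvgV; first by rewrite mulr0 subr0 oner_neq0.
  by apply: cvgB; [exact: cvg_cst|apply: cvgM => //; exact: cvg_cst].
apply: squeeze_cvgr lo up; apply: nearW => n.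
have th2 : 0 < theta n ^+ 2 by rewrite exprn_gt0// theta_gt0.
have ta : t * a n <= 0 by rewrite mulr_ge0_le0.
have p1 : 0 < 1 - t * a n by lra.
apply/andP; split.
  rewrite (_ : _ / (1 - t * a n) = (- (t * a n) / (1 - t * a n)) / theta n ^+ 2); last first.
    by field; rewrite !gt_eqF ?theta_gt0.
  rewrite ler_pM2r ?invr_gt0//.
  (* The inequality [1 + x <= e^x] at [x = - t a], inverted. *)
  have h : expR (t * a n) <= (1 - t * a n)^-1.
    rewrite -[t * a n in leLHS]opprK expRN lef_pV2 ?posrE ?expR_gt0//.
    exact: expR_ge1Dx.
  have -> : - (t * a n) / (1 - t * a n) = 1 - (1 - t * a n)^-1 by field; rewrite gt_eqF.
  lra.
rewrite mulrA ler_pM2r ?invr_gt0//.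
have := expR_ge1Dx (t * a n); lra.
Qed.

Lemma integrable_cosquot t n : 0 <= t ->
  P.-integrable setT (EFin \o (fun w => (1 - cos (theta n * X t w)) / theta n ^+ 2)).
Proof.
move=> t0; have := integrableZr measurableT (theta n ^+ 2)^-1 (integrable_1cosX (theta n) t0).
by apply: eq_integrable.
Qed.

(** The integrands of [cosquot] tend pointwise to [X t ^+ 2 / 2] while their integrals converge,
    hence are eventually below the limit plus 1; Fatou then bounds the second moment. *)
Lemma levy_Lsq t : 0 <= t -> Lsq P (X t).
Proof.
move=> t0; have mX := levy_measurable hX t0.
have /cvgrPdist_le/(_ 1 ltr01)[N _ NP] := cosquot_cvg t0.
pose g n w := (1 - cos (theta (n + N)%N * X t w)) / theta (n + N)%N ^+ 2.
have h : (\int[P]_w `|(X t w ^+ 2 / 2)%:E| <= (t * s2 / 2 + 1)%:E)%E.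
  apply: (@fatou_bound _ _ _ P g).
  - move=> n; apply: measurable_funM => //; apply: measurable_funB => //; exact: measurable_cosX.
  - by apply: measurable_funM => //; exact: measurable_funX.
  - move=> n w; rewrite /g mulr_ge0 ?invr_ge0 ?sqr_ge0// subr_ge0; exact: cos_le1.
  - apply: aeW => w; rewrite /g (cvg_shiftn N (fun n => (1 - cos (theta n * X t w)) / theta n ^+ 2)).
    exact: cvg_cos_quot theta_gt0 theta_cvg.
  - move=> n; have /= := NP (n + N)%N (leq_addl _ _).
    rewrite ler_distl => /andP[hle _].
    have := integrable_cosquot (n + N)%N t0 => /(integrable_fin_num measurableT) fin.
    rewrite -[leLHS]fineK// lee_fin; rewrite (_ : fine _ = cosquot t (n + N)%N)//; lra.
apply/LsqP; split => //.
rewrite (_ : (\int[P]_w (X t w ^+ 2)%:E = 2%:E * \int[P]_w `|(X t w ^+ 2 / 2)%:E|)%E).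
  by apply: lte_mul_pinfty => //; exact: le_lt_trans h (ltry _).
rewrite -ge0_integralZl//.
  apply: eq_integral => w _; rewrite /= ger0_norm ?divr_ge0 ?sqr_ge0// -EFinM; congr EFin; by field.
apply: measurableT_comp => //; apply/measurable_EFinP; apply: measurable_funM => //.
exact: measurable_funX.
Qed.

(** Once [X t] is square integrable, [X t ^+ 2 / 2] dominates the integrands of [cosquot], and the
    Fatou bound sharpens to an equality. *)
Lemma levy_sqn t : 0 <= t -> sqn P (X t) = t * s2.
Proof.
move=> t0; have mX := levy_measurable hX t0.
have iX := L2dot_integrable (levy_Lsq t0) (levy_Lsq t0).
have iX2 := integrableZr measurableT 2^-1 iX.
have [||||_ c] := @Rdominated_cvg _ _ _ P
  (fun n w => (1 - cos (theta n * X t w)) / theta n ^+ 2) (fun w => X t w ^+ 2 / 2) _ _ _ _ iX2.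
- move=> n; apply: measurable_funM => //; apply: measurable_funB => //; exact: measurable_cosX.
- by apply: measurable_funM => //; exact: measurable_funX.
- by apply: aeW => w; exact: cvg_cos_quot theta_gt0 theta_cvg.
- move=> n w /=; rewrite normrM (ger0_norm (_ : 0 <= (theta n ^+ 2)^-1)); last first.
    by rewrite invr_ge0 sqr_ge0.
  rewrite ler_pdivrMr ?exprn_gt0 ?theta_gt0//.
  by rewrite (le_trans (cos_taylor _))// exprMn -expr2 le_eqVlt; apply/orP; left; apply/eqP; ring.
have e : \int[P]_w (X t w ^+ 2 / 2) = t * s2 / 2.
  exact: (cvg_unique (@Rhausdorff R) c (cosquot_cvg t0)).
move: e; have -> : \int[P]_w (X t w ^+ 2 / 2) = sqn P (X t) / 2.
  by rewrite RintegralZr//; rewrite /sqn /L2dot; under eq_Rintegral do rewrite expr2.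
by move=> /(congr1 (fun z => z * 2)); rewrite !divfK.
Qed.

Lemma Lsq_cst1 : Lsq P (cst 1 : Om -> R).
Proof.
apply/LsqP; split => //.
rewrite (_ : (\int[P]_w _)%E = (\int[P]_w (cst 1%E w))%E).
  rewrite integral_cst// mul1e.
  exact: (le_lt_trans (probability_le1 P measurableT) (ltry 1)).
by apply: eq_integral => w _; rewrite /= expr1n.
Qed.

Lemma Lsq_L1 (f : Om -> R) : Lsq P f -> P.-integrable setT (EFin \o f).
Proof.
move=> lf; have := L2dot_integrable lf Lsq_cst1.
by apply: eq_integrable => // w _; rewrite /= mulr1.
Qed.

(** The expectation of [sin (theta X) / theta] tends to the mean by dominated convergence, and to
    zero because the phase of the characteristic function is of order [theta^2]. *)
Lemma levy_mean t : 0 <= t -> \int[P]_w X t w = 0.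
Proof.
move=> t0; have mX := levy_measurable hX t0.
have iX := integrable_norm (Lsq_L1 (levy_Lsq t0)).
have [|||_ c] := @Rdominated_cvg _ _ _ P
  (fun n w => sin (theta n * X t w) / theta n) (X t) _ _ mX _ iX.
- by move=> n; apply: measurable_funM => //; exact: measurable_sinX.
- by apply: aeW => w; exact: cvg_sin_quot theta_gt0 theta_cvg.
- move=> n w /=; rewrite normrM (ger0_norm (_ : 0 <= (theta n)^-1)); last first.
    by rewrite invr_ge0 ltW// theta_gt0.
  rewrite ler_pdivrMr ?theta_gt0// (le_trans (sin_abs_le _))// normrM mulrC.
  by rewrite (ger0_norm (ltW (theta_gt0 n))).
apply: (cvg_unique (@Rhausdorff R) c).
apply: norm_cvg0; apply: (@cvg0_le _ _ (fun n => t * `|psi_im nu (theta n) / theta n|)) => [n|n|].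
- exact: normr_ge0.
- rewrite RintegralZr//; last first.
    by apply: (@bounded_integrableP _ 1); [exact: measurable_sinX|move=> w; exact: sin_max].
  rewrite charfun_im// normrM [X in _ <= t * X]normrM mulrA ler_wpM2r//.
  rewrite normrM ger0_norm ?expR_ge0//.
  apply: (@le_trans _ _ `|sin (t * psi_im nu (theta n))|).
    rewrite ler_piMl// -expR0 ler_expR mulr_ge0_le0//.
    by have /andP[] := psi_re_bound hnu (theta n).
  by rewrite (le_trans (sin_abs_le _))// normrM ger0_norm.
- rewrite -[X in _ --> X](mulr0 t); apply: cvgM; first exact: cvg_cst.
  by rewrite -[X in _ --> X](@normr0 _ R); apply: cvg_norm; exact: psi_im_cvg.
Qed.

End levy_moments.

(** * Consequences of equal laws and of independence *)

Section laws.
Context d (Om : measurableType d) (R : realType) (P : probability Om R).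
Notation RT := (measurableTypeR R).
Implicit Types U V : Om -> R.

Lemma sqn_same_law U V : Lsq P U -> Lsq P V ->
  (forall B : set R, measurable B -> P (U @^-1` B) = P (V @^-1` B)) ->
  sqn P U = sqn P V.
Proof.
move=> lU lV UV; apply: EFin_inj; rewrite !sqnE//.
have mU : measurable_fun [set: Om] (U : Om -> RT) by exact: Lsq_measurable lU.
have mV : measurable_fun [set: Om] (V : Om -> RT) by exact: Lsq_measurable lV.
have msq : measurable_fun [set: RT] (fun x : R => (x ^+ 2)%:E).
  by apply/measurable_EFinP; exact: measurable_funX.
have sq0 (x : R) : (0 <= (x ^+ 2)%:E)%E by rewrite lee_fin sqr_ge0.
have hU := @ge0_integral_pushforward _ _ _ _ _ _ mU P setT _ measurableT msq (fun x _ => sq0 x).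
have hV := @ge0_integral_pushforward _ _ _ _ _ _ mV P setT _ measurableT msq (fun x _ => sq0 x).
transitivity (\int[pushforward P (U : Om -> RT)]_y (y ^+ 2)%:E)%E; first by rewrite hU.
transitivity (\int[pushforward P (V : Om -> RT)]_y (y ^+ 2)%:E)%E; last by rewrite hV.
by apply: eq_measure_integral => A mA _; exact: UV.
Qed.

(** The joint law of [(U, V)] is the product of the marginals, by uniqueness on rectangles; Fubini
    factors the integral of the product of the coordinates. *)
Lemma L2dot_independent U V : Lsq P U -> Lsq P V ->
  (forall A B : set R, measurable A -> measurable B ->
     P (U @^-1` A `&` V @^-1` B) = (P (U @^-1` A) * P (V @^-1` B))%E) ->
  L2dot P U V = (\int[P]_w U w) * (\int[P]_w V w).
Proof.
move=> lU lV UV.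
have mU : measurable_fun [set: Om] (U : Om -> RT) by exact: Lsq_measurable lU.
have mV : measurable_fun [set: Om] (V : Om -> RT) by exact: Lsq_measurable lV.
pose U' : {mfun Om >-> RT} := @mfun_Sub _ _ Om RT U (mem_set mU).
pose V' : {mfun Om >-> RT} := @mfun_Sub _ _ Om RT V (mem_set mV).
pose m1 := distribution P U'; pose m2 := distribution P V'.
have mW : measurable_fun [set: Om] (fun w => (U w, V w) : (RT * RT)%type).
  exact: measurable_fun_pair.
have prodE := @product_measure_unique _ _ RT RT R m1 m2
  (measure_function_pushforward__canonical__measure_function_Measure P mW).
have {}prodE X : measurable X -> (m1 \x m2)%E X = pushforward P (fun w => (U w, V w) : (RT * RT)%type) X.
  by apply: prodE => A B mA mB; exact: UV.
have mxy : measurable_fun [set: (RT * RT)%type] (fun z : RT * RT => z.1 * z.2 : R).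
  exact: measurable_funM.
have mxyE : measurable_fun [set: (RT * RT)%type] (fun z : RT * RT => (z.1 * z.2)%:E).
  exact/measurable_EFinP.
have iUV := L2dot_integrable lU lV.
have E1 : (\int[P]_w (U w * V w)%:E = \int[(m1 \x m2)%E]_z (z.1 * z.2)%:E)%E.
  have h := @integral_pushforward _ _ _ _ _ _ mW P setT (fun z : RT * RT => (z.1 * z.2)%:E) mxyE iUV measurableT.
  rewrite -[LHS]h; apply: eq_measure_integral => A mA _; exact/esym/prodE.
have iprod : (m1 \x m2)%E.-integrable setT (EFin \o (fun z : RT * RT => z.1 * z.2 : R)).
  apply/integrableP; split; first exact: mxyE.
  have [_] := integrableP _ _ _ iUV; apply: le_lt_trans.
  have mabs : measurable_fun [set: (RT * RT)%type] (fun z : RT * RT => `|(z.1 * z.2)%:E|%E).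
    exact: measurableT_comp.
  have h := @ge0_integral_pushforward _ _ _ _ _ _ mW P setT _ measurableT mabs (fun z _ => abse_ge0 _).
  rewrite le_eqVlt; apply/orP; left; apply/eqP; rewrite -[RHS]h.
  by apply: eq_measure_integral => A mA _; exact: prodE.
have i1 : m1.-integrable setT (EFin \o (id : RT -> R)).
  apply/integrableP; split; first by apply/measurable_EFinP; exact: measurable_id.
  have mabs : measurable_fun [set: RT] (fun z : RT => `|z%:E|%E) by exact: measurableT_comp.
  have h := @ge0_integral_pushforward _ _ _ _ _ _ mU P setT _ measurableT mabs (fun z _ => abse_ge0 _).
  rewrite [X in (X < _)%E]h.
  by have [_] := integrableP _ _ _ (Lsq_L1 lU).
have i2 : m2.-integrable setT (EFin \o (id : RT -> R)).
  apply/integrableP; split; first by apply/measurable_EFinP; exact: measurable_id.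
  have mabs : measurable_fun [set: RT] (fun z : RT => `|z%:E|%E) by exact: measurableT_comp.
  have h := @ge0_integral_pushforward _ _ _ _ _ _ mV P setT _ measurableT mabs (fun z _ => abse_ge0 _).
  rewrite [X in (X < _)%E]h.
  by have [_] := integrableP _ _ _ (Lsq_L1 lV).
have e1 : \int[P]_w U w = \int[m1]_x x.
  congr fine; apply/esym.
  have mid : measurable_fun [set: RT] (EFin : RT -> \bar R) by apply/measurable_EFinP; exact: measurable_id.
  exact: (@integral_pushforward _ _ _ _ _ _ mU P setT (fun z : RT => z%:E) mid (Lsq_L1 lU) measurableT).
have e2 : \int[P]_w V w = \int[m2]_x x.
  congr fine; apply/esym.
  have mid : measurable_fun [set: RT] (EFin : RT -> \bar R) by apply/measurable_EFinP; exact: measurable_id.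
  exact: (@integral_pushforward _ _ _ _ _ _ mV P setT (fun z : RT => z%:E) mid (Lsq_L1 lV) measurableT).
rewrite /L2dot [LHS](_ : _ = \int[(m1 \x m2)%E]_z (z.1 * z.2)); last by rewrite /Rintegral E1.
rewrite (Rint_prod iprod) /= e1 e2.
rewrite -RintegralZr//; apply: eq_Rintegral => x _.
by rewrite -RintegralZl.
Qed.

End laws.

(** * Variance of the increments of the two-sided process *)

Section increments.
Context d (Om : measurableType d) (R : realType) (P : probability Om R).
Notation RT := (measurableTypeR R).
Variable nu : {measure set RT -> \bar R}.
Hypothesis hnu : levy_measure nu.
Notation s2 := (levy_var nu).
Implicit Types X Y : R -> Om -> R.

(** Stationarity replaces the increment by [X (t - s) - X 0], which is almost surely [X (t - s)]. *)
Lemma levy_increment X s t : levy_process P nu X -> 0 <= s -> s <= t ->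
  sqn P (X t - X s) = (t - s) * s2.
Proof.
move=> hX s0 st.
have t0 := le_trans s0 st.
have ts0 : 0 <= t - s by rewrite subr_ge0.
have lt := levy_Lsq hnu hX t0; have ls := levy_Lsq hnu hX s0.
have l0 := levy_Lsq hnu hX (lexx 0); have lts := levy_Lsq hnu hX ts0.
rewrite -(levy_sqn hnu hX ts0).
transitivity (sqn P (X (t - s) - X 0)).
  apply: sqn_same_law; [exact: LsqB|exact: LsqB|] => B mB.
  have := levy_stat hX s0 ts0 mB.
  by rewrite (_ : s + (t - s) = t) // addrC subrK.
apply: sqn_ae_eq => //; first exact: LsqB.
by apply: filterS (levy_start hX) => w h _; rewrite !fctE h subr0.
Qed.

(** A Levy process has no jump at a fixed time: as [s] increases to [u] the path [X s] tends to the
    left limit, while the variance of [X u - X s] tends to zero; Fatou combines the two. *)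
Lemma left_lim X (u : R) : levy_process P nu X -> 0 < u ->
  Lsq P (fun w => lim (X s w @[s --> u^'-])) /\
  X u = (fun w => lim (X s w @[s --> u^'-])) %[ae P].
Proof.
move=> hX u0; set Z := (fun w => _).
(* These times start at [0], hence stay in [[0, u)], where the process is constrained. *)
pose sn n : R := u - u * n.+1%:R^-1.
have sn0 n : 0 <= sn n.
  by rewrite /sn subr_ge0 ger_pMr// invf_le1// ler1n.
have snu n : sn n < u by rewrite /sn ltrBlDr ltrDl mulr_gt0// invr_gt0.
have snc : sn n @[n --> \oo] --> u.
  rewrite -[X in _ --> X](_ : u - u * 0 = u); last by rewrite mulr0 subr0.
  apply: cvgB; first exact: cvg_cst.
  by apply: cvgM; [exact: cvg_cst|exact: cvg_harmonic].
have XZ w : X (sn n) w @[n --> \oo] --> Z w.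
  have [_ /(_ u0) c] := levy_cadlag hX w u.
  apply: (cvg_comp sn (fun s => X s w) _ c).
  move=> A /= [e /= e0 eA].
  have /cvgrPdist_lt/(_ e e0) := snc.
  by apply: filterS => n hn; apply: eA.
have u0' := ltW u0.
have mX n : measurable_fun setT (X (sn n)) by exact: (levy_measurable hX (sn0 n)).
have mZ : measurable_fun setT Z by apply: (measurable_fun_cvg mX) => w _; exact: XZ.
have lu := levy_Lsq hnu hX u0'.
have bound N : (\int[P]_w ((X u w - Z w) ^+ 2)%:E <= ((u - sn N) * s2)%:E)%E.
  have := @fatou_bound _ _ _ P (fun n w => (X u w - X (sn (n + N)%N) w) ^+ 2)
    (fun w => (X u w - Z w) ^+ 2) ((u - sn N) * s2)%:E.
  rewrite (eq_integral (fun w => ((X u w - Z w) ^+ 2)%:E)); last first.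
    by move=> w _; rewrite gee0_abs// lee_fin sqr_ge0.
  apply.
  - by move=> n; apply: measurable_funX; apply: measurable_funB => //; exact: Lsq_measurable lu.
  - by apply: measurable_funX; apply: measurable_funB => //; exact: Lsq_measurable lu.
  - by move=> n w; exact: sqr_ge0.
  - apply: aeW => w.
    have c : X (sn (n + N)%N) w @[n --> \oo] --> Z w.
      by rewrite (cvg_shiftn N (fun n => X (sn n) w)).
    by apply: (cvgM (cvgB (cvg_cst (X u w)) c) (cvgB (cvg_cst (X u w)) c)).
  - move=> n; have ln := levy_Lsq hnu hX (sn0 (n + N)%N).
    rewrite -[leLHS](sqnE (LsqB lu ln)) lee_fin (levy_increment hX (sn0 _) (ltW (snu _))).
    apply: ler_wpM2r; first exact: levy_var_ge0.
    rewrite lerD2l lerN2 /sn lerD2l lerN2 ler_pM2l// lef_pV2 ?posrE// ler_nat ltnS.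
    exact: leq_addl.
have lB : Lsq P (X u - Z).
  apply/LsqP; split; last exact: le_lt_trans (bound 0%N) (ltry _).
  by apply: measurable_funB => //; exact: Lsq_measurable lu.
have lZ : Lsq P Z.
  by rewrite (_ : Z = X u - (X u - Z)); [exact: LsqB|rewrite opprB addrC subrK].
split => //; apply/sqnB_eq0 => //; apply/eqP; rewrite eq_le sqn_ge0 andbT.
have c : (u - sn N) * s2 @[N --> \oo] --> 0.
  rewrite -[X in _ --> X](_ : (u - u) * s2 = 0); last by rewrite subrr mul0r.
  by apply: cvgM; [apply: cvgB => //; exact: cvg_cst|exact: cvg_cst].
rewrite -(cvg_lim (@Rhausdorff R) c); apply: limr_ge.
  by apply/cvg_ex; exists 0.
by apply: nearW => N; rewrite -lee_fin sqnE//; exact: bound.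
Qed.

Lemma process_sigma_preimage X t (B : set R) : 0 <= t -> measurable B ->
  process_sigma X (X t @^-1` B).
Proof. by move=> t0 mB; apply: sub_gen_smallest; exists t => //; exists B. Qed.

Lemma levy_cross X Y s t : independent_levy_copies P nu X Y -> 0 <= s -> 0 <= t ->
  L2dot P (X s) (Y t) = 0.
Proof.
move=> [hX hY ind] s0 t0.
rewrite L2dot_independent ?(levy_mean hnu hX s0) ?mul0r//.
- exact: (levy_Lsq hnu hX s0).
- exact: (levy_Lsq hnu hY t0).
- by move=> A B mA mB; apply: ind; exact: process_sigma_preimage.
Qed.

Variables X Y : R -> Om -> R.
Hypothesis hXY : independent_levy_copies P nu X Y.
Notation L := (two_sided X Y).

(* Up to null sets the left limit in the definition of [two_sided] is immaterial. *)
Let L' t : Om -> R := if 0 <= t then X t else - Y (- t).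

Let L'_Lsq t : Lsq P (L' t).
Proof.
have [hX hY _] := hXY; rewrite /L'; case: leP => t0; first exact: (levy_Lsq hnu hX t0).
by apply: LsqN; apply: (levy_Lsq hnu hY); rewrite oppr_ge0 ltW.
Qed.

Let two_sided_ae t : Lsq P (L t) /\ L' t = L t %[ae P].
Proof.
have [hX hY _] := hXY; rewrite /two_sided /L'; case: leP => t0.
  by split; [exact: (levy_Lsq hnu hX t0)|exact: aeW].
have nt0 : 0 < - t by rewrite oppr_gt0.
have [lZ YZ] := left_lim hY nt0.
split; first exact: LsqN lZ.
by apply: filterS YZ => w h Tw; rewrite !fctE h.
Qed.

Lemma two_sided_Lsq t : Lsq P (L t).
Proof. by case: (two_sided_ae t). Qed.

Lemma two_sided_increment s t : sqn P (L t - L s) = s2 * `|t - s|.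
Proof.
have [hX hY _] := hXY.
have -> : sqn P (L t - L s) = sqn P (L' t - L' s).
  have [lt et] := two_sided_ae t; have [ls es] := two_sided_ae s.
  apply: sqn_ae_eq; [exact: LsqB|by apply: LsqB; exact: L'_Lsq|].
  by move: et es; apply: filterS2 => w h1 h2 Tw; rewrite !fctE h1// h2.
wlog st : s t / s <= t.
  move=> h; case: (leP s t) => [/h//|/ltW ts].
  by rewrite sqnBC distrC; exact: h.
rewrite ger0_norm ?subr_ge0// mulrC /L'; case: (leP 0 t) => t0; case: (leP 0 s) => s0.
- exact: levy_increment.
(* Here the increment straddles the origin and equals [X t + Y (- s)]; the two terms are orthogonal,
   so the variances [t] and [- s] add up. *)
- have ns : 0 <= - s by rewrite oppr_ge0 ltW.
  have lX := levy_Lsq hnu hX t0; have lY := levy_Lsq hnu hY ns.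
  rewrite opprK sqnD// (levy_sqn hnu hX t0) (levy_sqn hnu hY ns) levy_cross//; ring.
- by have := lt_le_trans t0 (le_trans s0 st); rewrite ltxx.
- have nt : 0 <= - t by rewrite oppr_ge0 ltW.
  rewrite opprK addrC levy_increment// ?lerN2//; ring.
Qed.

End increments.

(** * The Wiener integral *)

Section lincomb_norm.
Context d (Om : measurableType d) (R : realType) (P : {measure set Om -> \bar R}).
Variables (Z : R -> Om -> R) (c : R).
Hypothesis lZ : forall t, Lsq P (Z t).
Hypothesis Zincr : forall s t, sqn P (Z t - Z s) = c * `|t - s|.
Implicit Types l : seq (R * R).

Lemma lincomb_cons p l : lincomb Z (p :: l) = p.1 \*o Z p.2 + lincomb Z l.
Proof. by apply/funext => w; rewrite /lincomb big_cons. Qed.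

Lemma Lsq_lincomb l : Lsq P (lincomb Z l).
Proof.
elim: l => [|p l IH]; last by rewrite lincomb_cons; apply: LsqD => //; exact: LsqZ.
rewrite (_ : lincomb Z [::] = 0); first exact: Lsq0.
by apply/funext => w; rewrite /lincomb big_nil.
Qed.

Lemma L2dot_lincomb l (g : Om -> R) : Lsq P g ->
  L2dot P (lincomb Z l) g = \sum_(p <- l) p.1 * L2dot P (Z p.2) g.
Proof.
move=> lg; elim: l => [|p l IH].
  rewrite big_nil (_ : lincomb Z [::] = 0).
    by have := L2dotZl 0 lg lg; rewrite mul0r => <-; congr L2dot; apply/funext => w; rewrite /= mul0r.
  by apply/funext => w; rewrite /lincomb big_nil.
rewrite lincomb_cons L2dotDl//; [|exact: LsqZ|exact: Lsq_lincomb].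
by rewrite L2dotZl// IH big_cons.
Qed.

(* Polarisation: since the weights sum to zero only the increments matter. *)
Lemma sqn_lincomb l : wsum l = 0 -> sqn P (lincomb Z l) =
  c * (- 2^-1 * \sum_(p <- l) \sum_(q <- l) p.1 * q.1 * `|p.2 - q.2|).
Proof.
move=> wl; rewrite /sqn L2dot_lincomb; last exact: Lsq_lincomb.
pose A t := sqn P (Z t).
have dotE a b : L2dot P (Z a) (Z b) = (A a + A b - c * `|a - b|) / 2.
  by rewrite -Zincr (sqnB (lZ a) (lZ b)) /A; field.
transitivity (\sum_(p <- l) \sum_(q <- l) (p.1 * q.1 * A p.2 / 2 + p.1 * q.1 * A q.2 / 2
   - c * (2^-1 * (p.1 * q.1 * `|p.2 - q.2|)))).
  apply: eq_bigr => p _; rewrite L2dotC L2dot_lincomb// mulr_sumr; apply: eq_bigr => q _.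
  by rewrite dotE distrC; field.
under eq_bigr => p _.
  rewrite !big_split /= sumrN -!mulr_sumr.
  over.
rewrite !big_split /= sumrN -!mulr_sumr.
have -> : \sum_(p <- l) \sum_(q <- l) p.1 * q.1 * A p.2 / 2 = 0.
  transitivity (\sum_(p <- l) (p.1 * A p.2 / 2) * wsum l).
    apply: eq_bigr => p _; rewrite mulr_sumr; apply: eq_bigr => q _; ring.
  by rewrite wl; apply: big1 => p _; rewrite mulr0.
have -> : \sum_(p <- l) \sum_(q <- l) p.1 * q.1 * A q.2 / 2 = 0.
  transitivity (\sum_(p <- l) p.1 * \sum_(q <- l) q.1 * A q.2 / 2).
    apply: eq_bigr => p _; rewrite mulr_sumr; apply: eq_bigr => q _; ring.
  by rewrite -mulr_suml -/(wsum l) wl mul0r.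
by rewrite !add0r mulNr mulrN; congr (- (c * _)); rewrite mulr_sumr.
Qed.

Lemma Lsq_step_int (s : step R) : Lsq P (step_int Z s).
Proof. by rewrite -step_seqE; exact: Lsq_lincomb. Qed.

End lincomb_norm.

Section wiener_theory.
Context d (Om : measurableType d) (R : realType) (P : probability Om R).
Notation mu := (leb R).
Variables (L : R -> Om -> R) (c : R).
Hypothesis lL : forall t, Lsq P (L t).
Hypothesis Lincr : forall s t, sqn P (L t - L s) = c * `|t - s|.
Hypothesis c0 : 0 < c.

(** The correction by [1_(x < 0)] makes [heav t] square integrable, being plus or minus the
    indicator of the interval between [0] and [t]; it cancels in every increment. *)
Definition heav (t x : R) : R := (x < t)%R%:R - (x < 0)%R%:R.

Lemma step_fun_heav (s : step R) : step_fun s = step_int heav s.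
Proof.
rewrite step_fun_int; apply/funext => x; apply: eq_bigr => i _; congr (_ * _).
by rewrite /heav; ring.
Qed.

Lemma heav_diff a b : a <= b -> heav b - heav a = \1_(`[a, b[).
Proof.
move=> ab; apply/funext => x; rewrite !fctE /heav indicE mem_setE in_itv /=.
case: (ltP x a) => h1; case: (ltP x b) => h2 /=; try ring.
by have := lt_le_trans h1 (le_trans ab h2); rewrite ltxx.
Qed.

Lemma Lsq_heav t : Lsq mu (heav t).
Proof.
have h0 : heav 0 = 0 by apply/funext => x; rewrite /heav subrr.
case: (leP 0 t) => t0.
  by rewrite -[heav t]subr0 -h0 heav_diff//; exact: Lsq_indic.
by rewrite -[heav t]opprK -[- heav t]add0r -h0 heav_diff ?ltW//; apply: LsqN; exact: Lsq_indic.
Qed.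

Lemma heav_increment s t : sqn mu (heav t - heav s) = 1 * `|t - s|.
Proof.
wlog st : s t / s <= t.
  move=> h; case: (leP s t) => [/h//|/ltW ts].
  by rewrite sqnBC distrC; exact: h.
by rewrite heav_diff// sqn_indic// mul1r ger0_norm// subr_ge0.
Qed.

(** [sqn_lincomb] is applied to [L] with constant [c] and to [heav] with constant 1. Both give the
    same double sum over pairs of times, so overlapping intervals in the presentation cause no
    trouble. *)
Lemma sqn_step_int (s : step R) : sqn P (step_int L s) = c * sqn mu (step_fun s).
Proof.
rewrite step_fun_heav -!step_seqE.
by rewrite (sqn_lincomb lL Lincr (wsum_step_seq s)) (sqn_lincomb Lsq_heav heav_increment (wsum_step_seq s)) mul1r.
Qed.

Let opp1E (T : Type) (u v : T -> R) : u - v = -1 \*o v + u.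
Proof. by apply/funext => x; rewrite !fctE /= mulN1r addrC. Qed.

Let iso (s r : step R) : sqn P (step_int L s - step_int L r) = c * sqn mu (step_fun s - step_fun r).
Proof.
have [q qE] := step_int_lin (-1) r s.
by rewrite !opp1E !step_fun_int -!qE -step_fun_int sqn_step_int.
Qed.

Let lin (a : R) (s r : step R) : exists q : step R,
  step_fun q = a \*o step_fun s + step_fun r /\ step_int L q = a \*o step_int L s + step_int L r.
Proof.
by have [q qE] := step_int_lin a s r; exists q; split; rewrite ?step_fun_int.
Qed.

Definition wiener_rel := L2_ext mu P (@step_fun R) (step_int L).

Let lj := fun s => Lsq_step_int lL s.
Let le := @Lsq_step_fun R.

Lemma is_wiener_integralP f X : is_wiener_integral P L f X <-> wiener_rel f X.
Proof.
split => -[lf lX [s [sf sX]]]; split => //; exists s; split.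
- by apply/L2cvgP.
- by apply/L2cvgP => // n; exact: lj.
- by apply/L2cvgP.
- by apply/L2cvgP => // n; exact: lj.
Qed.

Lemma wiener_integralP f : Lsq mu f -> wiener_rel f (wiener_integral P L f).
Proof.
move=> lf; have [X fX] := L2_ext_exists le lj iso (@step_dense R) lf.
apply/is_wiener_integralP; rewrite /wiener_integral.
case: xgetP => [Y _ //|/(_ X)]; by case; apply/is_wiener_integralP.
Qed.

Lemma wiener_dot f g X Y : wiener_rel f X -> wiener_rel g Y ->
  L2dot P X Y = c * L2dot mu f g.
Proof. exact: (L2_ext_dot le lj iso (@step_dense R) lin). Qed.

Lemma wiener_iso f g X Y : wiener_rel f X -> wiener_rel g Y ->
  sqn P (X - Y) = c * sqn mu (f - g).
Proof. exact: (L2_ext_iso le lj iso). Qed.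

Lemma wiener_lin a f g X Y : wiener_rel f X -> wiener_rel g Y ->
  wiener_rel (a \*o f + g) (a \*o X + Y).
Proof. exact: (L2_ext_lin le lj lin). Qed.

Lemma wiener0 : wiener_rel 0 0.
Proof. exact: (L2_ext0 le lj iso (@step_dense R) lin). Qed.

Lemma wiener_ae_eq f g X Y : wiener_rel f X -> wiener_rel g Y ->
  (f = g %[ae mu]) <-> (X = Y %[ae P]).
Proof.
move=> fX gY; have [lf lX _] := fX; have [lg lY _] := gY.
split => /sqnB_eq0 h; apply/sqnB_eq0 => //; move: h => /(_ lf lg) || move: h => /(_ lX lY).
  by rewrite (wiener_iso fX gY) => ->//; rewrite mulr0.
by rewrite (wiener_iso fX gY) => /eqP; rewrite mulf_eq0 gt_eqF//= => /eqP.
Qed.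

Lemma wiener_closed (F : nat -> R -> R) (Y : nat -> Om -> R) f X :
  (forall n, wiener_rel (F n) (Y n)) -> Lsq mu f -> Lsq P X ->
  sqn mu (F n - f) @[n --> \oo] --> 0 ->
  sqn P (Y n - X) @[n --> \oo] --> 0 -> wiener_rel f X.
Proof. exact: (L2_ext_closed le lj iso (@step_dense R)). Qed.

Lemma wiener_lincomb (K : R -> R -> R) (Z : R -> Om -> R) l :
  (forall t, wiener_rel (K t) (Z t)) -> wiener_rel (lincomb K l) (lincomb Z l).
Proof.
move=> KZ; elim: l => [|p l IH].
  rewrite (_ : lincomb K [::] = 0) 1?(_ : lincomb Z [::] = 0); first exact: wiener0.
    by apply/funext => w; rewrite /lincomb big_nil.
  by apply/funext => w; rewrite /lincomb big_nil.
by rewrite !lincomb_cons; exact: wiener_lin.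
Qed.

(** From left to right, the isometry (with [c > 0]) turns convergence of the step integrals of [Z]
    into a Cauchy sequence of combinations of kernels, whose limit is [f]. Conversely [Kperp] makes
    these combinations dense, and an approximation of [f] is carried over to [X]. *)
Lemma wiener_span_closure (K : R -> R -> R) (Z : R -> Om -> R) :
  (forall t, wiener_rel (K t) (Z t)) ->
  (forall f, Lsq mu f -> (forall s t, s <= t -> L2dot mu f (K t - K s) = 0) ->
     f = 0 %[ae mu]) ->
  forall X, (Lsq P X /\ exists s : nat -> step R, L2cvg P (fun n => step_int Z (s n)) X) <->
    exists f, wiener_rel f X.
Proof.
move=> KZ Kperp X.
have lK t : Lsq mu (K t) by case: (KZ t).
have lZ t : Lsq P (Z t) by case: (KZ t).
have KZs s : wiener_rel (step_int K s) (step_int Z s).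
  by rewrite -!step_seqE; exact: wiener_lincomb.
split => [[lX [s /L2cvgP sX]]|[f fX]].
  have {}sX := sX (fun n => Lsq_step_int lZ (s n)) lX.
  have cau := cvg2_cauchy (fun n => Lsq_step_int lZ (s n)) lX sX.
  have [|f lf sf] := @L2_complete _ _ _ mu (fun n => step_int K (s n)) (fun n => Lsq_step_int lK (s n)).
    move=> e e0; have [N NP] := cau (c * e) (mulr_gt0 c0 e0).
    exists N => m n Nm Nn; have := NP m n Nm Nn.
    by rewrite (wiener_iso (KZs _) (KZs _)) ltr_pM2l.
  exists f; apply: wiener_closed sf sX => // n; exact: KZs.
have [lf lX _] := fX; split => //.
pose M : set (measurableTypeR R -> R) := range (step_int K).
have lM g : M g -> Lsq mu g by move=> [s _ <-]; exact: Lsq_step_int.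
have M0 : M 0.
  exists (one_step (lexx 0)) => //; rewrite one_step_int subrr//.
have Mlin (a : R) g h : M g -> M h -> M (a \*o g + h).
  by move=> [s _ <-] [t _ <-]; have [r rE] := step_int_lin a s t; exists r.
have Mperp g : Lsq mu g -> (forall m, M m -> L2dot mu g m = 0) -> g = 0 %[ae mu].
  move=> lg gM; apply: Kperp => // s t st; apply: gM.
  by exists (one_step st) => //; rewrite one_step_int.
have [u uM uf] := @L2_perp_dense _ _ _ mu M lM M0 Mlin Mperp f lf.
have /choice[s sP] : forall n, exists s, step_int K s = u n by move=> n; have [s _ <-] := uM n; exists s.
exists s; apply/L2cvgP => //; first by move=> n; exact: Lsq_step_int.
have E : (fun n => sqn P (step_int Z (s n) - X)) = (fun n => c * sqn mu (u n - f)).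
  by apply/funext => n; rewrite (wiener_iso (KZs _) fX) sP.
rewrite E -[X in _ --> X](mulr0 c); apply: cvgM => //; exact: cvg_cst.
Qed.

End wiener_theory.

(** * The kernel of the process *)

Section tempered_power.
Variable R : realType.
Notation mu := (leb R).
Notation L1 f := (mu.-integrable setT (EFin \o (f : R -> R))).
Implicit Types (a b d x y u t : R).

Lemma measurable_powR_fun a : measurable_fun [set: R] ((@powR R)^~ a).
Proof. exact: measurable_powR. Qed.

Lemma integral_indic_itv (i : interval R) :
  (\int[mu]_x (\1_([set` i]) x)%:E = mu [set` i])%E.
Proof. by rewrite integral_indic// setIT. Qed.

Lemma measurable_lt0 : measurable_fun setT (fun x : R => ((0 < x)%R%:R : R)).
Proof.
rewrite (_ : (fun x => _) = \1_(`]0, +oo[)); first exact: measurable_indic.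
by apply/funext => x; rewrite indicE mem_setE in_itv /= andbT.
Qed.

Lemma pospowE x a : pospow x a = (0 < x)%R%:R * x `^ a.
Proof. by rewrite /pospow; case: ifP; rewrite ?mul1r ?mul0r. Qed.

Lemma tempered_powE d b x : tempered_pow d b x = (0 < x)%R%:R * (x `^ d * expR (- (b * x))).
Proof.
rewrite /tempered_pow pospowE -mulrA; case: (ltP 0 x) => x0; rewrite ?mul0r// !mul1r.
Qed.

Lemma tempered_pow_ge0 d b x : 0 <= tempered_pow d b x.
Proof. by rewrite tempered_powE mulr_ge0// mulr_ge0 ?powR_ge0 ?expR_ge0. Qed.

Lemma tempered_pow_le0 d b x : x <= 0 -> tempered_pow d b x = 0.
Proof. by move=> x0; rewrite tempered_powE ltNge x0 mul0r. Qed.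

Lemma tempered_pow_gt0 d b x : 0 < x -> tempered_pow d b x = x `^ d * expR (- (b * x)).
Proof. by move=> x0; rewrite tempered_powE x0 mul1r. Qed.

Lemma measurable_tempered_pow d b : measurable_fun setT (tempered_pow d b).
Proof.
rewrite (_ : tempered_pow d b = fun x => (0 < x)%R%:R * (x `^ d * expR (- (b * x)))); last first.
  by apply/funext => x; rewrite tempered_powE.
apply: measurable_funM; first exact: measurable_lt0.
apply: measurable_funM; first exact: measurable_powR_fun.
apply: measurableT_comp; first exact: measurable_expR.
by apply: measurableT_comp => //; exact: measurable_funM.
Qed.

Lemma integral_powR_itv a e : -1 < a -> 0 < e -> e < 1 ->
  (\int[mu]_(x in `[e, 1%R]) (x `^ a)%:E <= ((a + 1)^-1)%:E)%E.
Proof.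
move=> a1 e0 e1; have a10 : 0 < a + 1 by lra.
have dF x : 0 < x -> is_derive x 1 (fun x => (a + 1)^-1 * x `^ (a + 1)) (x `^ a).
  move=> x0; have h := is_deriveZ (a + 1)^-1 (is_derive1_powR (a + 1) x0).
  by apply: is_derive_eq h _; rewrite /GRing.scale /= addrK mulKf// gt_eqF.
have cF x : 0 < x -> {for x, continuous (fun x : R => (a + 1)^-1 * x `^ (a + 1))}.
  by move=> x0; apply: differentiable_continuous; apply/derivable1_diffP; have [] := dF x x0.
have cf x : 0 < x -> {for x, continuous (fun x : R => x `^ a)}.
  by move=> x0; apply: differentiable_continuous; apply/derivable1_diffP; have [] := is_derive1_powR a x0.
rewrite (@continuous_FTC2 _ _ (fun x => (a + 1)^-1 * x `^ (a + 1)) e 1)//.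
- rewrite -EFinB lee_fin powR1 mulr1 lerBlDr lerDl mulr_ge0 ?powR_ge0// invr_ge0 ltW//.
- apply: continuous_in_subspaceT => x; rewrite inE /= in_itv /= => /andP[ex _].
  by apply: cf; exact: lt_le_trans ex.
- split.
  + by move=> x; rewrite in_itv /= => /andP[ex _]; have [] := dF x (lt_trans e0 ex).
  + by apply: cvg_at_right_filter; exact: cF.
  + by apply: cvg_at_left_filter; exact: cF.
- move=> x; rewrite in_itv /= => /andP[ex _].
  by rewrite derive1E; have [_ ->] := dF x (lt_trans e0 ex).
Qed.

Lemma integral_powR01 a : -1 < a ->
  (\int[mu]_x `|((0 < x <= 1)%R%:R * x `^ a)%:E| <= ((a + 1)^-1)%:E)%E.
Proof.
move=> a1.
have mI (u v : R) : measurable_fun setT (fun x : R => ((u <= x <= v)%R%:R : R)).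
  rewrite (_ : (fun x => _) = \1_(`[u, v])); first exact: measurable_indic.
  by apply/funext => x; rewrite indicE mem_setE in_itv.
have mI0 : measurable_fun setT (fun x : R => ((0 < x <= 1)%R%:R : R)).
  rewrite (_ : (fun x => _) = \1_(`]0, 1])); first exact: measurable_indic.
  by apply/funext => x; rewrite indicE mem_setE in_itv.
(* [n + 2] keeps the cut-off strictly below 1, as [integral_powR_itv] demands. *)
pose e n : R := n.+2%:R^-1.
have e0 n : 0 < e n by rewrite invr_gt0.
have e1 n : e n < 1 by rewrite invf_lt1// ltr1n.
apply: (@fatou_bound _ _ _ mu (fun n x => (e n <= x <= 1)%R%:R * x `^ a)).
- by move=> n; apply: measurable_funM; [exact: mI|exact: measurable_powR_fun].
- by apply: measurable_funM; [exact: mI0|exact: measurable_powR_fun].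
- by move=> n x; rewrite mulr_ge0// powR_ge0.
- apply: aeW => x; apply: cvgM; last exact: cvg_cst.
  case: (ltP 0 x) => x0 /=; last first.
    rewrite (_ : (fun n => _) = cst 0); first exact: cvg_cst.
    by apply/funext => n; rewrite leNgt (le_lt_trans x0 (e0 n)).
  have ec : e n @[n --> \oo] --> 0.
    by rewrite (cvg_shiftS (fun n => (n.+1%:R^-1 : R))); exact: cvg_harmonic.
  apply: cvg_near_cst; have /cvgr0Pnorm_lt/(_ _ x0) := ec; apply: filterS => n.
  by rewrite gtr0_norm// => /ltW ->.
- move=> n; apply: le_trans (integral_powR_itv a1 (e0 n) (e1 n)).
  rewrite [leRHS]integral_mkcond le_eqVlt; apply/orP; left; apply/eqP.
  apply: eq_integral => x _; rewrite patchE mem_setE in_itv /=.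
  by case: (_ && _); rewrite ?mul1r ?mul0r.
Qed.

(** On [(0, 1]] the exponential is at most 1 and [x^a] is integrable; beyond 1 the power is at most
    1 and the exponential is integrable. *)
Lemma tempered_pow_L1 a b : -1 < a -> a <= 0 -> 0 < b -> L1 (tempered_pow a b).
Proof.
move=> a1 a0 b0.
have i1 : L1 (fun x => (0 < x <= 1)%R%:R * x `^ a).
  apply/integrableP; split; last exact: le_lt_trans (integral_powR01 a1) (ltry _).
  apply/measurable_EFinP; apply: measurable_funM; last exact: measurable_powR_fun.
  rewrite (_ : (fun x => _) = \1_(`]0, 1])); first exact: measurable_indic.
  by apply/funext => x; rewrite indicE mem_setE in_itv.
have i2 := integrable_expN b0.
apply: (le_integrable measurableT _ _ (integrableD measurableT i1 i2)).
  by apply/measurable_EFinP; exact: measurable_tempered_pow.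
move=> x _; rewrite /= lee_fin ger0_norm ?tempered_pow_ge0// [leRHS]ger0_norm; last first.
  by rewrite addr_ge0 ?expR_ge0// mulr_ge0// powR_ge0.
rewrite tempered_powE; case: (ltP 0 x) => x0 /=; last first.
  by rewrite !mul0r add0r expR_ge0.
rewrite mul1r (gtr0_norm x0).
have p0 := powR_ge0 x a; have ex0 := expR_ge0 (- (b * x)).
have ex1 : expR (- (b * x)) <= 1 by rewrite -expR0 ler_expR oppr_le0 mulr_ge0// ltW.
case: (leP x 1) => x1; rewrite ?mul1r ?mul0r ?add0r; first nra.
have : x `^ a <= 1 by have := ler_powR (ltW x1) a0; rewrite powRr0.
nra.
Qed.

Lemma tempered_pow_sqr d b x : tempered_pow d b x ^+ 2 = tempered_pow (2 * d) (2 * b) x.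
Proof.
rewrite !tempered_powE; case: (ltP 0 x) => x0; last by rewrite !mul0r expr0n.
rewrite !mul1r exprMn -expRM_natl; congr (_ * expR _); last by rewrite -mulr_natl; ring.
by rewrite mulrC powRrM powR_mulrn ?powR_ge0.
Qed.

(** Squaring doubles the exponent, so [- 1/2 < d] is the integrability condition [- 1 < 2 d] at the
    origin. *)
Lemma tempered_pow_Lsq d b : - (1 / 2) < d -> d <= 0 -> 0 < b -> Lsq mu (tempered_pow d b).
Proof.
move=> d1 d0 b0; apply/LsqP; split; first exact: measurable_tempered_pow.
have a1 : -1 < 2 * d by lra.
have a2 : 2 * d <= 0 by lra.
have b2 : 0 < 2 * b by lra.
have := integrable_lty measurableT (tempered_pow_L1 a1 a2 b2).
apply: le_lt_trans; rewrite le_eqVlt; apply/orP; left; apply/eqP.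
by apply: eq_integral => x _; rewrite /= tempered_pow_sqr.
Qed.

Lemma integral_tempered_pow_gt0 a b : -1 < a -> a <= 0 -> 0 < b ->
  0 < \int[mu]_x tempered_pow a b x.
Proof.
move=> a1 a0 b0; have i := tempered_pow_L1 a1 a0 b0.
(* The value at 2 of a function decreasing on [[1, 2]], hence a lower bound there. *)
pose c : R := 2 `^ a * expR (- (b * 2)).
have c0 : 0 < c by rewrite mulr_gt0 ?powR_gt0 ?expR_gt0.
apply: (@lt_le_trans _ _ (\int[mu]_x (c * \1_(`[1, 2[) x))).
  rewrite RintegralZl//; last exact: integrable_indic_itv.
  rewrite mulr_gt0// /Rintegral integral_indic_itv lebesgue_measure_itv /= lte_fin.
  by rewrite ltr1n /=; lra.
apply: le_Rintegral => //.
  exact: (integrableZl measurableT c (integrable_indic_itv 1 2 true true)).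
move=> x _; rewrite indicE mem_setE in_itv /=.
case: (boolP (_ && _)) => [/andP[x1 x2]|_]; last by rewrite mulr0 tempered_pow_ge0.
have x0 : 0 < x by lra.
rewrite mulr1 tempered_pow_gt0// /c.
apply: ler_pM; rewrite ?powR_ge0 ?expR_ge0//; last first.
  by rewrite ler_expR lerN2 ler_pM2l// ltW.
rewrite -[a]opprK !(powRN _ (- a)) lef_pV2 ?posrE ?powR_gt0//.
by apply: ge0_ler_powR; rewrite ?nnegrE ?oppr_ge0//; lra.
Qed.

Lemma Gamma_gt0 d : - (1 / 2) < d -> d <= 0 -> 0 < Gamma (d + 1) :> R.
Proof.
move=> d1 d0; have d2 : -1 < d by lra.
have := integral_tempered_pow_gt0 d2 d0 ltr01.
move=> /lt_le_trans; apply; rewrite le_eqVlt; apply/orP; left; apply/eqP.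
rewrite /Gamma [RHS]Rintegral_mkcond; apply: eq_Rintegral => x _.
rewrite patchE mem_setE in_itv /= andbT tempered_powE addrK mul1r.
by case: (0 < x); rewrite ?mul1r ?mul0r.
Qed.

(** Euler's Beta integral [B(a + 1, b + 1)], kept as an extended real so that Tonelli can be used
    before its finiteness is known. *)
Definition beta01 a b : \bar R :=
  (\int[mu]_v ((0 < v < 1)%R%:R * (v `^ a * (1 - v) `^ b))%:E)%E.

Lemma measurable_itvoo u t : measurable_fun setT (fun x : R => ((u < x < t)%R%:R : R)).
Proof.
rewrite (_ : (fun x => _) = \1_(`]u, t[)); first exact: measurable_indic.
by apply/funext => x; rewrite indicE mem_setE in_itv.
Qed.

Lemma measurable_beta a b x : measurable_fun setT
  (fun v : R => (0 < v < x)%R%:R * (v `^ a * (x - v) `^ b)).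
Proof.
apply: measurable_funM; first exact: measurable_itvoo.
apply: measurable_funM; first exact: measurable_powR_fun.
have ms : measurable_fun [set: R] (fun v : R => x - v) by exact: measurable_funB.
exact: (measurableT_comp (measurable_powR_fun b) ms).
Qed.

(** Both exponents are at most zero, so the integrand is at least 1 on the open unit interval. For
    finiteness, one of [v] and [1 - v] is at least [1/2], so one factor is at most 2 and only one
    singularity is felt at a time. *)
Lemma beta01_fin a b : -1 < a -> a <= 0 -> -1 < b -> b <= 0 ->
  (0 < beta01 a b < +oo)%E.
Proof.
move=> a1 a0 b1 b0.
have low v : 0 < v < 1 -> 1 <= v `^ a.
  move=> /andP[v0 v1]; have h : 0 < v <= 1 by rewrite v0 ltW.
  by have := ger_powR h a0; rewrite powRr0.
have low' v : 0 < v < 1 -> 1 <= (1 - v) `^ b.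
  move=> /andP[v0 v1]; have h : 0 < 1 - v <= 1 by lra.
  by have := ger_powR h b0; rewrite powRr0.
apply/andP; split.
  apply: (@lt_le_trans _ _ (\int[mu]_v (\1_(`]0, 1[) v)%:E)%E).
    by rewrite integral_indic_itv lebesgue_measure_itv /= lte_fin ltr01 sube0 lte_fin ltr01.
  apply: ge0_le_integral => //.
  - by apply/measurable_EFinP; exact: measurable_indic.
  - by apply/measurable_EFinP; exact: measurable_beta.
  - move=> v _; rewrite lee_fin indicE mem_setE in_itv /=.
    case: (boolP (_ && _)) => [h|_]; last by rewrite mul0r.
    by rewrite mul1r -[1 in leLHS]mulr1; apply: ler_pM => //; [exact: low|exact: low'].
(* 2 bounds the factor away from its singularity; [expR 1] undoes the tempering on [(0, 1)], so that
   the integrability of tempered powers can be reused. *)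
pose C : R := 2 * expR 1.
pose g x := tempered_pow a 1 x; pose g' x := tempered_pow b 1 x.
have lg : L1 g by exact: tempered_pow_L1.
have lg' : L1 (fun v => g' (1 - v)).
  have l := tempered_pow_L1 b1 b0 ltr01.
  have [/measurable_EFinP mb foo] := integrableP _ _ _ l.
  have ms : measurable_fun [set: R] (fun v : R => 1 - v) by exact: measurable_funB.
  apply/integrableP; split; first by apply/measurable_EFinP; exact: (measurableT_comp mb ms).
  apply: le_lt_trans foo; rewrite le_eqVlt; apply/orP; left; apply/eqP.
  have mn : measurable_fun setT (fun v => `|tempered_pow b 1 v|%:E).
    by apply/measurable_EFinP; exact: measurableT_comp.
  rewrite -[RHS](ge0_integral_opp mn)// -[RHS](@ge0_integral_shift _ (-1) (fun v => `|tempered_pow b 1 (- v)|%:E))//.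
    by apply: eq_integral => v _; rewrite /g' opprD opprK addrC.
  apply/measurable_EFinP; apply: measurableT_comp => //.
  exact: (measurableT_comp mb (@oppr_measurable R setT)).
have lsum : L1 (fun v => C * (g v + g' (1 - v))).
  exact: (integrableZl measurableT C (integrableD measurableT lg lg')).
have [_] := integrableP _ _ _ lsum; apply: le_lt_trans.
apply: ge0_le_integral => //.
- by move=> v _; rewrite lee_fin mulr_ge0// mulr_ge0 ?powR_ge0.
- by apply/measurable_EFinP; exact: measurable_beta.
- by apply: measurableT_comp => //; have [] := integrableP _ _ _ lsum.
move=> v _; rewrite /= lee_fin ger0_norm; last first.
  by rewrite mulr_ge0 ?mulr_ge0 ?expR_ge0// addr_ge0 ?tempered_pow_ge0.
have ge0 : 0 <= C * (g v + g' (1 - v)).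
  by rewrite mulr_ge0 ?mulr_ge0 ?expR_ge0// addr_ge0 ?tempered_pow_ge0.
case: (boolP (_ && _)) => [h|_]; last by rewrite mul0r.
have /andP[v0 v1] := h.
have h1 := low v h; have h2 := low' v h.
have gE : v `^ a <= expR 1 * g v.
  rewrite /g tempered_pow_gt0// mulrCA -expRD ler_peMr ?powR_ge0//.
  by rewrite -[leLHS]expR0 ler_expR; lra.
have gE' : (1 - v) `^ b <= expR 1 * g' (1 - v).
  rewrite /g' tempered_pow_gt0 ?subr_gt0// mulrCA -expRD ler_peMr ?powR_ge0//.
  by rewrite -[leLHS]expR0 ler_expR; lra.
have half p (r : R) : -1 < p -> p <= 0 -> 1 / 2 <= r -> r `^ p <= 2.
  move=> p1 p0 r2; rewrite -[p]opprK powRN invf_ple ?posrE ?powR_gt0//; last lra.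
  apply: (@le_trans _ _ (2^-1 `^ (- p))).
    have hh : 0 < (2^-1 : R) <= 1 by apply/andP; split; lra.
    have hp : - p <= 1 by lra.
    by have := ger_powR hh hp; rewrite powRr1//; lra.
  by apply: ge0_ler_powR; rewrite ?nnegrE ?oppr_ge0//; lra.
rewrite mul1r /C -mulrA mulrDr.
have p1 := powR_ge0 v a; have p2 := powR_ge0 (1 - v) b.
have e0 : 0 < expR 1 :> R by exact: expR_gt0.
have q1 : 0 <= expR 1 * g v by rewrite mulr_ge0 ?expR_ge0 ?tempered_pow_ge0.
have q2 : 0 <= expR 1 * g' (1 - v) by rewrite mulr_ge0 ?expR_ge0 ?tempered_pow_ge0.
case: (leP (1 / 2) v) => v2.
  by have := half a v a1 a0 v2; nra.
by have := half b (1 - v) b1 b0 (ltac:(lra)); nra.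
Qed.

End tempered_power.

(** * The kernels of the process have dense span *)

Section kernel.
Variable R : realType.
Notation mu := (leb R).
Notation L1 f := (mu.-integrable setT (EFin \o (f : R -> R))).
Variables (d lam : R).
Hypotheses (hd : - (1 / 2) < d) (hd0 : d < 0) (hlam : 0 < lam).
Implicit Types (x y u v z s t : R).

Let g : R -> R := tempered_pow d lam.
(** The exponents of [g] and [k] add up to [- 1], so that their convolution carries no power of [x];
    the common tempering makes the exponentials multiply to [e^(- lam x)]. *)
Let k : R -> R := tempered_pow (- d - 1) lam.

Let g0 x : 0 <= g x. Proof. exact: tempered_pow_ge0. Qed.
Let k0 x : 0 <= k x. Proof. exact: tempered_pow_ge0. Qed.
Let mg : measurable_fun setT g. Proof. exact: measurable_tempered_pow. Qed.
Let mk : measurable_fun setT k. Proof. exact: measurable_tempered_pow. Qed.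
Let lg : L1 g.
Proof. by apply: tempered_pow_L1 => //; [have := hd; lra|exact: ltW]. Qed.
Let lk : L1 k.
Proof. by apply: tempered_pow_L1 => //; have := hd; have := hd0; lra. Qed.
Let l2g : Lsq mu g.
Proof. by apply: tempered_pow_Lsq => //; exact: ltW. Qed.

Definition ind_le (z x : R) : R := (z <= x)%R%:R.

Lemma ind_le_ge0 z x : 0 <= ind_le z x. Proof. by rewrite /ind_le. Qed.

Lemma measurable_ind_le : measurable_fun [set: R * R] (fun p : R * R => ind_le p.2 p.1).
Proof.
have mi : measurable_fun [set: R] (\1_(`[0, +oo[) : R -> R) by exact: measurable_indic.
have ms : measurable_fun [set: R * R] (fun p : R * R => p.1 - p.2) by exact: measurable_funB.
have := measurableT_comp mi ms; apply: eq_measurable_fun => p _.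
by rewrite /= indicE mem_setE in_itv /= andbT subr_ge0.
Qed.

Lemma measurable_ind_le1 x : measurable_fun setT (fun z => ind_le z x).
Proof.
rewrite (_ : (fun z => _) = \1_(`]-oo, x])); first exact: measurable_indic.
by apply/funext => z; rewrite indicE mem_setE in_itv.
Qed.

(** The primitive of [g] vanishing on the negative half-line, written over the whole line so that
    Tonelli and joint measurability apply. *)
Definition Gc x : R := \int[mu]_z (g z * ind_le z x).

Lemma L1_ind_le (f : R -> R) x : L1 f -> L1 (fun z => f z * ind_le z x).
Proof.
move=> lf; apply: (@L1_mul_bounded _ _ _ 1 lf); first exact: measurable_ind_le1.
by move=> z; rewrite /ind_le; case: (z <= x); rewrite ?normr1 ?normr0.
Qed.

Lemma GcE x : (Gc x)%:E = (\int[mu]_z (g z * ind_le z x)%:E)%E.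
Proof.
rewrite /Gc /Rintegral fineK//.
exact: (integrable_fin_num measurableT (L1_ind_le x lg)).
Qed.

Lemma Gc_ge0 x : 0 <= Gc x.
Proof. by apply: Rintegral_ge0 => z _; rewrite mulr_ge0// ind_le_ge0. Qed.

Lemma measurable_Gc : measurable_fun setT Gc.
Proof.
apply: measurableT_comp => //.
apply: (@measurable_fun_fubini_tonelli_F _ _ _ _ _ mu (fun p : R * R => (g p.2 * ind_le p.2 p.1)%:E)).
  apply/measurable_EFinP; apply: measurable_funM; last exact: measurable_ind_le.
  exact: measurableT_comp.
by move=> p; rewrite lee_fin mulr_ge0// ind_le_ge0.
Qed.

Lemma Gc_diff s t : s <= t -> Gc t - Gc s = \int[mu]_z (g z * (s < z <= t)%R%:R).
Proof.
move=> st; rewrite /Gc -RintegralB//; [|exact: L1_ind_le|exact: L1_ind_le].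
apply: eq_Rintegral => z _; rewrite -mulrBr; congr (_ * _); rewrite /ind_le.
case: (ltP s z) => h1; case: (leP z t) => h2 /=; rewrite ?subr0 ?subrr//.
by have := le_lt_trans (le_trans h1 st) h2; rewrite ltxx.
Qed.

Lemma oriented_GcE t y : oriented_integral 0 t (fun s => g (s - y)) = Gc (t - y) - Gc (- y).
Proof.
have key a b : a <= b -> \int[mu]_(s in `[a, b]) g (s - y) = Gc (b - y) - Gc (a - y).
  move=> ab; rewrite Gc_diff ?lerD2r//.
  have ms : measurable_fun [set: R] (fun s : R => s - y) by exact: measurable_funB.
  have mgs : measurable_fun setT (fun s => g (s - y)) by exact: (measurableT_comp mg ms).
  have li : L1 (fun s => g (s - y)).
    apply/integrableP; split; first exact/measurable_EFinP.
    rewrite (@ge0_integral_shift _ (- y) (fun s => `|g s|%:E))//.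
      by have [] := integrableP _ _ _ lg.
    by apply/measurable_EFinP; exact: measurableT_comp.
  rewrite -Rintegral_itv_obnd_cbnd; last exact: (integrableS measurableT).
  rewrite Rintegral_mkcond /Rintegral.
  have mf : measurable_fun setT (fun z => (g z * (a - y < z <= b - y)%R%:R)%:E).
    apply/measurable_EFinP; apply: measurable_funM => //.
    rewrite (_ : (fun z => _) = \1_(`](a - y), (b - y)])); first exact: measurable_indic.
    by apply/funext => z; rewrite indicE mem_setE in_itv.
  rewrite -(@integral_shift _ (- y) _ mf); congr fine; apply: eq_integral => s _.
  rewrite patchE mem_setE in_itv /= ltrD2r lerD2r.
  by case: (_ && _); rewrite ?mulr1 ?mulr0.
rewrite /oriented_integral; case: leP => t0.
  by rewrite key// sub0r.
by rewrite key ?ltW// sub0r opprB.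
Qed.

Definition hker x : R := g x + lam * Gc x.

Lemma kernelE t y : tflp2_kernel d lam t y = hker (t - y) - hker (- y).
Proof. by rewrite /tflp2_kernel -/g oriented_GcE /hker; ring. Qed.

(** The increment is bounded by [I], the integral of [g], and by Tonelli its own integral is
    [t * I]; a bounded integrable function is square integrable. *)
Lemma Lsq_Gc_diff_pos t : 0 <= t -> Lsq mu (fun y => Gc (t - y) - Gc (- y)).
Proof.
move=> t0; pose D y := Gc (t - y) - Gc (- y).
have ms (c : R) : measurable_fun [set: R] (fun y : R => c - y) by exact: measurable_funB.
have mD : measurable_fun setT D.
  apply: measurable_funB; first exact: (measurableT_comp measurable_Gc (ms t)).
  exact: (measurableT_comp measurable_Gc (@oppr_measurable R setT)).
pose I := \int[mu]_z g z.
have DE y : D y = \int[mu]_z (g z * (- y < z <= t - y)%R%:R).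
  by rewrite /D Gc_diff// lerBrDr addrC subrr.
have mi y : measurable_fun setT (fun z => ((- y < z <= t - y)%R%:R : R)).
  rewrite (_ : (fun z => _) = \1_(`](- y), (t - y)])); first exact: measurable_indic.
  by apply/funext => z; rewrite indicE mem_setE in_itv.
have li y : L1 (fun z => g z * (- y < z <= t - y)%R%:R).
  apply: (@L1_mul_bounded _ _ _ 1 lg); first exact: mi.
  by move=> z; case: (_ && _); rewrite ?normr1 ?normr0.
have D0 y : 0 <= D y by rewrite DE; apply: Rintegral_ge0 => z _; rewrite mulr_ge0.
have DI y : D y <= I.
  rewrite DE; apply: le_Rintegral => // z _.
  by rewrite -[leRHS]mulr1 ler_wpM2l//; case: (_ && _).
have I0 : 0 <= I := le_trans (D0 0) (DI 0).
apply/LsqP; split => //.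
apply: (@le_lt_trans _ _ (\int[mu]_y (I%:E * (D y)%:E))%E).
  apply: ge0_le_integral => //.
  - by move=> y _; rewrite lee_fin sqr_ge0.
  - by apply/measurable_EFinP; exact: measurable_funX.
  - by apply: emeasurable_funM => //; exact/measurable_EFinP.
  - by move=> y _; rewrite -EFinM lee_fin -/(D y) expr2 ler_wpM2r.
rewrite ge0_integralZl//; [|exact/measurable_EFinP|by move=> y _; rewrite lee_fin].
apply: lte_mul_pinfty; rewrite ?lee_fin//.
have DEE y : (D y)%:E = (\int[mu]_z (g z * (- y < z <= t - y)%R%:R)%:E)%E.
  by rewrite DE /Rintegral fineK//; exact: (integrable_fin_num measurableT (li y)).
under eq_integral do rewrite DEE.
have mF : measurable_fun [set: R * R] (fun p : R * R => (g p.2 * (- p.1 < p.2 <= t - p.1)%R%:R)%:E).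
  apply/measurable_EFinP; apply: measurable_funM; first exact: measurableT_comp.
  have mi0 : measurable_fun [set: R] (\1_(`]0, t]) : R -> R) by exact: measurable_indic.
  have ma : measurable_fun [set: R * R] (fun p : R * R => p.2 + p.1) by exact: measurable_funD.
  have := measurableT_comp mi0 ma; apply: eq_measurable_fun => p _.
  by rewrite /= indicE mem_setE in_itv /= -lerBrDr -ltrBlDr sub0r.
rewrite (@fubini_tonelli _ _ _ _ _ mu mu
  (fun p : R * R => (g p.2 * (- p.1 < p.2 <= t - p.1)%R%:R)%:E) mF) /=; last first.
  by move=> p; rewrite lee_fin mulr_ge0.
(* For fixed [z] the admissible [y] form the interval from [- z] to [t - z], of length [t]. *)
rewrite (_ : (\int[mu]_y _)%E = (\int[mu]_z ((g z)%:E * t%:E))%E).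
  rewrite ge0_integralZr//; [|exact/measurable_EFinP|by move=> z _; rewrite lee_fin].
  have [_ foo] := integrableP _ _ _ lg.
  have gi : (\int[mu]_z (g z)%:E < +oo)%E.
    by apply: le_lt_trans foo; apply: ge0_le_integral => //;
     [by move=> z _; rewrite lee_fin|exact/measurable_EFinP
     |by apply/measurable_EFinP; exact: measurableT_comp
     |by move=> z _; rewrite lee_fin ler_norm].
  rewrite muleC; apply: lte_mul_pinfty; rewrite ?lee_fin//.
apply: eq_integral => z _; under eq_integral do rewrite EFinM.
rewrite ge0_integralZl//.
- congr (_ * _)%E.
  transitivity (\int[mu]_y (\1_([set` `](- z), (t - z)]]) y)%:E)%E.
    apply: eq_integral => y _; rewrite indicE mem_setE in_itv /=; congr (_%:R%:E); congr nat_of_bool.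
    by rewrite ltrNl lerBrDr addrC -lerBrDr.
  rewrite integral_indic_itv lebesgue_measure_itv /= lte_fin; case: ltP => h.
    by rewrite -EFinB; congr EFin; ring.
  by congr EFin; move: h; lra.
- apply/measurable_EFinP.
  rewrite (_ : (fun y => _) = \1_(`](- z), (t - z)])); first exact: measurable_indic.
  apply/funext => y; rewrite indicE mem_setE in_itv /=; congr (_%:R); congr nat_of_bool.
  by rewrite ltrNl lerBrDr addrC -lerBrDr.
- by rewrite lee_fin.
Qed.

Lemma Lsq_Gc_diff t : Lsq mu (fun y => Gc (t - y) - Gc (- y)).
Proof.
case: (leP 0 t) => t0; first exact: Lsq_Gc_diff_pos.
have nt : 0 <= - t by rewrite oppr_ge0 ltW.
have := LsqN (Lsq_shift (- t) (Lsq_Gc_diff_pos nt)).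
congr Lsq; apply/funext => y; rewrite fctE opprB.
by congr (Gc _ - Gc _); ring.
Qed.

Lemma Lsq_kernel t : Lsq mu (tflp2_kernel d lam t).
Proof.
have h1 : Lsq mu (fun y => g (- y)) := Lsq_opp l2g.
have h2 : Lsq mu (fun y => g (t - y)).
  have := Lsq_shift (- t) h1; congr Lsq; apply/funext => y.
  by rewrite opprD opprK addrC.
have h3 := LsqZ lam (Lsq_Gc_diff t).
have := LsqD (LsqB h2 h1) h3; congr Lsq; apply/funext => y.
by rewrite kernelE /hker !fctE /=; ring.
Qed.

(** The exponentials combine to [e^(- lam x)]; the substitution [u = x v] produces [x^(- d - 1) x^d]
    times the Jacobian [x], which is 1, and leaves the Beta integral. *)
Lemma conv_kg x : (\int[mu]_u (k u * g (x - u))%:E =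
  beta01 (- d - 1) d * ((0 < x)%R%:R * expR (- (lam * x)))%:E)%E.
Proof.
case: (ltP 0 x) => x0; last first.
  rewrite mul0r mule0 integral0_eq// => u _; congr EFin.
  case: (leP u 0) => u0; first by rewrite /k tempered_pow_le0 ?mul0r.
  by rewrite /g tempered_pow_le0 ?mulr0// subr_le0 (le_trans x0)// ltW.
pose f u : R := expR (- (lam * x)) * ((0 < u < x)%R%:R * (u `^ (- d - 1) * (x - u) `^ d)).
have E u : k u * g (x - u) = f u.
  rewrite /k /g /f !tempered_powE subr_gt0.
  case: (ltP 0 u) => u0; last by rewrite !mul0r mulr0.
  case: (ltP u x) => ux; last by rewrite !mul0r !mulr0.
  have -> : expR (- (lam * x)) = expR (- (lam * u)) * expR (- (lam * (x - u))) :> R.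
    by rewrite -expRD; congr expR; ring.
  by rewrite /= !mul1r; ring.
under eq_integral do rewrite E.
have mf : measurable_fun setT (EFin \o f).
  by apply/measurable_EFinP; apply: measurable_funM => //; exact: measurable_beta.
have f0 u : (0 <= (EFin \o f) u)%E.
  by rewrite lee_fin mulr_ge0 ?expR_ge0// mulr_ge0// mulr_ge0 ?powR_ge0.
rewrite -(ge0_integral_scale x0 mf f0) mul1r /beta01 muleC.
have mb := measurable_beta (- d - 1) d 1.
pose b01 v : R := (0 < v < 1)%R%:R * (v `^ (- d - 1) * (1 - v) `^ d).
have b0 v : 0 <= b01 v by rewrite mulr_ge0// mulr_ge0 ?powR_ge0.
have fx v : f (x * v) = x^-1 * expR (- (lam * x)) * b01 v.
  rewrite /f /b01 pmulr_rgt0// -[X in x * v < X]mulr1 ltr_pM2l//.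
  case: (boolP (_ && _)) => [/andP[v0 v1]|_]; last by rewrite !mul0r !mulr0.
  rewrite -[X in X - x * v]mulr1 -mulrBr !powRM ?(ltW x0) ?(ltW v0) ?subr_ge0 ?(ltW v1)//.
  have xx : x `^ (- d - 1) * x `^ d = x^-1.
    rewrite -powRD; last by apply/implyP => _; rewrite gt_eqF.
    by rewrite (_ : - d - 1 + d = -1) ?powR_inv1 ?ltW//; ring.
  by rewrite -xx; ring.
under eq_integral => v _ do rewrite /= fx EFinM.
rewrite ge0_integralZl//.
- by rewrite muleC muleA -EFinM mulrA mulfV ?gt_eqF// mul1r muleC.
- exact/measurable_EFinP.
- by move=> v _; rewrite lee_fin.
- by rewrite lee_fin mulr_ge0 ?expR_ge0// invr_ge0 ltW.
Qed.

Lemma integral_expN_itv x : 0 < x ->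
  (\int[mu]_(v in `[0%R, x]) (expR (- (lam * v)))%:E = ((1 - expR (- (lam * x))) / lam)%:E)%E.
Proof.
move=> x0.
have dF v : is_derive v 1 (fun v => - lam^-1 * expR (- (lam * v))) (expR (- (lam * v))).
  have dl : is_derive v 1 (fun v => - (lam * v)) (- lam).
    apply: is_deriveN; have h := is_deriveZ lam (is_derive_id v (1 : R)).
    by apply: is_derive_eq h _; rewrite /GRing.scale /= mulr1.
  have h := is_deriveZ (- lam^-1) (@is_derive1_comp R expR (fun v => - (lam * v)) v _ _ (is_derive_expR _) dl).
  by apply: is_derive_eq h _; rewrite /GRing.scale /=; field; rewrite gt_eqF.
have cF : continuous (fun v : R => - lam^-1 * expR (- (lam * v))).
  by move=> v; apply: differentiable_continuous; apply/derivable1_diffP; have [] := dF v.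
rewrite (@continuous_FTC2 _ _ (fun v => - lam^-1 * expR (- (lam * v))) 0 x)//.
- by rewrite mulr0 oppr0 expR0 -EFinB; congr EFin; field; rewrite gt_eqF.
- apply: continuous_subspaceT => v; apply: continuous_comp; last exact: continuous_expR.
  by apply: cvgN; apply: cvgM; [exact: cvg_cst|exact: cvg_id].
- split.
  + by move=> v _; have [] := dF v.
  + by apply: cvg_at_right_filter; exact: cF.
  + by apply: cvg_at_left_filter; exact: cF.
- by move=> v _; rewrite derive1E; have [_ ->] := dF v.
Qed.

Let sub_measurable (c : R) : measurable_fun [set: R] (fun u : R => c - u).
Proof. exact: measurable_funB. Qed.

(** By Tonelli, convolving [k] with a primitive of [g] gives the primitive of the convolution in
    [conv_kg]. Multiplied by [lam], its exponential cancels the one of [conv_kg]. *)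
Lemma conv_kG x : (\int[mu]_u (k u * Gc (x - u))%:E =
  beta01 (- d - 1) d * ((0 < x)%R%:R * ((1 - expR (- (lam * x))) / lam))%:E)%E.
Proof.
pose F (p : R * R) := (k p.1 * (g (p.2 - p.1) * ind_le p.2 x))%:E.
have mF : measurable_fun setT F.
  apply/measurable_EFinP; apply: measurable_funM; first exact: measurableT_comp.
  apply: measurable_funM.
    have ms : measurable_fun [set: R * R] (fun p : R * R => p.2 - p.1) by exact: measurable_funB.
    exact: (measurableT_comp mg ms).
  have m2 : measurable_fun [set: R * R] (fun p : R * R => p.2) by exact: measurable_snd.
  exact: (measurableT_comp (measurable_ind_le1 x) m2).
have F0 p : (0 <= F p)%E by rewrite lee_fin mulr_ge0// mulr_ge0// ind_le_ge0.
transitivity (\int[mu]_u \int[mu]_v F (u, v))%E.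
  apply: eq_integral => u _; rewrite EFinM GcE.
  have m1 : measurable_fun setT (fun z => (g z * ind_le z (x - u))%:E).
    by apply/measurable_EFinP; apply: measurable_funM => //; exact: measurable_ind_le1.
  rewrite -(@ge0_integral_shift _ (- u) _ m1); last first.
    by move=> z; rewrite lee_fin mulr_ge0// ind_le_ge0.
  rewrite -ge0_integralZl//.
  - apply: eq_integral => v _; rewrite /F /= -EFinM; congr (_ * (_ * _))%:E.
    by rewrite /ind_le lerD2r.
  - apply/measurable_EFinP; apply: measurable_funM.
      by apply: (measurableT_comp mg); exact: measurable_funB.
    rewrite (_ : (fun v => _) = (fun v => ind_le v x)); first exact: measurable_ind_le1.
    by apply/funext => v; rewrite /ind_le lerD2r.
  - by move=> v _; rewrite lee_fin mulr_ge0// ind_le_ge0.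
  - by rewrite lee_fin.
transitivity (\int[mu]_v \int[mu]_u F (u, v))%E.
  exact: (@fubini_tonelli _ _ _ _ _ mu mu F mF F0).
pose w v : R := ind_le v x * ((0 < v)%R%:R * expR (- (lam * v))).
have w0 v : 0 <= w v by rewrite mulr_ge0 ?ind_le_ge0// mulr_ge0// expR_ge0.
have mexp : measurable_fun setT (fun v : R => expR (- (lam * v))).
  apply: measurableT_comp; first exact: measurable_expR.
  by apply: measurableT_comp => //; exact: measurable_funM.
have mw : measurable_fun setT w.
  apply: measurable_funM; first exact: measurable_ind_le1.
  by apply: measurable_funM => //; exact: measurable_lt0.
have B0 : (0 <= beta01 (- d - 1) d)%E.
  by apply: integral_ge0 => v _; rewrite lee_fin mulr_ge0// mulr_ge0 ?powR_ge0.
transitivity (\int[mu]_v (beta01 (- d - 1) d * (w v)%:E))%E.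
  apply: eq_integral => v _.
  transitivity ((ind_le v x)%:E * \int[mu]_u (k u * g (v - u))%:E)%E.
    rewrite -ge0_integralZl//.
    - by apply: eq_integral => u _; rewrite /F /= -EFinM; congr EFin; ring.
    - apply/measurable_EFinP; apply: measurable_funM => //.
      exact: (measurableT_comp mg (sub_measurable v)).
    - by move=> u _; rewrite lee_fin mulr_ge0.
    - by rewrite lee_fin ind_le_ge0.
  by rewrite conv_kg /w muleCA -EFinM.
rewrite ge0_integralZl//; [|exact/measurable_EFinP|by move=> v _; rewrite lee_fin].
congr (_ * _)%E.
transitivity (\int[mu]_(v in `]0%R, x]) (expR (- (lam * v)))%:E)%E.
  rewrite [RHS]integral_mkcond; apply: eq_integral => v _.
  rewrite patchE mem_setE in_itv /= /w /ind_le.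
  by case: (0 < v); case: (v <= x); rewrite ?mul1r ?mul0r ?mulr0.
case: (ltP 0 x) => x0; last first.
  by rewrite mul0r set_itv_ge ?integral_set0// bnd_simp -leNgt.
rewrite mul1r -integral_expN_itv//.
by rewrite integral_itv_obnd_cbnd//; apply/measurable_funTS/measurable_EFinP.
Qed.

Definition beta_const : R := fine (beta01 (- d - 1) d).

Lemma beta_constE : beta01 (- d - 1) d = beta_const%:E.
Proof.
have /andP[b0 boo] : (0 < beta01 (- d - 1) d < +oo)%E.
  by apply: beta01_fin; have := hd; have := hd0; lra.
by rewrite /beta_const fineK// ge0_fin_numE// ltW.
Qed.

Lemma beta_const_gt0 : 0 < beta_const.
Proof.
have /andP[b0 _] : (0 < beta01 (- d - 1) d < +oo)%E.
  by apply: beta01_fin; have := hd; have := hd0; lra.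
by rewrite -lte_fin -beta_constE.
Qed.

Lemma hker_ge0 x : 0 <= hker x.
Proof. by rewrite addr_ge0// mulr_ge0 ?Gc_ge0// ltW. Qed.

Lemma measurable_hker : measurable_fun setT hker.
Proof.
apply: measurable_funD => //; apply: measurable_funM => //; exact: measurable_Gc.
Qed.

(* In Laplace transforms this is
   [(p + lam)^d * ((p + lam)^(- d - 1) * (1 + lam / p)) = 1 / p]. *)
Lemma conv_kh x : (\int[mu]_u (k u * hker (x - u))%:E = (beta_const * (0 < x)%R%:R)%:E)%E.
Proof.
have mgx := measurableT_comp mg (sub_measurable x).
have mGx := measurableT_comp measurable_Gc (sub_measurable x).
transitivity (\int[mu]_u ((k u * g (x - u))%:E + lam%:E * (k u * Gc (x - u))%:E))%E.
  by apply: eq_integral => u _; rewrite -EFinM -EFinD /hker; congr EFin; ring.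
rewrite ge0_integralD//.
- rewrite ge0_integralZl//.
  + rewrite conv_kg conv_kG beta_constE -!EFinM -EFinD; congr EFin.
    by case: (ltP 0 x) => x0; rewrite ?mul0r ?mulr0 ?addr0//= !mul1r; field; rewrite gt_eqF.
  + by apply/measurable_EFinP; apply: measurable_funM.
  + by move=> u _; rewrite lee_fin mulr_ge0// Gc_ge0.
  + by rewrite lee_fin ltW.
- by move=> u _; rewrite lee_fin mulr_ge0.
- by apply/measurable_EFinP; apply: measurable_funM.
- by move=> u _; rewrite mule_ge0// lee_fin ?(ltW hlam)// mulr_ge0// Gc_ge0.
- by apply: emeasurable_funM => //; apply/measurable_EFinP; apply: measurable_funM.
Qed.

Lemma L1_conv_kh x : L1 (fun u => k u * hker (x - u)).
Proof.
have mh := measurableT_comp measurable_hker (sub_measurable x).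
apply/integrableP; split; first by apply/measurable_EFinP; apply: measurable_funM.
rewrite (_ : (\int[mu]_u _)%E = (\int[mu]_u (k u * hker (x - u))%:E)%E).
  by rewrite conv_kh ltry.
by apply: eq_integral => u _; rewrite /= ger0_norm// mulr_ge0// hker_ge0.
Qed.

Lemma Rconv_kh x : \int[mu]_u (k u * hker (x - u)) = beta_const * (0 < x)%R%:R.
Proof. by rewrite /Rintegral conv_kh. Qed.

(** The orthogonality relations at the times [t - u] and [s - u] are averaged over [u] with weight
    [k]. Fubini moves the average onto the kernels, where [Rconv_kh] turns it into a positive
    multiple of the indicator of [[s, t)]. *)
Lemma kernel_perp (phi : R -> R) : Lsq mu phi ->
  (forall s t, s <= t ->
     L2dot mu phi (tflp2_kernel d lam t - tflp2_kernel d lam s) = 0) ->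
  phi = 0 %[ae mu].
Proof.
move=> lphi perp; apply: indic_perp => // s t st.
pose D : R -> R := tflp2_kernel d lam t - tflp2_kernel d lam s.
have lD : Lsq mu D by apply: LsqB; exact: Lsq_kernel.
have DE y : D y = hker (t - y) - hker (s - y) by rewrite /D !fctE !kernelE; ring.
have DuE u y : D (y + u) = hker (t - y - u) - hker (s - y - u).
  by rewrite DE !opprD !addrA.
pose F (p : R * R) := k p.1 * (phi p.2 * D (p.2 + p.1)).
have mphi := Lsq_measurable lphi; have mD := Lsq_measurable lD.
have mF : measurable_fun setT F.
  apply: measurable_funM; first exact: measurableT_comp.
  apply: measurable_funM; first exact: measurableT_comp.
  have ma : measurable_fun [set: R * R] (fun p : R * R => p.2 + p.1) by exact: measurable_funD.
  exact: (measurableT_comp mD ma).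
pose C := sqn mu phi + sqn mu D.
have C0 : 0 <= C by rewrite addr_ge0 ?sqn_ge0.
have lDu u : Lsq mu (fun y => D (y + u)) by exact: Lsq_shift.
have ipD u := L2dot_integrable lphi (lDu u).
(* [C] does not depend on [u], since translation preserves the norm of [D]; with [k] integrable this
   gives the integrability of [F] needed for Fubini. *)
have pDC u : \int[mu]_y `|phi y * D (y + u)| <= C.
  apply: (@le_trans _ _ (\int[mu]_y (phi y * phi y + D (y + u) * D (y + u)))).
    apply: le_Rintegral => //; first exact: integrable_norm.
      by apply: eq_integrable (integrableD measurableT (L2dot_integrable lphi lphi) (L2dot_integrable (lDu u) (lDu u))).
    move=> y _; rewrite normrM -!expr2 -[X in _ <= X + _]real_normK ?num_real//.
    rewrite -[X in _ <= _ + X]real_normK ?num_real//.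
    have := normr_ge0 (phi y); have := normr_ge0 (D (y + u)).
    by have := sqr_ge0 (`|phi y| - `|D (y + u)|); nra.
  have E : \int[mu]_y (D (y + u) * D (y + u)) = sqn mu D by exact: (sqn_shift u lD).
  rewrite (RintegralD measurableT (L2dot_integrable lphi lphi) (L2dot_integrable (lDu u) (lDu u))).
  by rewrite [X in _ + X <= _]E.
have iF : (mu \x mu)%E.-integrable setT (EFin \o F).
  apply/integrable12ltyP; first exact/measurable_EFinP.
  apply: (@le_lt_trans _ _ (\int[mu]_u ((k u)%:E * C%:E))%E); last first.
    rewrite ge0_integralZr//; [|exact/measurable_EFinP|by move=> u _; rewrite lee_fin].
    rewrite muleC; apply: lte_mul_pinfty; rewrite ?lee_fin//.
    have [_ foo] := integrableP _ _ _ lk; apply: le_lt_trans foo.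
    apply: ge0_le_integral => //.
    - by move=> u _; rewrite lee_fin.
    - exact/measurable_EFinP.
    - by apply/measurable_EFinP; exact: measurableT_comp.
    - by move=> u _; rewrite lee_fin ler_norm.
  apply: ge0_le_integral => //.
  - by move=> u _; exact: integral_ge0.
  - apply: (@measurable_fun_fubini_tonelli_F _ _ _ _ _ mu (fun p => `|(F p)%:E|%E)) => //.
    by apply/measurable_EFinP; exact: measurableT_comp.
  - by apply: emeasurable_funM => //; exact/measurable_EFinP.
  move=> u _; under eq_integral => y _ do rewrite /F /= normrM EFinM (ger0_norm (k0 u)).
  have mpD : measurable_fun setT (fun y => `|phi y * D (y + u)|%:E).
    have [/measurable_EFinP m _] := integrableP _ _ _ (ipD u).
    by apply/measurable_EFinP; exact: measurableT_comp.
  rewrite ge0_integralZl//; last by rewrite lee_fin.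
  apply: lee_wpmul2l; first by rewrite lee_fin.
  have := pDC u; rewrite -lee_fin; apply: le_trans; rewrite /Rintegral fineK//.
  by apply: (integrable_fin_num measurableT); exact: integrable_norm.
(* In [D] the terms [hker (- y)] of the two kernels cancel, so translating by [u] amounts to moving
   both times by [- u], and [perp] applies. *)
have h1 : \int[mu]_u \int[mu]_y F (u, y) = 0.
  rewrite (@eq_Rintegral _ _ _ mu _ (cst 0)); first by rewrite /Rintegral integral0.
  move=> u _; rewrite /F /= RintegralZl//.
  rewrite [X in _ * X](_ : _ = L2dot mu phi (tflp2_kernel d lam (t - u) - tflp2_kernel d lam (s - u))).
    by rewrite perp ?mulr0// lerD2r.
  apply: eq_Rintegral => y _; congr (_ * _).
  by rewrite DuE !fctE !kernelE (addrAC t) (addrAC s); ring.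
have h2 := etrans (esym (RFubini iF)) h1.
suff h3 : \int[mu]_y \int[mu]_u F (u, y) = beta_const * L2dot mu phi \1_(`[s, t[).
  by move/eqP: (etrans (esym h3) h2); rewrite mulf_eq0 gt_eqF ?beta_const_gt0//= => /eqP.
rewrite /L2dot -RintegralZl//; last by apply: L2dot_integrable => //; exact: Lsq_indic.
apply: eq_Rintegral => y _; rewrite /F /=.
transitivity (phi y * (\int[mu]_u (k u * hker (t - y - u)) - \int[mu]_u (k u * hker (s - y - u)))).
  rewrite -(RintegralB measurableT (L1_conv_kh _) (L1_conv_kh _)).
  rewrite -RintegralZl//.
    by apply: eq_Rintegral => u _; rewrite DuE; ring.
  by apply: eq_integrable (integrableB measurableT (L1_conv_kh _) (L1_conv_kh _)).
rewrite !Rconv_kh !subr_gt0 indicE mem_setE in_itv /= mulrCA -mulrBr; congr (_ * (_ * _)).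
case: (ltP y s) => h; case: (ltP y t) => h' /=; rewrite ?subrr ?subr0//.
by have := lt_le_trans h (le_trans st h'); rewrite ltxx.
Qed.

End kernel.

(** * The isometry *)

Section span_of_tflp2.
Context disp (Om : measurableType disp) (R : realType) (P : probability Om R).
Variables (L : R -> Om -> R) (c : R).
Hypothesis lL : forall t, Lsq P (L t).
Hypothesis Lincr : forall s t, sqn P (L t - L s) = c * `|t - s|.
Hypothesis c0 : 0 < c.
Variables (d lam : R).
Hypotheses (hd : - (1 / 2) < d) (hd0 : d < 0) (hlam : 0 < lam).
Notation mu := (leb R).

(** The factor [(Gamma (d + 1))^-1] is absorbed into the kernels; being nonzero, it does not affect
    orthogonality. *)
Lemma Sp_closureP X : Sp_closure P L d lam X <-> exists f, wiener_rel P L f X.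
Proof.
pose c1 := (Gamma (d + 1))^-1; pose K t := c1 \*o tflp2_kernel d lam t.
have G0 : 0 < Gamma (d + 1) :> R by apply: Gamma_gt0 => //; exact: ltW.
have lK0 t : Lsq mu (tflp2_kernel d lam t) by exact: Lsq_kernel.
apply: (wiener_span_closure lL Lincr c0 (K := K)) => [t|f lf perp].
  have := wiener_lin lL c1 (wiener_integralP lL Lincr (lK0 t)) (wiener0 lL Lincr).
  by rewrite !addr0.
apply: (kernel_perp hd hd0 hlam lf) => s t st.
have := perp s t st.
have -> : K t - K s = c1 \*o (tflp2_kernel d lam t - tflp2_kernel d lam s).
  by apply/funext => y; rewrite !fctE /K /= mulrBr.
rewrite L2dotZr//; last exact: LsqB.
by move/eqP; rewrite mulf_eq0 invr_eq0 gt_eqF//= => /eqP.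
Qed.

End span_of_tflp2.

Section isometry.
Context disp (Om : measurableType disp) (R : realType) (P : probability Om R).
Variables (L : R -> Om -> R) (c : R).
Hypothesis lL : forall t, Lsq P (L t).
Hypothesis Lincr : forall s t, sqn P (L t - L s) = c * `|t - s|.
Hypothesis c0 : 0 < c.
Variables (d lam : R).
Hypotheses (hd : - (1 / 2) < d) (hd0 : d < 0) (hlam : 0 < lam).
Notation mu := (leb R).
Notation td := (tempered_deriv lam (- d)).

Lemma A2_tempered_deriv f : A2 d lam f -> is_tempered_deriv lam (- d) f (td f).
Proof. by move=> [_ [phi fphi]]; rewrite /tempered_deriv; case: xgetP => [//|/(_ phi)]. Qed.

Lemma A2_isometric : isometric mu (A2 d lam) (A2dot d lam) P (Sp_closure P L d lam) (L2dot P).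
Proof.
have nd0 : 0 < - d by rewrite oppr_gt0.
pose r := (Num.sqrt c)^-1; have r0 : 0 < r by rewrite invr_gt0 sqrtr_gt0.
have rc : r ^+ 2 * c = 1 by rewrite exprVn sqr_sqrtr ?ltW// mulVf// gt_eqF.
have ltd f : A2 d lam f -> Lsq mu (td f) by move=> /A2_tempered_deriv[].
pose U f : Om -> R := r \*o wiener_integral P L (td f).
(* Seen as the Wiener integral of [r] times the derivative, [U f] falls under the a.e. injectivity,
   linearity and inner product lemmas for [wiener_rel]. *)
have UP f : A2 d lam f -> wiener_rel P L (r \*o td f) (U f).
  move=> Af; have := wiener_lin lL r (wiener_integralP lL Lincr (ltd f Af)) (wiener0 lL Lincr).
  by rewrite !addr0.
have aeZ (a : R) (u v : R -> R) : u = v %[ae mu] -> a \*o u = a \*o v %[ae mu].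
  by apply: ae_mono => x h _ /=; rewrite h.
have aeZr (u v : R -> R) : (r \*o u = r \*o v %[ae mu]) <-> (u = v %[ae mu]).
  split; last exact: aeZ.
  by apply: ae_mono => x h _; apply: (mulfI (lt0r_neq0 r0)); exact: h.
exists U; split.
- move=> f Af; apply/(Sp_closureP lL Lincr c0 hd hd0 hlam).
  by exists (r \*o td f); exact: UP.
- move=> f g Af Ag; have e1 := tempered_deriv_ae hlam (A2_tempered_deriv Af) (A2_tempered_deriv Ag).
  exact: (iff_trans (iff_trans e1 (iff_sym (aeZr _ _))) (wiener_ae_eq lL Lincr c0 (UP f Af) (UP g Ag))).
- move=> h /(Sp_closureP lL Lincr c0 hd hd0 hlam)[phi phih].
  have [lphi _ _] := phih.
  (* [U] rescales by [r], so the derivative of the preimage must be [r^-1] times [phi]. *)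
  have [f W2f fphi] := tempered_deriv_onto hlam nd0 (LsqZ r^-1 lphi).
  have Af : A2 d lam f by split => //; exists (r^-1 \*o phi).
  exists f => //; apply/(wiener_ae_eq lL Lincr c0 (UP f Af) phih).
  have : td f = r^-1 \*o phi %[ae mu].
    have e1 := (tempered_deriv_ae hlam (A2_tempered_deriv Af) fphi).1.
    by apply: e1; exact: aeW.
  by apply: ae_mono => x e _ /=; rewrite e//= mulVKf// gt_eqF.
- move=> a f g Af Ag.
  have lin := tempered_deriv_lin a (A2_tempered_deriv Af) (A2_tempered_deriv Ag).
  have Afg : A2 d lam (a \*o f + g).
    by split; [exact: (tempered_deriv_W2 lin)|exists (a \*o td f + td g)].
  have tdE : td (a \*o f + g) = a \*o td f + td g %[ae mu].
    by apply: (tempered_deriv_ae hlam (A2_tempered_deriv Afg) lin).1; exact: aeW.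
  apply/(wiener_ae_eq lL Lincr c0 (UP _ Afg) (wiener_lin lL a (UP f Af) (UP g Ag))).
  by move: tdE; apply: ae_mono => x e _; rewrite /= e// !fctE /=; ring.
- move=> f g Af Ag; rewrite (wiener_dot lL Lincr (UP f Af) (UP g Ag)).
  rewrite L2dotZl ?L2dotZr//; [|exact: ltd|exact: ltd|exact: ltd|exact/LsqZ/ltd].
  by rewrite /A2dot !mulrA -(mulrA c) -expr2 (mulrC c) rc mul1r.
Qed.

End isometry.
Theorem theorem3p11 (R : realType)
    (disp : measure_display) (Om : measurableType disp) (P : probability Om R)
    (nu : {measure set (measurableTypeR R) -> \bar R})
    (hnu : levy_measure nu)
    (hnu0 : nu [set: measurableTypeR R] <> 0%E)
    (L1 L2 : R -> Om -> R)
    (hL : independent_levy_copies P nu L1 L2)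
    (d lam : R) (hd : - (1 / 2) < d) (hd0 : d < 0) (hlam : 0 < lam) :
  isometric (leb R) (A2 d lam) (A2dot d lam)
            P (Sp_closure P (two_sided L1 L2) d lam) (L2dot P).
Proof.
have lX t := two_sided_Lsq hnu hL t.
(* [hnu0] enters through the positivity of the variance: for [nu = 0] the process is almost surely
   zero and its span trivial, while the space of integrands is not. *)
exact: (A2_isometric lX (two_sided_increment hnu hL) (levy_var_gt0 hnu hnu0) hd hd0 hlam).
Qed.
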